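(* Let $\phi,\psi,F,G$ and the parameters be as in the context. Suppose that for all $x>0$ $$\sum_{n=1}^\infty a_nY_{\boldsymbol\alpha,\boldsymbol\beta}(\lambda_nx)=P_1(x)+\frac{\omega}{(xQ)^\delta}\sum_{n=1}^\infty\bar b_nX_{\boldsymbol\alpha,\bar{\boldsymbol\beta}}\Big(\frac{\mu_n}{Q^2x}\Big),$$ where $P_1$ is a residual function and, for $x,a>0$, $Y_{\boldsymbol\alpha,\boldsymbol\beta}(x)=\frac{1}{2\pi i}\int_{a-i\infty}^{a+i\infty}\Gamma(s)\prod_{i=1}^r\Gamma(\alpha_is+\beta_i)x^{-s}ds$ and $X_{\boldsymbol\alpha,\bar{\boldsymbol\beta}}(x)=\frac{1}{2\pi i}\int_{a-i\infty}^{a+i\infty}\Gamma(\delta-s)\prod_{i=1}^r\Gamma(\alpha_is+\bar\beta_i)x^{-s}ds$. Then the functional equation $Q^sF(s)=\omega Q^{\delta-s}\overline{G(\delta-\bar s)}$ holds, i.e. the two sides are analytic continuations of one another.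
   Context: Let $(\lambda_n)$, $(\mu_n)$ be strictly increasing sequences of real numbers tending to $\infty$, $(a_n)$, $(b_n)$ complex sequences not identically zero, $\phi(s)=\sum a_n\lambda_n^{-s}$, $\psi(s)=\sum b_n\mu_n^{-s}$ with finite abscissae of absolute convergence $\sigma_a,\sigma_b$. Fix $r\in\mathbb N$, $\alpha_i>0$, $\beta_i\in\mathbb C$ with $\Re\beta_i\ge0$, $Q>0$, $|\omega|=1$, $\delta>0$; $F(s)=\phi(s)\prod_{i=1}^r\Gamma(\alpha_is+\beta_i)$, $G(s)=\psi(s)\prod_{i=1}^r\Gamma(\alpha_is+\beta_i)$, $\boldsymbol\alpha=(\alpha_i)$, $\boldsymbol\beta=(\beta_i)$, $\bar{\boldsymbol\beta}=(\bar\beta_i)$. A residual function is a $P$ on $(0,\infty)$, differentiable, with $P(x)=O(x^{-c})$ as $x\to0$ and $O(x^c)$ as $x\to\infty$ for some $c>0$, such that $\int_0^1P(x)x^{s-1}dx$ (right half-plane) and $-\int_1^\infty P(x)x^{s-1}dx$ (left half-plane) continue analytically into each other in a domain which is the exterior of a compact set, the continuation tending to $0$ as $|\Im s|\to\infty$ uniformly in vertical strips. *)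

(* Defs.v *)
From Stdlib Require Import Reals List ZArith.
From Coquelicot Require Import Coquelicot.
Open Scope R_scope.

(* Complex exponential and powers [x ^ z := exp (z ln x)] of a positive base;
   [Rcpow] is only meaningful for [0 < x]. *)
Definition Cexp (z : C) : C :=
  (exp (Re z) * cos (Im z), exp (Re z) * sin (Im z)).

Definition Rcpow (x : R) (z : C) : C := Cexp (z * RtoC (ln x))%C.

(* [f 0 * ... * f (n - 1)]; note that [n] factors are taken. *)
Fixpoint Cprod (f : nat -> C) (n : nat) : C :=
  match n with
  | O => RtoC 1
  | S m => (Cprod f m * f m)%C
  end.

(* Value of a convergent complex series (unspecified otherwise), in the same
   style as Coquelicot's [RInt] and [RInt_gen]. *)
Definition CSeries (u : nat -> C) : C :=
  iota (T := C_CompleteNormedModule) (is_series (V := C_NormedModule) u).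

Definition CInt (f : R -> C) (Fa Fb : (R -> Prop) -> Prop) : C :=
  RInt_gen (V := C_R_CompleteNormedModule) f Fa Fb.

(* (1 / 2 pi i) * integral of [f] along the line from [a - i oo] to
   [a + i oo], parametrised by [s = a + i t], [ds = i dt]. *)
Definition vertical_integral (a : R) (f : C -> C) : C :=
  (/ (RtoC (2 * PI) * Ci) *
   CInt (fun t => f (a, t) * Ci) (Rbar_locally m_infty) (Rbar_locally p_infty))%C.

(* Euler's integral, convergent for [0 < Re s]. *)
Definition Gamma_Euler (s : C) : C :=
  CInt (fun t => Rcpow t (s - RtoC 1) * RtoC (exp (- t)))%C
       (at_right 0) (Rbar_locally p_infty).

(* Meromorphic continuation by Gamma (s + n) = s (s + 1) ... (s + n - 1) Gamma s,
   with [n] the least natural number such that [0 < Re s + n]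
   ([up x] is the least integer [> x]).  At the poles 0, -1, -2, ... the
   denominator vanishes and the value is meaningless. *)
Definition Gamma (s : C) : C :=
  let n := Z.to_nat (up (- Re s)) in
  (Gamma_Euler (s + RtoC (INR n)) / Cprod (fun k => s + RtoC (INR k)) n)%C.

(* The index i = 1, ..., r is represented by 0, ..., r - 1. *)
Definition gamma_factor (r : nat) (alpha : nat -> R) (beta : nat -> C) (s : C) : C :=
  Cprod (fun i => Gamma (RtoC (alpha i) * s + beta i)%C) r.

Definition dirichlet_term (a : nat -> C) (lam : nat -> R) (s : C) (n : nat) : C :=
  (a n * Rcpow (lam n) (- s))%C.

Definition dirichlet (a : nat -> C) (lam : nat -> R) (s : C) : C :=
  CSeries (dirichlet_term a lam s).

(* Absolute convergence at [s] depends on [Re s] only, so it is tested at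
   real points. *)
Definition abscissa_abs (a : nat -> C) (lam : nat -> R) : Rbar :=
  Glb_Rbar (fun sigma =>
    ex_series (fun n => Cmod (dirichlet_term a lam (RtoC sigma) n))).

Definition completed (r : nat) (alpha : nat -> R) (beta : nat -> C)
    (a : nat -> C) (lam : nat -> R) (s : C) : C :=
  (dirichlet a lam s * gamma_factor r alpha beta s)%C.

Definition Yfun (r : nat) (alpha : nat -> R) (beta : nat -> C) (a x : R) : C :=
  vertical_integral a
    (fun s => Gamma s * gamma_factor r alpha beta s * Rcpow x (- s))%C.

Definition Xfun (delta : R) (r : nat) (alpha : nat -> R) (beta : nat -> C)
    (a x : R) : C :=
  vertical_integral a
    (fun s => Gamma (RtoC delta - s) * gamma_factor r alpha beta s
              * Rcpow x (- s))%C.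

Definition Ccompact (K : C -> Prop) : Prop :=
  forall fam : (C -> Prop) -> Prop,
    (forall U, fam U -> open U) ->
    (forall z, K z -> exists U, fam U /\ U z) ->
    exists l : list (C -> Prop),
      (forall U, In U l -> fam U) /\
      (forall z, K z -> exists U, In U l /\ U z).

Definition Cconnected (D : C -> Prop) : Prop :=
  forall U V : C -> Prop,
    open U -> open V ->
    (forall z, D z -> U z \/ V z) ->
    (exists z, D z /\ U z) ->
    (exists z, D z /\ V z) ->
    exists z, D z /\ U z /\ V z.

Definition holomorphic_on (D : C -> Prop) (f : C -> C) : Prop :=
  forall z, D z -> ex_derive (K := C_AbsRing) (V := C_NormedModule) f z.

(* [chi], holomorphic in the domain exterior to the compact set [K], continues
   both [f] (given on [A]) and [g] (given on [B]).  Poles of [f] in [A] or of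
   [g] in [B] therefore have to lie in [K]. *)
Definition continues_outside (K : C -> Prop) (chi : C -> C)
    (A : C -> Prop) (f : C -> C) (B : C -> Prop) (g : C -> C) : Prop :=
  let D := fun z => ~ K z in
  Ccompact K /\ open D /\ Cconnected D /\ holomorphic_on D chi /\
  (forall s, D s -> A s -> chi s = f s) /\
  (forall s, D s -> B s -> chi s = g s).

Definition vanishes_vertically (K : C -> Prop) (chi : C -> C) : Prop :=
  forall s1 s2 eps : R, 0 < eps ->
    exists T : R, forall s : C,
      s1 <= Re s <= s2 -> T < Rabs (Im s) -> ~ K s -> Cmod (chi s) < eps.

(* The growth bounds make the two Mellin integrals converge for [c < Re s] and
   [Re s < - c] respectively; these are the half-planes used below. *)
Definition residual_function (P : R -> C) : Prop :=
  (forall x, 0 < x -> ex_derive (K := R_AbsRing) (V := C_R_NormedModule) P x) /\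
  exists c : R, 0 < c /\
    (exists M : R, at_right 0 (fun x => Cmod (P x) <= M * Rpower x (- c))) /\
    (exists M : R, Rbar_locally p_infty (fun x => Cmod (P x) <= M * Rpower x c)) /\
    exists (K : C -> Prop) (chi : C -> C),
      continues_outside K chi
        (fun s => c < Re s)
        (fun s => CInt (fun x => P x * Rcpow x (s - RtoC 1))%C
                       (at_right 0) (at_point 1))
        (fun s => Re s < - c)
        (fun s => - CInt (fun x => P x * Rcpow x (s - RtoC 1))%C
                         (at_point 1) (Rbar_locally p_infty))%C /\
      vanishes_vertically K chi.

(* Main.v *)
(** Write [V_a u (x)] for [1 / (2 pi i)] times the integral of [u(w) x^(-w)] over
    the line [Re w = a], [F] and [H] for the two sides of the functional equation
    divided by [Q^s].  For [a] large the left hand side of the modular relation is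
    [V_a (Gamma F)].  Moving the line of each [X]-integral far to the left of the
    origin in the variable [delta - s] crosses poles of [Gamma], so each summand on
    the right becomes a polynomial in [x] plus an absolutely summable remainder; as
    the series converges for every [x], so do the coefficients of the polynomials,
    and the right hand side is [P1 + p + V_(-a') (Gamma H)] with a polynomial [p].

    Taking the Mellin transform over (0,1) for [Re s] large and over (1,oo) for
    [- Re s] large, both [Gamma F] and [Gamma H] equal, on vertical strips far to
    the right and to the left, the same function
    [E + chi1 + sum_k p_k / (s + k)], where [E] is a difference of two Cauchy
    integrals over the lines [a] and [- a'] and [chi1] is the continuation given by
    [P1].  The identity theorem along horizontal lines extends the two equalities
    as far as the Dirichlet series converge absolutely, and dividing by the
    zero-free function [Gamma] gives the continuation outside a large square.

    Only polynomial decay of [Gamma] on vertical lines is needed; it follows from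
    [Gamma(s) = Gamma(s + N) / (s (s + 1) ... (s + N - 1))]. *)

Require Import Defs.
From Stdlib Require Import Reals ZArith Lra Lia Psatz Classical ClassicalEpsilon FunctionalExtensionality.
From Coquelicot Require Import Coquelicot.
Open Scope R_scope.

(** * Complex differentiability and the complex exponential *)

(** The Mellin integral is cut at 1, and each half of the transform of a line integral is, up to
    sign, a Cauchy integral over that line; Cauchy's formula for a strip turns two such integrals
    into a value of the integrand. One line [a2] far to the right and one line [L] far to the left
    serve both half-planes, which is why the same E appears twice. Monomials fit in because the two
    halves of the transform of x^k are 1/(s+k) and -1/(s+k). The obstacle is that the series of
    X-integrals is only known to converge, on a line where the Dirichlet series of psi need not
    converge absolutely. Sum and integral are therefore exchanged only after the shift to the left,
    which is made term by term. Integrals are improper Riemann integrals, so limits are controlled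
    by the single majorant M/(1+t^2), with an arctangent as primitive. Decay of fourth order is
    asked of the integrands because differentiating a power of x under the integral brings in a
    quadratic factor. Gamma has no zeros because its density concentrates around a large real
    argument; no product or reflection formula enters. *)

Lemma functional_choice (A B : Type) (R : A -> B -> Prop) :
  (forall x, exists y, R x y) -> exists f, forall x, R x (f x).
Proof.
intros H. exists (fun x => proj1_sig (constructive_indefinite_description _ (H x))).
intros x. apply proj2_sig.
Qed.

Lemma continuous_Cmod_eps (f : R -> C) (x : R) :
  (forall eps, 0 < eps -> exists d, 0 < d /\
     forall y, Rabs (y - x) < d -> Cmod (f y - f x) < eps) ->
  continuous (U := C_UniformSpace) f x.
Proof.
intros H P [eps HP].
destruct (H eps (cond_pos eps)) as [d [Hd Hy]].
exists (mkposreal d Hd). intros y Hb.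
apply HP. apply C_NormedModule_mixin_compat1.
exact (Hy y Hb).
Qed.

(** Balls of the uniform structure on C are squares, while all estimates are in [Cmod]; passing from
    one to the other costs the factor [sqrt 2]. *)
Lemma continuous_eps_Cmod (f : R -> C) (x : R) :
  continuous (U := C_UniformSpace) f x ->
  forall eps, 0 < eps -> exists d, 0 < d /\
     forall y, Rabs (y - x) < d -> Cmod (f y - f x) < eps.
Proof.
intros H eps He.
assert (He' : 0 < eps / sqrt 2) by (apply Rdiv_lt_0_compat; [lra | apply Rlt_sqrt2_0]).
destruct (H (fun z => Cmod (z - f x) < eps)) as [d Hd].
- exists (mkposreal _ He'). intros z Hz.
  apply C_NormedModule_mixin_compat2 in Hz.
  eapply Rlt_le_trans. exact Hz. simpl. right. field.
  apply Rgt_not_eq, Rlt_sqrt2_0.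
- exists d. split. apply cond_pos. intros y Hy. apply Hd. exact Hy.
Qed.

Lemma norm_C_R (z : C) : norm (V := C_R_NormedModule) z = Cmod z.
Proof. symmetry. apply (Cmod_norm z). Qed.

Lemma Cmod_le_sum (z : C) : Cmod z <= Rabs (Re z) + Rabs (Im z).
Proof.
destruct z as [x y]. simpl.
replace (x, y) with (RtoC x + Ci * RtoC y)%C by (apply injective_projections; simpl; ring).
eapply Rle_trans. apply Cmod_triangle. rewrite Cmod_mult, Cmod_Ci, !Cmod_R. lra.
Qed.

Lemma Rabs_Im_le_Cmod (z : C) : Rabs (Im z) <= Cmod z.
Proof. eapply Rle_trans; [ | apply Rmax_Cmod]. apply Rmax_r. Qed.

(** [C_R_NormedModule] has real scalars only, so multiplication by a complex constant is carried out
    on the two components. *)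
Lemma is_RInt_Cmult (f : R -> C) (c : C) a b (l : C) :
  is_RInt (V := C_R_NormedModule) f a b l ->
  is_RInt (V := C_R_NormedModule) (fun x => c * f x)%C a b (c * l)%C.
Proof.
intros H.
pose proof (is_RInt_fct_extend_fst (U := R_NormedModule) (V := R_NormedModule) f a b l H) as H1.
pose proof (is_RInt_fct_extend_snd (U := R_NormedModule) (V := R_NormedModule) f a b l H) as H2.
apply (is_RInt_fct_extend_pair (U := R_NormedModule) (V := R_NormedModule)).
- apply (is_RInt_minus (V := R_NormedModule) (fun t => fst c * fst (f t)) (fun t => snd c * snd (f t))).
  now apply (is_RInt_scal (V := R_NormedModule)).
  now apply (is_RInt_scal (V := R_NormedModule)).
- apply (is_RInt_plus (V := R_NormedModule) (fun t => fst c * snd (f t)) (fun t => snd c * fst (f t))).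
  now apply (is_RInt_scal (V := R_NormedModule)).
  now apply (is_RInt_scal (V := R_NormedModule)).
Qed.

Definition CRInt (f : R -> C) (a b : R) : C := RInt (V := C_R_CompleteNormedModule) f a b.

Definition cont_on (f : R -> C) (a b : R) : Prop :=
  forall t, Rmin a b <= t <= Rmax a b -> continuous (U := C_UniformSpace) f t.

Lemma CRInt_correct f a b : cont_on f a b ->
  is_RInt (V := C_R_NormedModule) f a b (CRInt f a b).
Proof.
intros H. apply (RInt_correct (V := C_R_CompleteNormedModule)).
now apply (ex_RInt_continuous (V := C_R_CompleteNormedModule)).
Qed.

Lemma CRInt_unique f a b l : is_RInt (V := C_R_NormedModule) f a b l -> CRInt f a b = l.
Proof. apply (is_RInt_unique (V := C_R_CompleteNormedModule)). Qed.

Lemma CRInt_Cmult f c a b : cont_on f a b ->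
  CRInt (fun x => c * f x)%C a b = (c * CRInt f a b)%C.
Proof. intros H. apply CRInt_unique, is_RInt_Cmult, CRInt_correct, H. Qed.

Lemma CRInt_plus f g a b : cont_on f a b -> cont_on g a b ->
  CRInt (fun x => f x + g x)%C a b = (CRInt f a b + CRInt g a b)%C.
Proof. intros H H'. apply CRInt_unique.
apply (is_RInt_plus (V := C_R_NormedModule)); now apply CRInt_correct. Qed.

Lemma CRInt_minus f g a b : cont_on f a b -> cont_on g a b ->
  CRInt (fun x => f x - g x)%C a b = (CRInt f a b - CRInt g a b)%C.
Proof. intros H H'. apply CRInt_unique.
apply (is_RInt_minus (V := C_R_NormedModule)); now apply CRInt_correct. Qed.

Lemma CRInt_ext f g a b : (forall x, Rmin a b <= x <= Rmax a b -> f x = g x) ->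
  CRInt f a b = CRInt g a b.
Proof. intros H. apply (RInt_ext (V := C_R_CompleteNormedModule)). intros; apply H; lra. Qed.

Lemma CRInt_Chasles f a b c : cont_on f a b -> cont_on f b c ->
  (CRInt f a b + CRInt f b c)%C = CRInt f a c.
Proof. intros H1 H2. apply (RInt_Chasles (V := C_R_CompleteNormedModule));
now apply (ex_RInt_continuous (V := C_R_CompleteNormedModule)). Qed.

Lemma CRInt_bound f a b M : a <= b -> cont_on f a b ->
  (forall x, a <= x <= b -> Cmod (f x) <= M) -> Cmod (CRInt f a b) <= (b - a) * M.
Proof.
intros Hab Hc H. rewrite <- norm_C_R.
apply (norm_RInt_le_const (V := C_R_NormedModule) f); auto.
intros; rewrite norm_C_R; auto. now apply CRInt_correct.
Qed.

Lemma CRInt_bound_fun f (g : R -> R) a b lg : a <= b -> cont_on f a b ->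
  (forall x, a <= x <= b -> Cmod (f x) <= g x) -> is_RInt g a b lg ->
  Cmod (CRInt f a b) <= lg.
Proof.
intros Hab Hc H Hg. rewrite <- norm_C_R.
apply (norm_RInt_le (V := C_R_NormedModule) f g a b); auto.
intros; rewrite norm_C_R; auto. now apply CRInt_correct.
Qed.

(** Complex derivative in increment form, free of filters. [is_Cd_is_derive] identifies it with the
    derivative behind [holomorphic_on]. *)
Definition is_Cd (f : C -> C) (z l : C) : Prop :=
  forall eps, 0 < eps -> exists d, 0 < d /\
    forall h, Cmod h < d -> Cmod (f (z + h)%C - f z - l * h) <= eps * Cmod h.

Definition Cd (f : C -> C) (z : C) : Prop := exists l, is_Cd f z l.

Lemma is_Cd_is_derive f z l :
  is_Cd f z l <-> is_derive (K := C_AbsRing) (V := C_NormedModule) f z l.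
Proof.
split.
- intros H. split. apply is_linear_scal_l.
  intros x Hx. apply (is_filter_lim_locally_unique (K := C_AbsRing) (V := AbsRing_NormedModule C_AbsRing)) in Hx. subst x.
  intros eps. destruct (H eps (cond_pos eps)) as [d [Hd Hh]].
  exists (mkposreal d Hd). intros y Hy. change C in y.
  change (Cmod (f y - f z - (y - z) * l) <= eps * Cmod (y - z)).
  specialize (Hh (y - z)%C Hy).
  replace (z + (y - z))%C with y in Hh by ring.
  replace ((y - z) * l)%C with (l * (y - z))%C by ring. exact Hh.
- intros [_ H] eps He. specialize (H z (fun P H => H) (mkposreal eps He)).
  destruct H as [d Hd]. exists d. split. apply cond_pos.
  intros h Hh. specialize (Hd (z + h)%C).
  change (Cmod ((z + h) - z) < d -> Cmod (f (z + h)%C - f z - ((z + h) - z) * l) <= eps * Cmod ((z + h) - z)) in Hd.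
  replace ((z + h) - z)%C with h in Hd by ring.
  replace (l * h)%C with (h * l)%C by ring. now apply Hd.
Qed.

Lemma Cd_ex_derive f z :
  Cd f z <-> ex_derive (K := C_AbsRing) (V := C_NormedModule) f z.
Proof. split; intros [l H]; exists l; now apply is_Cd_is_derive. Qed.

Lemma is_Cd_lipschitz f z l : is_Cd f z l -> exists d, 0 < d /\
  forall h, Cmod h < d -> Cmod (f (z + h)%C - f z) <= (Cmod l + 1) * Cmod h.
Proof.
intros H. destruct (H 1 Rlt_0_1) as [d [Hd Hh]]. exists d. split; auto.
intros h Hx. specialize (Hh h Hx).
replace (f (z + h) - f z)%C with ((f (z + h) - f z - l * h) + l * h)%C by ring.
eapply Rle_trans. apply Cmod_triangle. rewrite Cmod_mult. lra.
Qed.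

Lemma is_Cd_ext f g z l r : 0 < r ->
  (forall w, Cmod (w - z) < r -> f w = g w) -> is_Cd f z l -> is_Cd g z l.
Proof.
intros Hr He H eps Heps. destruct (H eps Heps) as [d [Hd Hh]].
exists (Rmin d r). split. now apply Rmin_pos. intros h Hx.
rewrite <- !He. apply Hh. eapply Rlt_le_trans; [exact Hx | apply Rmin_l].
replace (z - z)%C with (RtoC 0) by ring. now rewrite Cmod_0.
replace (z + h - z)%C with h by ring. eapply Rlt_le_trans; [exact Hx | apply Rmin_r].
Qed.

Lemma Cd_ext f g z r : 0 < r ->
  (forall w, Cmod (w - z) < r -> f w = g w) -> Cd f z -> Cd g z.
Proof. intros Hr He [l H]. exists l. now apply (is_Cd_ext f g z l r). Qed.

Lemma is_Cd_const c z : is_Cd (fun _ => c) z 0%C.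
Proof.
intros eps He. exists 1. split. lra. intros h _.
replace (c - c - 0 * h)%C with (RtoC 0) by ring. rewrite Cmod_0.
apply Rmult_le_pos. lra. apply Cmod_ge_0.
Qed.

Lemma is_Cd_id z : is_Cd (fun w => w) z 1%C.
Proof.
intros eps He. exists 1. split. lra. intros h _.
replace (z + h - z - 1 * h)%C with (RtoC 0) by ring. rewrite Cmod_0.
apply Rmult_le_pos. lra. apply Cmod_ge_0.
Qed.

Lemma is_Cd_plus f g z l m : is_Cd f z l -> is_Cd g z m ->
  is_Cd (fun w => f w + g w)%C z (l + m)%C.
Proof.
intros Hf Hg eps He.
destruct (Hf (eps/2)) as [d1 [Hd1 H1]]. lra.
destruct (Hg (eps/2)) as [d2 [Hd2 H2]]. lra.
exists (Rmin d1 d2). split. now apply Rmin_pos. intros h Hh.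
replace (f (z + h) + g (z + h) - (f z + g z) - (l + m) * h)%C with
 ((f (z + h) - f z - l * h) + (g (z + h) - g z - m * h))%C by ring.
eapply Rle_trans. apply Cmod_triangle.
specialize (H1 h (Rlt_le_trans _ _ _ Hh (Rmin_l _ _))).
specialize (H2 h (Rlt_le_trans _ _ _ Hh (Rmin_r _ _))). lra.
Qed.

(* f g - f0 g0 - (l g0 + f0 m) h
   = (f - f0)(g - g0) + (f - f0 - l h) g0 + f0 (g - g0 - m h) *)
Lemma is_Cd_mult f g z l m : is_Cd f z l -> is_Cd g z m ->
  is_Cd (fun w => f w * g w)%C z (l * g z + f z * m)%C.
Proof.
intros Hf Hg eps He.
pose proof (Cmod_ge_0 (f z)) as F0. pose proof (Cmod_ge_0 (g z)) as G0.
pose proof (Cmod_ge_0 l) as L0. pose proof (Cmod_ge_0 m) as M0.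
set (K := Cmod (f z) + Cmod (g z) + 1).
destruct (Hf (eps / (4 * K))) as [d1 [Hd1 H1]]. apply Rdiv_lt_0_compat; unfold K; lra.
destruct (Hg (eps / (4 * K))) as [d2 [Hd2 H2]]. apply Rdiv_lt_0_compat; unfold K; lra.
destruct (is_Cd_lipschitz _ _ _ Hf) as [d3 [Hd3 H3]].
destruct (is_Cd_lipschitz _ _ _ Hg) as [d4 [Hd4 H4]].
set (L := (Cmod l + 1) * (Cmod m + 1)).
assert (HL : 0 < L) by (unfold L; nra).
set (d5 := eps / (2 * L)).
assert (Hd5 : 0 < d5) by (apply Rdiv_lt_0_compat; lra).
exists (Rmin (Rmin d1 d2) (Rmin (Rmin d3 d4) d5)).
split. repeat apply Rmin_pos; auto. intros h Hh.
apply Rmin_Rgt in Hh. destruct Hh as [Ha Hb].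
apply Rmin_Rgt in Ha. destruct Ha as [Ha1 Ha2].
apply Rmin_Rgt in Hb. destruct Hb as [Hb Hb5].
apply Rmin_Rgt in Hb. destruct Hb as [Hb3 Hb4].
specialize (H1 h Ha1). specialize (H2 h Ha2). specialize (H3 h Hb3). specialize (H4 h Hb4).
replace (f (z + h) * g (z + h) - f z * g z - (l * g z + f z * m) * h)%C with
 ((f (z + h) - f z) * (g (z + h) - g z) +
   ((f (z + h) - f z - l * h) * g z + f z * (g (z + h) - g z - m * h)))%C by ring.
eapply Rle_trans. apply Cmod_triangle.
eapply Rle_trans. apply Rplus_le_compat_l. apply Cmod_triangle.
rewrite !Cmod_mult.
pose proof (Cmod_ge_0 h) as Hh0.
set (A := Cmod (f (z + h) - f z)%C) in *. set (B := Cmod (g (z + h) - g z)%C) in *.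
set (A' := Cmod (f (z + h) - f z - l * h)%C) in *. set (B' := Cmod (g (z + h) - g z - m * h)%C) in *.
assert (A0 : 0 <= A) by apply Cmod_ge_0. assert (B0 : 0 <= B) by apply Cmod_ge_0.
assert (S1 : A * B <= eps / 2 * Cmod h).
{ apply Rle_trans with ((Cmod l + 1) * Cmod h * ((Cmod m + 1) * Cmod h)).
  apply Rmult_le_compat; auto.
  replace ((Cmod l + 1) * Cmod h * ((Cmod m + 1) * Cmod h)) with (L * Cmod h * Cmod h) by (unfold L; ring).
  apply Rmult_le_compat_r; auto.
  apply Rle_trans with (L * d5). apply Rmult_le_compat_l; lra. unfold d5. right. field. lra. }
assert (HK : 0 < K) by (unfold K; lra).
assert (S2 : A' * Cmod (g z) <= eps / 4 * Cmod h).
{ apply Rle_trans with (eps / (4 * K) * Cmod h * K). apply Rmult_le_compat; auto. apply Cmod_ge_0. unfold K; lra.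
  right. field. lra. }
assert (S3 : Cmod (f z) * B' <= eps / 4 * Cmod h).
{ apply Rle_trans with (K * (eps / (4 * K) * Cmod h)). apply Rmult_le_compat; auto. apply Cmod_ge_0. unfold K; lra.
  right. field. lra. }
lra.
Qed.

Lemma is_Cd_comp f g z l m : is_Cd g z m -> is_Cd f (g z) l ->
  is_Cd (fun w => f (g w)) z (l * m)%C.
Proof.
intros Hg Hf eps He.
pose proof (Cmod_ge_0 l) as L0. pose proof (Cmod_ge_0 m) as M0.
destruct (is_Cd_lipschitz _ _ _ Hg) as [d4 [Hd4 H4]].
destruct (Hf (eps / (2 * (Cmod m + 1)))) as [d1 [Hd1 H1]]. apply Rdiv_lt_0_compat; lra.
destruct (Hg (eps / (2 * (Cmod l + 1)))) as [d2 [Hd2 H2]]. apply Rdiv_lt_0_compat; lra.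
exists (Rmin (Rmin d4 d2) (d1 / (Cmod m + 1))).
split. repeat apply Rmin_pos; auto. apply Rdiv_lt_0_compat; lra.
intros h Hh.
apply Rmin_Rgt in Hh. destruct Hh as [Ha Hb].
apply Rmin_Rgt in Ha. destruct Ha as [Ha1 Ha2].
specialize (H4 h Ha1). specialize (H2 h Ha2).
pose proof (Cmod_ge_0 h) as Hh0.
assert (Hs : Cmod (g (z + h) - g z)%C < d1).
{ eapply Rle_lt_trans. exact H4.
  apply Rlt_le_trans with ((Cmod m + 1) * (d1 / (Cmod m + 1))). apply Rmult_lt_compat_l; lra. right; field; lra. }
specialize (H1 _ Hs). replace (g z + (g (z + h) - g z))%C with (g (z + h)%C) in H1 by ring.
replace (f (g (z + h)%C) - f (g z) - l * m * h)%C with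
 ((f (g (z + h)%C) - f (g z) - l * (g (z + h) - g z)) + l * (g (z + h) - g z - m * h))%C by ring.
eapply Rle_trans. apply Cmod_triangle. rewrite Cmod_mult.
apply Rle_trans with (eps / (2 * (Cmod m + 1)) * ((Cmod m + 1) * Cmod h) + (Cmod l + 1) * (eps / (2 * (Cmod l + 1)) * Cmod h)).
apply Rplus_le_compat.
eapply Rle_trans. exact H1. apply Rmult_le_compat_l; auto. left; apply Rdiv_lt_0_compat; lra.
apply Rmult_le_compat; auto. apply Cmod_ge_0. lra.
right; field; lra.
Qed.

Lemma is_Cd_inv (z : C) : z <> 0%C -> is_Cd Cinv z (- / (z * z))%C.
Proof.
intros Hz eps He.
pose proof (proj1 (Cmod_gt_0 z) Hz) as Hz0. set (r := Cmod z) in *.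
(* The remainder is exactly [h ^ 2 / (z ^ 2 * (z + h))], and [Cmod (z + h) > r / 2] bounds the
   denominator from below by [r ^ 3 / 2]. *)
exists (Rmin (r / 2) (eps * r * r * r / 2)). split. apply Rmin_pos. lra.
assert (0 < eps * r * r * r) by (repeat apply Rmult_lt_0_compat; auto). lra.
intros h Hh. apply Rmin_Rgt in Hh. destruct Hh as [H1 H2].
assert (Hzh : r / 2 < Cmod (z + h)).
{ assert (r <= Cmod (z + h) + Cmod h). unfold r. replace z with ((z + h) + - h)%C at 1 by ring.
  eapply Rle_trans. apply Cmod_triangle. rewrite Cmod_opp. lra. lra. }
assert (Hn : (z + h)%C <> 0%C). { intros E. rewrite E, Cmod_0 in Hzh. lra. }
replace (/ (z + h) - / z - - / (z * z) * h)%C with (h * h / (z * z * (z + h)))%C by (field; auto).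
rewrite Cmod_div by (repeat apply Cmult_neq_0; auto). rewrite !Cmod_mult. fold r.
pose proof (Cmod_ge_0 h) as Hh0.
apply Rle_trans with (Cmod h * (eps * r * r * r / 2) / (r * r * (r / 2))).
- unfold Rdiv at 1. unfold Rdiv at 2. apply Rmult_le_compat. nra. left. apply Rinv_0_lt_compat. apply Rmult_lt_0_compat. nra. lra.
  apply Rmult_le_compat_l; lra.
  apply Rinv_le_contravar. apply Rmult_lt_0_compat. nra. lra. apply Rmult_le_compat_l. nra. lra.
- right. field. lra.
Qed.

Lemma Cd_const c z : Cd (fun _ => c) z.
Proof. eexists. apply is_Cd_const. Qed.
Lemma Cd_id z : Cd (fun w => w) z.
Proof. eexists. apply is_Cd_id. Qed.
Lemma Cd_plus f g z : Cd f z -> Cd g z -> Cd (fun w => f w + g w)%C z.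
Proof. intros [l H] [m H']. eexists. apply is_Cd_plus; eauto. Qed.
Lemma Cd_mult f g z : Cd f z -> Cd g z -> Cd (fun w => f w * g w)%C z.
Proof. intros [l H] [m H']. eexists. apply is_Cd_mult; eauto. Qed.
Lemma Cd_comp f g z : Cd g z -> Cd f (g z) -> Cd (fun w => f (g w)) z.
Proof. intros [l H] [m H']. eexists. eapply is_Cd_comp; eauto. Qed.
Lemma Cd_opp f z : Cd f z -> Cd (fun w => - f w)%C z.
Proof.
intros H. apply (Cd_ext (fun w => (- 1) * f w)%C _ z 1). lra. intros; ring.
apply Cd_mult; auto. apply Cd_const.
Qed.
Lemma Cd_minus f g z : Cd f z -> Cd g z -> Cd (fun w => f w - g w)%C z.
Proof. intros H H'. apply Cd_plus; auto. now apply Cd_opp. Qed.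
Lemma Cd_inv f z : Cd f z -> f z <> 0%C -> Cd (fun w => / f w)%C z.
Proof. intros H H'. apply (Cd_comp Cinv); auto. eexists. now apply is_Cd_inv. Qed.
Lemma Cd_div f g z : Cd f z -> Cd g z -> g z <> 0%C -> Cd (fun w => f w / g w)%C z.
Proof. intros H H' H''. apply Cd_mult; auto. now apply Cd_inv. Qed.

Lemma Cd_continuous f z : Cd f z -> forall eps, 0 < eps -> exists d, 0 < d /\
  forall w, Cmod (w - z) < d -> Cmod (f w - f z) < eps.
Proof.
intros [l H] eps He. destruct (is_Cd_lipschitz _ _ _ H) as [d [Hd Hh]].
pose proof (Cmod_ge_0 l).
exists (Rmin d (eps / (Cmod l + 1))). split. apply Rmin_pos; auto. apply Rdiv_lt_0_compat; lra.
intros w Hw. apply Rmin_Rgt in Hw. destruct Hw as [H1 H2].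
specialize (Hh _ H1). replace (z + (w - z))%C with w in Hh by ring.
eapply Rle_lt_trans. exact Hh.
apply Rlt_le_trans with ((Cmod l + 1) * (eps / (Cmod l + 1))). apply Rmult_lt_compat_l; lra. right; field; lra.
Qed.

Definition Ccont (f : C -> C) (z : C) := forall eps, 0 < eps -> exists d, 0 < d /\
  forall w, Cmod (w - z) < d -> Cmod (f w - f z) < eps.

Lemma Ccont_path (f : C -> C) (g : R -> C) (t : R) :
  Ccont f (g t) -> continuous (U := C_UniformSpace) g t ->
  continuous (U := C_UniformSpace) (fun t => f (g t)) t.
Proof.
intros Hf Hg. apply continuous_Cmod_eps. intros eps He.
destruct (Hf eps He) as [d [Hd H]].
destruct (continuous_eps_Cmod _ _ Hg d Hd) as [d' [Hd' H']].
exists d'. split; auto.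
Qed.

Lemma continuous_vert (x t : R) : continuous (U := C_UniformSpace) (fun t : R => (x, t) : C) t.
Proof.
apply continuous_Cmod_eps. intros eps He. exists eps. split; auto. intros y Hy. cbv beta.
replace ((x, y) - (x, t))%C with (Ci * RtoC (y - t))%C by (apply injective_projections; simpl; ring).
rewrite Cmod_mult, Cmod_Ci, Cmod_R. lra.
Qed.

Lemma continuous_horiz (y t : R) : continuous (U := C_UniformSpace) (fun t : R => (t, y) : C) t.
Proof.
apply continuous_Cmod_eps. intros eps He. exists eps. split; auto. intros y' Hy. cbv beta.
replace ((y', y) - (t, y))%C with (RtoC (y' - t))%C by (apply injective_projections; simpl; ring).
rewrite Cmod_R. lra.
Qed.

Lemma is_derive_eps_C (f : R -> C) (x : R) (l : C) :
  (forall eps, 0 < eps -> exists d, 0 < d /\ forall h : R, Rabs h < d ->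
     Cmod (f (x + h) - f x - RtoC h * l) <= eps * Rabs h) ->
  is_derive (K := R_AbsRing) (V := C_R_NormedModule) f x l.
Proof.
intros H. split. apply is_linear_scal_l.
intros y Hy. apply (is_filter_lim_locally_unique (K := R_AbsRing) (V := AbsRing_NormedModule R_AbsRing)) in Hy. subst y.
intros eps. destruct (H eps (cond_pos eps)) as [d [Hd Hh]].
exists (mkposreal d Hd). intros y Hy. change R in y.
rewrite norm_C_R.
specialize (Hh (y - x) Hy). replace (x + (y - x)) with y in Hh by ring.
change (norm (minus y x)) with (Rabs (y - x)).
eapply Rle_trans; [right; apply (f_equal Cmod) | exact Hh].
apply injective_projections; simpl; unfold minus, plus, opp, scal; simpl; unfold mult; simpl; ring.
Qed.

Lemma is_Cd_horiz F (x y : R) l : is_Cd F (x, y) l ->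
  is_derive (K := R_AbsRing) (V := C_R_NormedModule) (fun x => F (x, y)) x l.
Proof.
intros H. apply is_derive_eps_C. intros eps He. destruct (H eps He) as [d [Hd Hh]].
exists d. split; auto. intros h Hx. specialize (Hh (RtoC h)). rewrite Cmod_R in Hh.
replace ((x, y) + RtoC h)%C with ((x + h, y) : C) in Hh by (apply injective_projections; simpl; ring).
replace (RtoC h * l)%C with (l * RtoC h)%C by ring. auto.
Qed.

Lemma is_Cd_vert F (x y : R) l : is_Cd F (x, y) l ->
  is_derive (K := R_AbsRing) (V := C_R_NormedModule) (fun y => F (x, y)) y (Ci * l)%C.
Proof.
intros H. apply is_derive_eps_C. intros eps He. destruct (H eps He) as [d [Hd Hh]].
exists d. split; auto. intros h Hx. specialize (Hh (Ci * RtoC h)%C).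
rewrite Cmod_mult, Cmod_Ci, Cmod_R, Rmult_1_l in Hh.
replace ((x, y) + Ci * RtoC h)%C with ((x, y + h) : C) in Hh by (apply injective_projections; simpl; ring).
replace (RtoC h * (Ci * l))%C with (l * (Ci * RtoC h))%C by ring. auto.
Qed.

Lemma CRInt_derive (F f : R -> C) a b :
  (forall x, Rmin a b <= x <= Rmax a b -> is_derive (K := R_AbsRing) (V := C_R_NormedModule) F x (f x)) ->
  cont_on f a b -> CRInt f a b = (F b - F a)%C.
Proof.
intros H Hc. apply CRInt_unique.
apply (is_RInt_derive (V := C_R_CompleteNormedModule) F f); auto.
Qed.

(** * The complex exponential and its Taylor remainders *)

Lemma Cexp_plus z w : Cexp (z + w) = (Cexp z * Cexp w)%C.
Proof.
destruct z as [x y], w as [u v]. unfold Cexp. simpl.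
rewrite exp_plus, cos_plus, sin_plus. apply injective_projections; simpl; ring.
Qed.

Lemma Cexp_0 : Cexp 0 = 1%C.
Proof. unfold Cexp; simpl. rewrite exp_0, cos_0, sin_0. apply injective_projections; simpl; ring. Qed.

Lemma Cmod_Cexp z : Cmod (Cexp z) = exp (Re z).
Proof.
destruct z as [x y]. unfold Cexp, Cmod; simpl.
replace (exp x * cos y * (exp x * cos y * 1) + exp x * sin y * (exp x * sin y * 1))
 with (exp x ^ 2 * ((sin y)² + (cos y)²)) by (unfold Rsqr; ring).
rewrite sin2_cos2, Rmult_1_r. rewrite sqrt_pow2; auto. left; apply exp_pos.
Qed.

Lemma Cexp_neq_0 z : Cexp z <> 0%C.
Proof. intros H. pose proof (Cmod_Cexp z). rewrite H, Cmod_0 in H0. pose proof (exp_pos (Re z)). lra. Qed.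

Lemma Cexp_opp z : Cexp (- z) = (/ Cexp z)%C.
Proof.
pose proof (Cexp_neq_0 z).
assert (Cexp (- z) * Cexp z = 1)%C. rewrite <- Cexp_plus. replace (- z + z)%C with (RtoC 0) by ring. apply Cexp_0.
replace (Cexp (- z)) with (Cexp (- z) * Cexp z / Cexp z)%C by (field; auto). rewrite H0. field; auto.
Qed.

Lemma is_derive_R_eps (f : R -> R) x l : is_derive f x l ->
  forall eps, 0 < eps -> exists d, 0 < d /\ forall h, Rabs h < d ->
    Rabs (f (x + h) - f x - h * l) <= eps * Rabs h.
Proof.
intros [_ H] eps He. specialize (H x (fun P H => H) (mkposreal eps He)).
destruct H as [d Hd]. exists d. split. apply cond_pos.
intros h Hh. specialize (Hd (x + h)).
change (Rabs ((x + h) - x) < d -> Rabs (f (x + h) - f x - ((x + h) - x) * l) <= eps * Rabs ((x + h) - x)) in Hd.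
replace ((x + h) - x) with h in Hd by ring. now apply Hd.
Qed.

Lemma is_derive_C_eps (f : R -> C) (x : R) (l : C) :
  is_derive (K := R_AbsRing) (V := C_R_NormedModule) f x l ->
  forall eps, 0 < eps -> exists d, 0 < d /\ forall h : R, Rabs h < d ->
     Cmod (f (x + h) - f x - RtoC h * l) <= eps * Rabs h.
Proof.
intros [_ H] eps He. specialize (H x (fun P H => H) (mkposreal eps He)).
destruct H as [d Hd]. exists d. split. apply cond_pos.
intros h Hh. specialize (Hd (x + h)). rewrite norm_C_R in Hd.
change (Rabs ((x + h) - x) < d -> Cmod (f (x + h) - f x - scal (K := R_AbsRing) (V := C_R_NormedModule) ((x + h) - x) l) <= eps * Rabs ((x + h) - x)) in Hd.
replace ((x + h) - x) with h in Hd by ring.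
replace (RtoC h * l)%C with (scal (K := R_AbsRing) (V := C_R_NormedModule) h l). now apply Hd.
apply injective_projections; simpl; unfold scal; simpl; unfold mult; simpl; ring.
Qed.

Lemma is_derive_Cmult_const (f : R -> C) (x : R) (c l : C) :
  is_derive (K := R_AbsRing) (V := C_R_NormedModule) f x l ->
  is_derive (K := R_AbsRing) (V := C_R_NormedModule) (fun x => c * f x)%C x (c * l)%C.
Proof.
intros H. apply is_derive_eps_C. intros eps He. pose proof (Cmod_ge_0 c).
destruct (is_derive_C_eps _ _ _ H (eps / (Cmod c + 1))) as [d [Hd Hh]]. apply Rdiv_lt_0_compat; lra.
exists d. split; auto. intros h Hx. specialize (Hh h Hx).
replace (c * f (x + h)%R - c * f x - RtoC h * (c * l))%C with (c * (f (x + h)%R - f x - RtoC h * l))%C by ring.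
rewrite Cmod_mult.
apply Rle_trans with ((Cmod c + 1) * (eps / (Cmod c + 1) * Rabs h)).
apply Rmult_le_compat; try lra. apply Cmod_ge_0. right; field; lra.
Qed.

Lemma is_derive_pair (f g : R -> R) x l m : is_derive f x l -> is_derive g x m ->
  is_derive (K := R_AbsRing) (V := C_R_NormedModule) (fun t => (f t, g t)) x (l, m).
Proof.
intros Hf Hg. apply is_derive_eps_C. intros eps He.
destruct (is_derive_R_eps _ _ _ Hf (eps / 2)) as [d1 [Hd1 H1]]. lra.
destruct (is_derive_R_eps _ _ _ Hg (eps / 2)) as [d2 [Hd2 H2]]. lra.
exists (Rmin d1 d2). split. now apply Rmin_pos. intros h Hh. apply Rmin_Rgt in Hh.
destruct Hh as [Ha Hb]. specialize (H1 h Ha). specialize (H2 h Hb).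
eapply Rle_trans. apply Cmod_le_sum. simpl.
replace (f (x + h) + - f x + - (h * l - 0 * m)) with (f (x + h) - f x - h * l) by ring.
replace (g (x + h) + - g x + - (h * m + 0 * l)) with (g (x + h) - g x - h * m) by ring. lra.
Qed.

(** A real derivative along the ray through [z]. It comes before the complex differentiability of
    [Cexp], which is deduced from it through the two remainder bounds below. *)
Lemma is_derive_Cexp_line (z : C) (t : R) :
  is_derive (K := R_AbsRing) (V := C_R_NormedModule) (fun t => Cexp (RtoC t * z)) t (z * Cexp (RtoC t * z))%C.
Proof.
destruct z as [x y].
apply (is_derive_ext (K := R_AbsRing) (V := C_R_NormedModule)
  (fun t => (exp (t * x) * cos (t * y), exp (t * x) * sin (t * y)) : C)).
{ intros u. unfold Cexp; simpl.
  replace (u * x - 0 * y) with (u * x) by ring. replace (u * y + 0 * x) with (u * y) by ring. reflexivity. }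
unfold Cexp; simpl.
replace (t * x - 0 * y) with (t * x) by ring. replace (t * y + 0 * x) with (t * y) by ring.
unfold Cmult; simpl. apply is_derive_pair; auto_derive; auto; ring.
Qed.

Lemma continuous_of_derive (f : R -> C) x l :
  is_derive (K := R_AbsRing) (V := C_R_NormedModule) f x l -> continuous (U := C_UniformSpace) f x.
Proof.
intros H. apply (ex_derive_continuous (K := R_AbsRing) (V := C_R_NormedModule)). now exists l.
Qed.

Lemma continuous_Cmult_const c (f : R -> C) x :
  continuous (U := C_UniformSpace) f x -> continuous (U := C_UniformSpace) (fun t => c * f t)%C x.
Proof.
intros H. pose proof (Cmod_ge_0 c).
apply continuous_Cmod_eps. intros eps He.
destruct (continuous_eps_Cmod _ _ H (eps / (Cmod c + 1))) as [d [Hd Hy]]. apply Rdiv_lt_0_compat; lra.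
exists d. split; auto. intros y Hy'. specialize (Hy y Hy').
replace (c * f y - c * f x)%C with (c * (f y - f x))%C by ring. rewrite Cmod_mult.
pose proof (Cmod_ge_0 (f y - f x)%C).
apply Rle_lt_trans with ((Cmod c + 1) * Cmod (f y - f x)). nra.
apply Rlt_le_trans with ((Cmod c + 1) * (eps / (Cmod c + 1))). apply Rmult_lt_compat_l; lra. right; field; lra.
Qed.

Lemma continuous_Cplus (f g : R -> C) x :
  continuous (U := C_UniformSpace) f x -> continuous (U := C_UniformSpace) g x ->
  continuous (U := C_UniformSpace) (fun t => f t + g t)%C x.
Proof. apply (continuous_plus (K := R_AbsRing) (V := C_R_NormedModule)). Qed.

Lemma continuous_Cminus (f g : R -> C) x :
  continuous (U := C_UniformSpace) f x -> continuous (U := C_UniformSpace) g x ->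
  continuous (U := C_UniformSpace) (fun t => f t - g t)%C x.
Proof. apply (continuous_minus (K := R_AbsRing) (V := C_R_NormedModule)). Qed.

Lemma continuous_Cconst (c : C) (x : R) : continuous (U := C_UniformSpace) (fun _ => c) x.
Proof. apply (continuous_const (U := R_UniformSpace) (V := C_UniformSpace)). Qed.

Lemma continuous_Cmult (f g : R -> C) x :
  continuous (U := C_UniformSpace) f x -> continuous (U := C_UniformSpace) g x ->
  continuous (U := C_UniformSpace) (fun t => f t * g t)%C x.
Proof.
intros Hf Hg. apply continuous_Cmod_eps. intros eps He.
pose proof (Cmod_ge_0 (f x)) as F0. pose proof (Cmod_ge_0 (g x)) as G0.
set (e := Rmin 1 (eps / (2 * (Cmod (f x) + Cmod (g x) + 1)))).
assert (Hep : 0 < e) by (apply Rmin_pos; [lra | apply Rdiv_lt_0_compat; lra]).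
destruct (continuous_eps_Cmod _ _ Hf e Hep) as [d1 [Hd1 H1]].
destruct (continuous_eps_Cmod _ _ Hg e Hep) as [d2 [Hd2 H2]].
exists (Rmin d1 d2). split. now apply Rmin_pos. intros y Hy. apply Rmin_Rgt in Hy. destruct Hy as [Ha Hb].
specialize (H1 y Ha). specialize (H2 y Hb).
replace (f y * g y - f x * g x)%C with ((f y - f x) * (g y - g x) + ((f y - f x) * g x + f x * (g y - g x)))%C by ring.
eapply Rle_lt_trans. apply Cmod_triangle.
eapply Rle_lt_trans. apply Rplus_le_compat_l. apply Cmod_triangle. rewrite !Cmod_mult.
set (A := Cmod (f y - f x)) in *. set (B := Cmod (g y - g x)) in *.
assert (0 <= A) by apply Cmod_ge_0. assert (0 <= B) by apply Cmod_ge_0.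
assert (e <= 1) by apply Rmin_l.
assert (e * (2 * (Cmod (f x) + Cmod (g x) + 1)) <= eps).
{ apply Rle_trans with (eps / (2 * (Cmod (f x) + Cmod (g x) + 1)) * (2 * (Cmod (f x) + Cmod (g x) + 1))).
  apply Rmult_le_compat_r. lra. apply Rmin_r. right; field. lra. }
nra.
Qed.

Lemma exp_le (x y : R) : x <= y -> exp x <= exp y.
Proof. intros [H|H]. left; now apply exp_increasing. rewrite H; lra. Qed.

(** [Cexp z - 1] is the integral of [z * Cexp (t z)] over [0,1]. Only [Re z] enters the exponential
    on the right, which keeps the bound useful along vertical lines. *)
Lemma Cexp_remainder1 z : Cmod (Cexp z - 1) <= Cmod z * exp (Rabs (Re z)).
Proof.
assert (E : (Cexp z - 1)%C = CRInt (fun t => z * Cexp (RtoC t * z))%C 0 1).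
{ rewrite (CRInt_derive (fun t => Cexp (RtoC t * z))).
  replace (1 * z)%C with z by ring. replace (0 * z)%C with (RtoC 0) by ring. now rewrite Cexp_0.
  intros; apply is_derive_Cexp_line.
  intros t _. apply continuous_Cmult_const. eapply continuous_of_derive. apply is_derive_Cexp_line. }
rewrite E. rewrite <- (Rmult_1_l (_ * _)). replace 1 with (1 - 0) at 2 by ring. apply CRInt_bound. lra.
intros t _. apply continuous_Cmult_const. eapply continuous_of_derive. apply is_derive_Cexp_line.
intros t Ht. rewrite Cmod_mult, Cmod_Cexp. apply Rmult_le_compat_l. apply Cmod_ge_0.
apply exp_le. pose proof (Rle_abs (Re z)). pose proof (Rabs_pos (Re z)). destruct z as [x y]; simpl in *.
replace (t * x - 0 * y) with (t * x) in * by ring. nra.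
Qed.

(** The same integral, with the first-order bound inserted. This quadratic remainder is what later
    justifies differentiation under integral and summation signs. *)
Lemma Cexp_remainder2 z : Cmod (Cexp z - 1 - z) <= Cmod z * Cmod z * exp (Rabs (Re z)).
Proof.
assert (Hc : cont_on (fun t => z * (Cexp (RtoC t * z) - 1))%C 0 1).
{ intros t _. apply continuous_Cmult_const. apply continuous_Cminus.
  eapply continuous_of_derive. apply is_derive_Cexp_line. apply continuous_Cconst. }
assert (E : (Cexp z - 1 - z)%C = CRInt (fun t => z * (Cexp (RtoC t * z) - 1))%C 0 1).
{ rewrite (CRInt_derive (fun t => Cexp (RtoC t * z) - RtoC t * z)%C); auto.
  replace (1 * z)%C with z by ring. replace (0 * z)%C with (RtoC 0) by ring. rewrite Cexp_0. ring.
  intros t _. replace (z * (Cexp (RtoC t * z) - 1))%C with (z * Cexp (RtoC t * z) - z)%C by ring.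
  apply (is_derive_minus (K := R_AbsRing) (V := C_R_NormedModule)).
  apply is_derive_Cexp_line.
  apply is_derive_eps_C. intros eps He. exists 1. split. lra. intros h _. rewrite RtoC_plus.
  replace ((t + h) * z - t * z - h * z)%C with (RtoC 0) by ring.
  rewrite Cmod_0. apply Rmult_le_pos. lra. apply Rabs_pos. }
rewrite E. rewrite <- (Rmult_1_l (_ * _)). replace 1 with (1 - 0) at 2 by ring. apply CRInt_bound; auto. lra.
intros t Ht. rewrite Cmod_mult, Rmult_assoc. apply Rmult_le_compat_l. apply Cmod_ge_0.
eapply Rle_trans. apply Cexp_remainder1.
apply Rmult_le_compat. apply Cmod_ge_0. left; apply exp_pos.
rewrite Cmod_mult, Cmod_R, Rabs_pos_eq by lra. pose proof (Cmod_ge_0 z). nra.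
apply exp_le. destruct z as [x y]; simpl. replace (t * x - 0 * y) with (t * x) by ring.
rewrite Rabs_mult, Rabs_pos_eq by lra. pose proof (Rabs_pos x). nra.
Qed.

Lemma is_Cd_Cexp z : is_Cd Cexp z (Cexp z).
Proof.
intros eps He. pose proof (exp_pos (Re z)) as P. pose proof (exp_pos 1) as P1.
exists (Rmin 1 (eps / (exp (Re z) * exp 1))). split. apply Rmin_pos. lra. apply Rdiv_lt_0_compat; nra.
intros h Hh. apply Rmin_Rgt in Hh. destruct Hh as [H1 H2].
rewrite Cexp_plus. replace (Cexp z * Cexp h - Cexp z - Cexp z * h)%C with (Cexp z * (Cexp h - 1 - h))%C by ring.
rewrite Cmod_mult, Cmod_Cexp.
pose proof (Cmod_ge_0 h) as H0. pose proof (exp_increasing _ _ H1) as H3. pose proof (exp_pos (Cmod h)).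
apply Rle_trans with (exp (Re z) * (Cmod h * Cmod h * exp 1)).
{ apply Rmult_le_compat_l. lra. eapply Rle_trans. apply Cexp_remainder2. apply Rmult_le_compat_l. nra.
  pose proof (exp_le _ _ (re_le_Cmod h)). lra. }
apply Rle_trans with (exp (Re z) * exp 1 * Cmod h * (eps / (exp (Re z) * exp 1))).
replace (exp (Re z) * (Cmod h * Cmod h * exp 1)) with (exp (Re z) * exp 1 * Cmod h * Cmod h) by ring.
apply Rmult_le_compat_l. apply Rmult_le_pos; nra. lra.
right; field; lra.
Qed.

Lemma Cd_Cexp f z : Cd f z -> Cd (fun w => Cexp (f w)) z.
Proof. intros H. apply (Cd_comp Cexp); auto. eexists. apply is_Cd_Cexp. Qed.

Lemma Cd_Rcpow x f z : Cd f z -> Cd (fun w => Rcpow x (f w)) z.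
Proof. intros H. apply Cd_Cexp. apply Cd_mult; auto. apply Cd_const. Qed.

Lemma Rcpow_plus x z w : Rcpow x (z + w) = (Rcpow x z * Rcpow x w)%C.
Proof. unfold Rcpow. rewrite <- Cexp_plus. f_equal. ring. Qed.

Lemma Rcpow_opp x z : Rcpow x (- z) = (/ Rcpow x z)%C.
Proof. unfold Rcpow. rewrite <- Cexp_opp. f_equal. ring. Qed.

Lemma Rcpow_mult x y z : 0 < x -> 0 < y -> Rcpow (x * y) z = (Rcpow x z * Rcpow y z)%C.
Proof. intros. unfold Rcpow. rewrite <- Cexp_plus, ln_mult, RtoC_plus; auto. f_equal. ring. Qed.

Lemma Cmod_Rcpow x z : Cmod (Rcpow x z) = Rpower x (Re z).
Proof. unfold Rcpow. rewrite Cmod_Cexp. unfold Rpower. f_equal. destruct z; simpl; ring. Qed.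

Lemma Rcpow_real x (y : R) : Rcpow x (RtoC y) = RtoC (Rpower x y).
Proof.
unfold Rcpow, Cexp, Rpower. simpl. replace (y * ln x - 0 * 0) with (y * ln x) by ring.
replace (y * 0 + 0 * ln x) with 0 by ring. rewrite cos_0, sin_0. apply injective_projections; simpl; ring.
Qed.

(** * Goursat's theorem, Cauchy's formula and the identity theorem *)

(** The contour integral along the boundary, counterclockwise: dz = dx on the horizontal sides and
    dz = i dy on the vertical ones. *)
Definition rect (f : C -> C) (x1 x2 y1 y2 : R) : C :=
  (CRInt (fun x => f (x, y1)) x1 x2 + Ci * CRInt (fun y => f (x2, y)) y1 y2
   - CRInt (fun x => f (x, y2)) x1 x2 - Ci * CRInt (fun y => f (x1, y)) y1 y2)%C.

Definition cont_rect (f : C -> C) x1 x2 y1 y2 :=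
  forall x y, x1 <= x <= x2 -> y1 <= y <= y2 -> Ccont f (x, y).

Definition cont_edges (f : C -> C) x1 x2 y1 y2 :=
  forall x y, x1 <= x <= x2 -> y1 <= y <= y2 ->
    (x = x1 \/ x = x2 \/ y = y1 \/ y = y2) -> Ccont f (x, y).

Lemma cont_rect_edges f x1 x2 y1 y2 : cont_rect f x1 x2 y1 y2 -> cont_edges f x1 x2 y1 y2.
Proof. intros H x y Hx Hy _. now apply H. Qed.

Lemma Ccont_horiz f (x y : R) : Ccont f (x, y) -> continuous (U := C_UniformSpace) (fun x => f (x, y)) x.
Proof. intros H. apply (Ccont_path f (fun x => (x, y))); auto. apply continuous_horiz. Qed.
Lemma Ccont_vert f (x y : R) : Ccont f (x, y) -> continuous (U := C_UniformSpace) (fun y => f (x, y)) y.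
Proof. intros H. apply (Ccont_path f (fun y => (x, y))); auto. apply continuous_vert. Qed.

Lemma edges_cont f x1 x2 y1 y2 : x1 <= x2 -> y1 <= y2 -> cont_edges f x1 x2 y1 y2 ->
  cont_on (fun x => f (x, y1)) x1 x2 /\ cont_on (fun x => f (x, y2)) x1 x2 /\
  cont_on (fun y => f (x1, y)) y1 y2 /\ cont_on (fun y => f (x2, y)) y1 y2.
Proof.
intros Hx Hy H.
repeat split; intros t Ht; rewrite Rmin_left, Rmax_right in Ht by auto;
 first [apply Ccont_horiz | apply Ccont_vert]; apply H; auto; lra.
Qed.

Lemma rect_mult_const c f x1 x2 y1 y2 : x1 <= x2 -> y1 <= y2 -> cont_edges f x1 x2 y1 y2 ->
  rect (fun z => c * f z)%C x1 x2 y1 y2 = (c * rect f x1 x2 y1 y2)%C.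
Proof.
intros Hx Hy H. destruct (edges_cont f x1 x2 y1 y2 Hx Hy H) as [H1 [H2 [H3 H4]]].
unfold rect. rewrite !CRInt_Cmult by auto. ring.
Qed.

Lemma rect_minus f g x1 x2 y1 y2 : x1 <= x2 -> y1 <= y2 ->
  cont_edges f x1 x2 y1 y2 -> cont_edges g x1 x2 y1 y2 ->
  rect (fun z => f z - g z)%C x1 x2 y1 y2 = (rect f x1 x2 y1 y2 - rect g x1 x2 y1 y2)%C.
Proof.
intros Hx Hy Hf Hg. destruct (edges_cont f x1 x2 y1 y2 Hx Hy Hf) as [H1 [H2 [H3 H4]]].
destruct (edges_cont g x1 x2 y1 y2 Hx Hy Hg) as [K1 [K2 [K3 K4]]].
unfold rect. rewrite !CRInt_minus by auto. ring.
Qed.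

Lemma rect_ext f g x1 x2 y1 y2 : x1 <= x2 -> y1 <= y2 ->
  (forall x y, x1 <= x <= x2 -> y1 <= y <= y2 ->
    (x = x1 \/ x = x2 \/ y = y1 \/ y = y2) -> f (x, y) = g (x, y)) ->
  rect f x1 x2 y1 y2 = rect g x1 x2 y1 y2.
Proof.
intros Hx Hy H. unfold rect.
rewrite (CRInt_ext (fun x => f (x, y1)) (fun x => g (x, y1))),
 (CRInt_ext (fun x => f (x, y2)) (fun x => g (x, y2))),
 (CRInt_ext (fun y => f (x1, y)) (fun y => g (x1, y))),
 (CRInt_ext (fun y => f (x2, y)) (fun y => g (x2, y))); auto;
 intros t Ht; rewrite Rmin_left, Rmax_right in Ht by auto; apply H; auto; lra.
Qed.

Lemma rect_bound f x1 x2 y1 y2 M : x1 <= x2 -> y1 <= y2 -> cont_edges f x1 x2 y1 y2 ->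
  (forall x y, x1 <= x <= x2 -> y1 <= y <= y2 ->
    (x = x1 \/ x = x2 \/ y = y1 \/ y = y2) -> Cmod (f (x, y)) <= M) ->
  Cmod (rect f x1 x2 y1 y2) <= 2 * ((x2 - x1) + (y2 - y1)) * M.
Proof.
intros Hx Hy H HM. destruct (edges_cont f x1 x2 y1 y2 Hx Hy H) as [H1 [H2 [H3 H4]]].
unfold rect, Cminus.
eapply Rle_trans. apply Cmod_triangle. eapply Rle_trans. apply Rplus_le_compat_r. apply Cmod_triangle.
eapply Rle_trans. apply Rplus_le_compat_r. apply Rplus_le_compat_r. apply Cmod_triangle.
rewrite !Cmod_opp, !Cmod_mult, !Cmod_Ci, !Rmult_1_l.
assert (Cmod (CRInt (fun x => f (x, y1)) x1 x2) <= (x2 - x1) * M) by (apply CRInt_bound; auto; intros; apply HM; auto; lra).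
assert (Cmod (CRInt (fun x => f (x, y2)) x1 x2) <= (x2 - x1) * M) by (apply CRInt_bound; auto; intros; apply HM; auto; lra).
assert (Cmod (CRInt (fun y => f (x1, y)) y1 y2) <= (y2 - y1) * M) by (apply CRInt_bound; auto; intros; apply HM; auto; lra).
assert (Cmod (CRInt (fun y => f (x2, y)) y1 y2) <= (y2 - y1) * M) by (apply CRInt_bound; auto; intros; apply HM; auto; lra).
lra.
Qed.

Lemma rect_split_x f x1 x x2 y1 y2 : x1 <= x <= x2 -> y1 <= y2 -> cont_rect f x1 x2 y1 y2 ->
  rect f x1 x2 y1 y2 = (rect f x1 x y1 y2 + rect f x x2 y1 y2)%C.
Proof.
intros Hx Hy H. unfold rect.
rewrite <- (CRInt_Chasles (fun x => f (x, y1)) x1 x x2).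
rewrite <- (CRInt_Chasles (fun x => f (x, y2)) x1 x x2). ring.
all: intros t Ht; rewrite Rmin_left, Rmax_right in Ht by lra; apply Ccont_horiz; apply H; lra.
Qed.

Lemma rect_split_y f x1 x2 y1 y y2 : x1 <= x2 -> y1 <= y <= y2 -> cont_rect f x1 x2 y1 y2 ->
  rect f x1 x2 y1 y2 = (rect f x1 x2 y1 y + rect f x1 x2 y y2)%C.
Proof.
intros Hx Hy H. unfold rect.
rewrite <- (CRInt_Chasles (fun y => f (x1, y)) y1 y y2).
rewrite <- (CRInt_Chasles (fun y => f (x2, y)) y1 y y2). ring.
all: intros t Ht; rewrite Rmin_left, Rmax_right in Ht by lra; apply Ccont_vert; apply H; lra.
Qed.

(** Each side contributes the increment of the primitive between two corners, and the increments
    around the boundary cancel. *)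
Lemma rect_primitive F f x1 x2 y1 y2 : x1 <= x2 -> y1 <= y2 ->
  (forall x y, x1 <= x <= x2 -> y1 <= y <= y2 -> is_Cd F (x, y) (f (x, y))) ->
  cont_rect f x1 x2 y1 y2 -> rect f x1 x2 y1 y2 = 0%C.
Proof.
intros Hx Hy HF H. destruct (edges_cont f x1 x2 y1 y2 Hx Hy (cont_rect_edges _ _ _ _ _ H)) as [H1 [H2 [H3 H4]]].
unfold rect. rewrite <- !CRInt_Cmult by auto.
rewrite (CRInt_derive (fun x => F (x, y1)) (fun x => f (x, y1))),
 (CRInt_derive (fun x => F (x, y2)) (fun x => f (x, y2))),
 (CRInt_derive (fun y => F (x1, y)) (fun y => Ci * f (x1, y))%C),
 (CRInt_derive (fun y => F (x2, y)) (fun y => Ci * f (x2, y))%C); auto.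
ring.
all: try (intros t Ht; apply continuous_Cmult_const; auto).
all: intros t Ht; rewrite Rmin_left, Rmax_right in Ht by lra.
apply (is_Cd_vert F x2). apply HF; lra.
apply (is_Cd_vert F x1). apply HF; lra.
apply (is_Cd_horiz F t y2). apply HF; lra.
apply (is_Cd_horiz F t y1). apply HF; lra.
Qed.

Lemma Cadd_sub (p w : C) : (p + (w - p))%C = w.
Proof. ring. Qed.

Lemma Cd_Ccont f z : Cd f z -> Ccont f z.
Proof. intros H. exact (Cd_continuous f z H). Qed.

(* Near a point of differentiability [f] is affine up to [eps |w - p|], and
   affine functions have a primitive. *)
Lemma rect_local f (p : C) : Cd f p -> forall eps, 0 < eps -> exists d, 0 < d /\
  forall x1 x2 y1 y2, x1 <= x2 -> y1 <= y2 -> x2 - x1 + (y2 - y1) < d ->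
   cont_rect f x1 x2 y1 y2 ->
   x1 <= fst p <= x2 -> y1 <= snd p <= y2 ->
   Cmod (rect f x1 x2 y1 y2) <= eps * (x2 - x1 + (y2 - y1)) ^ 2.
Proof.
intros [l Hl] eps He. destruct (Hl (eps / 2)) as [d [Hd H]]. lra.
exists d. split; auto. intros x1 x2 y1 y2 Hx Hy Hs Hc Hpx Hpy.
set (g := fun z : C => (f p + l * (z - p))%C).
assert (Hg : forall z, Ccont g z).
{ intros z. apply Cd_Ccont. apply Cd_plus. apply Cd_const. apply Cd_mult. apply Cd_const.
  apply Cd_minus. apply Cd_id. apply Cd_const. }
assert (E : rect g x1 x2 y1 y2 = 0%C).
{ apply (rect_primitive (fun z => f p * z + l * (/ 2 * ((z - p) * (z - p))))%C); auto.
  2: now intros x y _ _.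
  intros x y _ _.
  replace (g (x, y)) with ((0 * (x, y) + f p * 1) +
     (0 * (/ 2 * (((x, y) - p) * ((x, y) - p))) + l * (0 * (((x, y) - p) * ((x, y) - p)) + / 2 * ((1 + 0) * ((x, y) - p) + ((x, y) - p) * (1 + 0)))))%C.
  2:{ unfold g. field. }
  assert (Hm : is_Cd (fun z => z - p)%C (x, y) (1 + 0)%C).
  { apply (is_Cd_plus (fun z => z) (fun _ => - p)%C). apply is_Cd_id. apply is_Cd_const. }
  apply is_Cd_plus. apply (is_Cd_mult (fun _ => f p) (fun z => z)). apply is_Cd_const. apply is_Cd_id.
  apply (is_Cd_mult (fun _ => l) (fun z => / 2 * ((z - p) * (z - p)))%C). apply is_Cd_const.
  apply (is_Cd_mult (fun _ => / 2)%C (fun z => ((z - p) * (z - p)))%C). apply is_Cd_const.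
  apply (is_Cd_mult (fun z => z - p)%C (fun z => z - p)%C); auto. }
assert (E2 : rect f x1 x2 y1 y2 = rect (fun z => f z - g z)%C x1 x2 y1 y2).
{ rewrite rect_minus; auto. rewrite E; ring. now apply cont_rect_edges. now intros x y _ _ _. }
rewrite E2. set (s := x2 - x1 + (y2 - y1)) in *.
apply Rle_trans with (2 * s * (eps / 2 * s)); [ | right; field].
apply rect_bound; auto.
- intros x y Hx' Hy' _ e0 He0.
  assert (Cc : Ccont f (x, y)) by now apply Hc.
  destruct (Cc (e0 / 2)) as [d1 [Hd1 G1]]. lra.
  destruct (Hg (x, y) (e0 / 2)) as [d2 [Hd2 G2]]. lra.
  exists (Rmin d1 d2). split. now apply Rmin_pos. intros w Hw. apply Rmin_Rgt in Hw. destruct Hw as [Wa Wb].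
  specialize (G1 w Wa). specialize (G2 w Wb).
  replace (f w - g w - (f (x, y) - g (x, y)))%C with ((f w - f (x, y)) + - (g w - g (x, y)))%C by ring.
  eapply Rle_lt_trans. apply Cmod_triangle. rewrite Cmod_opp. lra.
- intros x y Hx' Hy' _. unfold g.
  assert (Hw : Cmod ((x, y) - p) <= s).
  { eapply Rle_trans. apply Cmod_le_sum. destruct p as [a b]; simpl in *. unfold s.
    apply Rplus_le_compat; apply Rabs_le; lra. }
  specialize (H ((x, y) - p)%C). rewrite (Cadd_sub p (x, y)) in H.
  replace (f (x, y) - (f p + l * ((x, y) - p)))%C with (f (x, y) - f p - l * ((x, y) - p))%C by ring.
  eapply Rle_trans. apply H. lra. apply Rmult_le_compat_l; lra.
Qed.

Lemma half_pow_small a d : 0 < d -> exists n, a / 2 ^ n < d.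
Proof.
intros Hd. destruct (Rle_or_lt a 0) as [Ha|Ha].
- exists 0%nat. simpl. lra.
- destruct (pow_lt_1_zero (/ 2)) with (y := d / a) as [N HN].
  rewrite Rabs_pos_eq; lra. apply Rdiv_lt_0_compat; auto.
  exists N. specialize (HN N (Nat.le_refl N)).
  rewrite Rabs_pos_eq in HN by (apply pow_le; lra). rewrite pow_inv in HN.
  apply Rmult_lt_compat_l with (r := a) in HN; auto.
  unfold Rdiv at 1. eapply Rlt_le_trans. exact HN. right; field; lra.
Qed.

Section Bisection.
Variables (f : C -> C) (x1 x2 y1 y2 eps : R).
Hypothesis (Hx : x1 <= x2) (Hy : y1 <= y2).
Hypothesis Hf : forall x y, x1 <= x <= x2 -> y1 <= y <= y2 -> Cd f (x, y).
Let W := x2 - x1.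
Let H := y2 - y1.

(** [c] is the lower left corner of a rectangle of generation [n]. The threshold shrinks by 4 at
    each step, like the area, which is what the triangle inequality for four quarters allows. *)
Let bad (n : nat) (c : R * R) : Prop :=
  x1 <= fst c /\ fst c + W / 2 ^ n <= x2 /\ y1 <= snd c /\ snd c + H / 2 ^ n <= y2 /\
  eps / 4 ^ n < Cmod (rect f (fst c) (fst c + W / 2 ^ n) (snd c) (snd c + H / 2 ^ n)).

Lemma bad_step n c : bad n c -> exists c', bad (S n) c' /\
  fst c <= fst c' /\ fst c' + W / 2 ^ S n <= fst c + W / 2 ^ n /\
  snd c <= snd c' /\ snd c' + H / 2 ^ S n <= snd c + H / 2 ^ n.
Proof.
destruct c as [u v]. unfold bad. simpl fst; simpl snd. intros [B1 [B2 [B3 [B4 B5]]]].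
assert (P : 0 < 2 ^ n) by (apply pow_lt; lra).
assert (P4 : 0 < 4 ^ n) by (apply pow_lt; lra).
assert (EW : W / 2 ^ n = W / 2 ^ S n + W / 2 ^ S n) by (simpl; field; lra).
assert (EH : H / 2 ^ n = H / 2 ^ S n + H / 2 ^ S n) by (simpl; field; lra).
assert (W0 : 0 <= W / 2 ^ S n).
{ apply Rmult_le_pos. unfold W; lra. left. apply Rinv_0_lt_compat, pow_lt; lra. }
assert (H0 : 0 <= H / 2 ^ S n).
{ apply Rmult_le_pos. unfold H; lra. left. apply Rinv_0_lt_compat, pow_lt; lra. }
set (w := W / 2 ^ S n) in *. set (h := H / 2 ^ S n) in *.
rewrite EW, EH in *.
assert (E4 : eps / 4 ^ n = 4 * (eps / 4 ^ S n)) by (simpl; field; lra).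
rewrite E4 in B5. set (e := eps / 4 ^ S n) in *.
assert (Hc : forall a b, u <= a <= u + (w + w) -> v <= b <= v + (h + h) -> Ccont f (a, b)).
{ intros a b Ha Hb. apply Cd_Ccont, Hf; lra. }
rewrite (rect_split_x f u (u + w)) in B5; try lra.
2:{ intros a b Ha Hb; apply Hc; lra. }
rewrite (rect_split_y f u (u + w) v (v + h)) in B5; try lra.
2:{ intros a b Ha Hb; apply Hc; lra. }
rewrite (rect_split_y f (u + w) (u + (w + w)) v (v + h)) in B5; try lra.
2:{ intros a b Ha Hb; apply Hc; lra. }
replace (u + (w + w)) with (u + w + w) in * by ring.
replace (v + (h + h)) with (v + h + h) in * by ring.
destruct (Rle_or_lt (Cmod (rect f u (u + w) v (v + h))) e).
2:{ exists (u, v). simpl fst; simpl snd. repeat split; auto; lra. }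
destruct (Rle_or_lt (Cmod (rect f u (u + w) (v + h) (v + h + h))) e).
2:{ exists (u, v + h). simpl fst; simpl snd. repeat split; auto; lra. }
destruct (Rle_or_lt (Cmod (rect f (u + w) (u + w + w) v (v + h))) e).
2:{ exists (u + w, v). simpl fst; simpl snd. repeat split; auto; lra. }
destruct (Rle_or_lt (Cmod (rect f (u + w) (u + w + w) (v + h) (v + h + h))) e).
2:{ exists (u + w, v + h). simpl fst; simpl snd. repeat split; auto; lra. }
exfalso.
match type of B5 with _ < Cmod (?a + ?b + (?c + ?d)) =>
 pose proof (Cmod_triangle (a + b) (c + d)); pose proof (Cmod_triangle a b); pose proof (Cmod_triangle c d) end.
lra.
Qed.

(** The proof of [bad] travels with the corner because the choice of the next quarter depends on
    it. *)
Fixpoint bad_seq (b0 : {c | bad 0 c}) (n : nat) : {c | bad n c} :=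
  match n with
  | O => b0
  | S m => let b := bad_seq b0 m in
     let s := constructive_indefinite_description _ (bad_step m (proj1_sig b) (proj2_sig b)) in
     exist _ (proj1_sig s) (proj1 (proj2_sig s))
  end.

Lemma bad_seq_step b0 n :
  let c := proj1_sig (bad_seq b0 n) in let c' := proj1_sig (bad_seq b0 (S n)) in
  fst c <= fst c' /\ fst c' + W / 2 ^ S n <= fst c + W / 2 ^ n /\
  snd c <= snd c' /\ snd c' + H / 2 ^ S n <= snd c + H / 2 ^ n.
Proof.
intros c c'. exact (proj2 (proj2_sig (constructive_indefinite_description _
  (bad_step n c (proj2_sig (bad_seq b0 n)))))).
Qed.

Lemma bisection_bound : 0 < eps -> Cmod (rect f x1 x2 y1 y2) <= eps.
Proof.
intros He. destruct (Rle_or_lt (Cmod (rect f x1 x2 y1 y2)) eps) as [|Hlt]; auto. exfalso.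
assert (B0 : bad 0 (x1, y1)).
{ unfold bad; simpl fst; simpl snd. simpl pow. unfold Rdiv. rewrite Rinv_1, !Rmult_1_r.
  replace (x1 + W) with x2 by (unfold W; ring). replace (y1 + H) with y2 by (unfold H; ring).
  repeat split; lra. }
set (s := fun n => bad_seq (exist _ _ B0) n).
set (u := fun n => fst (proj1_sig (s n))). set (v := fun n => snd (proj1_sig (s n))).
assert (Hs : forall n, bad n (u n, v n)).
{ intros n. unfold u, v. rewrite <- surjective_pairing. apply (proj2_sig (s n)). }

assert (Hn : forall n, u n <= u (S n) /\ u (S n) + W / 2 ^ S n <= u n + W / 2 ^ n /\
   v n <= v (S n) /\ v (S n) + H / 2 ^ S n <= v n + H / 2 ^ n).
{ intros n. apply (bad_seq_step (exist _ _ B0) n). }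
assert (Hm : forall n k, u n <= u (n + k)%nat /\ u (n + k)%nat + W / 2 ^ (n + k) <= u n + W / 2 ^ n /\
   v n <= v (n + k)%nat /\ v (n + k)%nat + H / 2 ^ (n + k) <= v n + H / 2 ^ n).
{ intros n k. induction k as [|k IH]. rewrite Nat.add_0_r. lra.
  rewrite Nat.add_succ_r. specialize (Hn (n + k)%nat). lra. }
assert (PW : forall n, 0 <= W / 2 ^ n).
{ intros n. apply Rmult_le_pos. unfold W; lra. left. apply Rinv_0_lt_compat, pow_lt; lra. }
assert (PH : forall n, 0 <= H / 2 ^ n).
{ intros n. apply Rmult_le_pos. unfold H; lra. left. apply Rinv_0_lt_compat, pow_lt; lra. }
assert (Hu : forall m n, u m <= u n + W / 2 ^ n /\ v m <= v n + H / 2 ^ n).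
{ intros m n. destruct (Nat.le_ge_cases n m) as [L|L].
  - specialize (Hm n (m - n)%nat). replace (n + (m - n))%nat with m in Hm by lia.
    specialize (PW m). specialize (PH m). lra.
  - specialize (Hm m (n - m)%nat). replace (m + (n - m))%nat with n in Hm by lia.
    specialize (PW n). specialize (PH n). lra. }
(* Suprema of the coordinates of the corners: [(p, q)] lies in all the nested rectangles, because
   every left or lower end is below every right or upper end. *)
destruct (completeness (fun x => exists n, x = u n)) as [p [P1 P2]].
{ exists (u O + W / 2 ^ 0). intros x [n ->]. apply Hu. } { now exists (u O), O. }
destruct (completeness (fun x => exists n, x = v n)) as [q [Q1 Q2]].
{ exists (v O + H / 2 ^ 0). intros x [n ->]. apply Hu. } { now exists (v O), O. }
assert (Pn : forall n, u n <= p <= u n + W / 2 ^ n).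
{ intros n. split. apply P1; now exists n. apply P2. intros x [m ->]. apply Hu. }
assert (Qn : forall n, v n <= q <= v n + H / 2 ^ n).
{ intros n. split. apply Q1; now exists n. apply Q2. intros x [m ->]. apply Hu. }
assert (Hpq : Cd f (p, q)).
{ apply Hf; pose proof (Hs O) as B; unfold bad in B; simpl fst in B; simpl snd in B;
  specialize (Pn O); specialize (Qn O); lra. }
(* With this constant [rect_local] at [(p, q)] bounds the integral of a late generation [n] by
   [eps / 4 ^ n], against badness. The added 1 covers a degenerate rectangle. *)
set (e' := eps / ((W + H) ^ 2 + 1)).
assert (He' : 0 < e'). { apply Rdiv_lt_0_compat; auto. pose proof (pow2_ge_0 (W + H)). lra. }
destruct (rect_local f _ Hpq e' He') as [d [Hd Hr]].
destruct (half_pow_small (W + H) d Hd) as [n HnS].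
pose proof (Hs n) as B. unfold bad in B; simpl fst in B; simpl snd in B.
destruct B as [B1 [B2 [B3 [B4 B5]]]].
assert (P : 0 < 2 ^ n) by (apply pow_lt; lra).
assert (P4 : 0 < 4 ^ n) by (apply pow_lt; lra).
specialize (Hr (u n) (u n + W / 2 ^ n) (v n) (v n + H / 2 ^ n)).
specialize (PW n). specialize (PH n).
replace (u n + W / 2 ^ n - u n + (v n + H / 2 ^ n - v n)) with ((W + H) / 2 ^ n) in Hr by (field; lra).
assert (Hfin : e' * ((W + H) / 2 ^ n) ^ 2 <= eps / 4 ^ n).
{ replace (e' * ((W + H) / 2 ^ n) ^ 2) with (e' * (W + H) ^ 2 / 4 ^ n).
  2:{ replace (4 ^ n) with (2 ^ n * 2 ^ n). field; lra. rewrite <- Rpow_mult_distr. f_equal; lra. }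
  apply Rmult_le_compat_r. left; now apply Rinv_0_lt_compat.
  apply Rle_trans with (e' * ((W + H) ^ 2 + 1)). apply Rmult_le_compat_l; lra.
  unfold e'. right; field. pose proof (pow2_ge_0 (W + H)). lra. }
assert (Cmod (rect f (u n) (u n + W / 2 ^ n) (v n) (v n + H / 2 ^ n)) <= e' * ((W + H) / 2 ^ n) ^ 2).
{ apply Hr; simpl fst; simpl snd; try lra; auto.
  intros x y X Y. apply Cd_Ccont, Hf; lra. }
lra.
Qed.
End Bisection.

Theorem Goursat f x1 x2 y1 y2 : x1 <= x2 -> y1 <= y2 ->
  (forall x y, x1 <= x <= x2 -> y1 <= y <= y2 -> Cd f (x, y)) ->
  rect f x1 x2 y1 y2 = 0%C.
Proof.
intros Hx Hy Hf. apply Cmod_eq_0, Rle_antisym; [ | apply Cmod_ge_0].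
apply le_epsilon. intros e He. rewrite Rplus_0_l. now apply bisection_bound.
Qed.

(* The exceptional point is isolated in a square of arbitrarily small
   perimeter. *)
Lemma Goursat_except f x1 x2 y1 y2 (a b : R) : x1 < a < x2 -> y1 < b < y2 ->
  (forall x y, x1 <= x <= x2 -> y1 <= y <= y2 -> (x <> a \/ y <> b) -> Cd f (x, y)) ->
  Ccont f (a, b) ->
  rect f x1 x2 y1 y2 = 0%C.
Proof.
intros Hx Hy Hf Hab.
assert (Hc : cont_rect f x1 x2 y1 y2).
{ intros x y X Y. destruct (Req_dec x a) as [->|N]. destruct (Req_dec y b) as [->|N]; auto.
  apply Cd_Ccont, Hf; auto. apply Cd_Ccont, Hf; auto. }
destruct (Hab 1 Rlt_0_1) as [d [Hd Hd']].
set (M := Cmod (f (a, b)) + 1).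
apply Cmod_eq_0, Rle_antisym; [ | apply Cmod_ge_0].
apply le_epsilon. intros e He. rewrite Rplus_0_l.
assert (HM : 0 < M) by (unfold M; pose proof (Cmod_ge_0 (f (a, b))); lra).
set (h := Rmin (Rmin (Rmin (a - x1) (x2 - a)) (Rmin (b - y1) (y2 - b))) (Rmin (d / 3) (e / (8 * M)))).
assert (H0 : 0 < h).
{ repeat apply Rmin_pos; try lra. apply Rdiv_lt_0_compat; lra. }
assert (h <= a - x1 /\ h <= x2 - a /\ h <= b - y1 /\ h <= y2 - b /\ h <= d / 3 /\ h <= e / (8 * M)) as [L1 [L2 [L3 [L4 [L5 L6]]]]].
{ unfold h. repeat split.
  eapply Rle_trans; [apply Rmin_l|]. eapply Rle_trans; [apply Rmin_l|]. apply Rmin_l.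
  eapply Rle_trans; [apply Rmin_l|]. eapply Rle_trans; [apply Rmin_l|]. apply Rmin_r.
  eapply Rle_trans; [apply Rmin_l|]. eapply Rle_trans; [apply Rmin_r|]. apply Rmin_l.
  eapply Rle_trans; [apply Rmin_l|]. eapply Rle_trans; [apply Rmin_r|]. apply Rmin_r.
  eapply Rle_trans; [apply Rmin_r|]. apply Rmin_l.
  eapply Rle_trans; [apply Rmin_r|]. apply Rmin_r. }
rewrite (rect_split_x f x1 (a - h) x2) by (auto; lra).
rewrite (rect_split_x f (a - h) (a + h) x2); try lra.
2:{ intros x y X Y; apply Hc; lra. }
rewrite (rect_split_y f (a - h) (a + h) y1 (b - h) y2); try lra.
2:{ intros x y X Y; apply Hc; lra. }
rewrite (rect_split_y f (a - h) (a + h) (b - h) (b + h) y2); try lra.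
2:{ intros x y X Y; apply Hc; lra. }
rewrite (Goursat f x1 (a - h)); try lra. 2:{ intros x y X Y; apply Hf; lra. }
rewrite (Goursat f (a + h) x2); try lra. 2:{ intros x y X Y; apply Hf; lra. }
rewrite (Goursat f (a - h) (a + h) y1 (b - h)); try lra. 2:{ intros x y X Y; apply Hf; lra. }
rewrite (Goursat f (a - h) (a + h) (b + h) y2); try lra. 2:{ intros x y X Y; apply Hf; lra. }
replace (0 + (0 + (rect f (a - h) (a + h) (b - h) (b + h) + 0) + 0))%C with (rect f (a - h) (a + h) (b - h) (b + h)) by ring.
eapply Rle_trans. apply (rect_bound _ _ _ _ _ M); try lra.
- apply cont_rect_edges. intros x y X Y. apply Hc; lra.
- intros x y X Y _.
  replace (f (x, y)) with (f (a, b) + (f (x, y) - f (a, b)))%C by ring.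
  eapply Rle_trans. apply Cmod_triangle. unfold M. apply Rplus_le_compat_l. left. apply Hd'.
  eapply Rle_lt_trans. apply Cmod_le_sum. simpl.
  assert (Rabs (x + - a) <= h) by (apply Rabs_le; lra).
  assert (Rabs (y + - b) <= h) by (apply Rabs_le; lra). lra.
- apply Rle_trans with (8 * M * h). right; ring.
  apply Rle_trans with (8 * M * (e / (8 * M))). apply Rmult_le_compat_l; lra. right; field; lra.
Qed.

(** * The winding number of a rectangle and Cauchy's formula *)

Lemma continuous_C_pair (f g : R -> R) x :
  continuous f x -> continuous g x -> continuous (U := C_UniformSpace) (fun t => (f t, g t) : C) x.
Proof.
intros Hf Hg. apply (continuous_comp_2 (U := R_UniformSpace) (V := R_UniformSpace) (W := R_UniformSpace) (X := C_UniformSpace) f g (fun a b => (a, b) : C)); auto.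
intros P [e He]. exists e. intros [u v] Huv. apply He. exact Huv.
Qed.

Lemma atan_complement (x y : R) : 0 < x -> 0 < y -> atan (x / y) + atan (y / x) = PI / 2.
Proof.
intros Hx Hy. replace (y / x) with (/ (x / y)) by (field; lra). rewrite atan_inv. ring.
apply Rdiv_lt_0_compat; auto.
Qed.

(** The primitive is the logarithm of [w - p] without a choice of branch: the real part is the [ln]
    of the modulus, and on a horizontal line that misses [p = (a, b)] the argument is
    [- atan ((x - a) / (y - b))] up to a constant. *)
Lemma CRInt_inv_horiz (a b y x1 x2 : R) : y <> b ->
  CRInt (fun x => / ((x, y) - (a, b)))%C x1 x2 =
  ((ln ((x2 - a) ^ 2 + (y - b) ^ 2) - ln ((x1 - a) ^ 2 + (y - b) ^ 2)) / 2,
   - (atan ((x2 - a) / (y - b)) - atan ((x1 - a) / (y - b)))).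
Proof.
intros He. assert (Hp : forall x, 0 < (x - a) ^ 2 + (y - b) ^ 2).
{ intros x. pose proof (pow2_ge_0 (x - a)). assert (0 < (y - b) ^ 2) by (apply pow2_gt_0; lra). lra. }
rewrite (CRInt_derive (fun x => (ln ((x - a) ^ 2 + (y - b) ^ 2) / 2, - atan ((x - a) / (y - b))))).
apply injective_projections; simpl; field; lra.
- intros x _. unfold Cinv, Cminus, Cplus, Copp; simpl fst; simpl snd.
  specialize (Hp x). simpl in Hp. apply is_derive_pair.
  auto_derive; [repeat split; lra | field; repeat split; lra].
  auto_derive; [repeat split; lra | field; repeat split; lra].
- intros x _. unfold Cinv, Cminus, Cplus, Copp; simpl fst; simpl snd. specialize (Hp x). simpl in Hp.
  apply continuous_C_pair; apply (ex_derive_continuous (K := R_AbsRing) (V := R_NormedModule)); auto_derive; lra.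
Qed.

Lemma CRInt_inv_vert (a b x y1 y2 : R) : x <> a ->
  (Ci * CRInt (fun y => / ((x, y) - (a, b)))%C y1 y2)%C =
  ((ln ((x - a) ^ 2 + (y2 - b) ^ 2) - ln ((x - a) ^ 2 + (y1 - b) ^ 2)) / 2,
   atan ((y2 - b) / (x - a)) - atan ((y1 - b) / (x - a))).
Proof.
intros He. assert (Hp : forall y, 0 < (x - a) ^ 2 + (y - b) ^ 2).
{ intros y. pose proof (pow2_ge_0 (y - b)). assert (0 < (x - a) ^ 2) by (apply pow2_gt_0; lra). lra. }
rewrite (CRInt_derive (fun y => (atan ((y - b) / (x - a)), - (ln ((x - a) ^ 2 + (y - b) ^ 2) / 2)))).
apply injective_projections; simpl; field; lra.
- intros y _. unfold Cinv, Cminus, Cplus, Copp; simpl fst; simpl snd.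
  specialize (Hp y). simpl in Hp. apply is_derive_pair.
  auto_derive; [repeat split; lra | field; repeat split; lra].
  auto_derive; [repeat split; lra | field; repeat split; lra].
- intros y _. unfold Cinv, Cminus, Cplus, Copp; simpl fst; simpl snd. specialize (Hp y). simpl in Hp.
  apply continuous_C_pair; apply (ex_derive_continuous (K := R_AbsRing) (V := R_NormedModule)); auto_derive; lra.
Qed.

(** The logarithms cancel around the boundary. Eight arctangents remain, two at each corner, and by
    [atan_complement] each pair contributes [PI / 2]. *)
Lemma rect_inv (a b x1 x2 y1 y2 : R) : x1 < a < x2 -> y1 < b < y2 ->
  rect (fun w => / (w - (a, b)))%C x1 x2 y1 y2 = (RtoC (2 * PI) * Ci)%C.
Proof.
intros Hx Hy. unfold rect.
rewrite !CRInt_inv_horiz, !CRInt_inv_vert by lra.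
pose proof (atan_complement (x2 - a) (y2 - b)). pose proof (atan_complement (x2 - a) (b - y1)).
pose proof (atan_complement (a - x1) (y2 - b)). pose proof (atan_complement (a - x1) (b - y1)).
replace ((x2 - a) / (y1 - b)) with (- ((x2 - a) / (b - y1))) by (field; lra).
replace ((x1 - a) / (y1 - b)) with ((a - x1) / (b - y1)) by (field; lra).
replace ((y1 - b) / (x2 - a)) with (- ((b - y1) / (x2 - a))) by (field; lra).
replace ((x1 - a) / (y2 - b)) with (- ((a - x1) / (y2 - b))) by (field; lra).
replace ((y2 - b) / (x1 - a)) with (- ((y2 - b) / (a - x1))) by (field; lra).
replace ((y1 - b) / (x1 - a)) with ((b - y1) / (a - x1)) by (field; lra).
rewrite !atan_opp.
apply injective_projections; simpl; lra.
Qed.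

Lemma Ccont_mult f g z : Ccont f z -> Ccont g z -> Ccont (fun w => f w * g w)%C z.
Proof.
intros Hf Hg eps He.
pose proof (Cmod_ge_0 (f z)) as F0. pose proof (Cmod_ge_0 (g z)) as G0.
set (e := Rmin 1 (eps / (2 * (Cmod (f z) + Cmod (g z) + 1)))).
assert (Hep : 0 < e) by (apply Rmin_pos; [lra | apply Rdiv_lt_0_compat; lra]).
destruct (Hf e Hep) as [d1 [Hd1 H1]]. destruct (Hg e Hep) as [d2 [Hd2 H2]].
exists (Rmin d1 d2). split. now apply Rmin_pos. intros y Hy. apply Rmin_Rgt in Hy. destruct Hy as [Ha Hb].
specialize (H1 y Ha). specialize (H2 y Hb).
replace (f y * g y - f z * g z)%C with ((f y - f z) * (g y - g z) + ((f y - f z) * g z + f z * (g y - g z)))%C by ring.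
eapply Rle_lt_trans. apply Cmod_triangle.
eapply Rle_lt_trans. apply Rplus_le_compat_l. apply Cmod_triangle. rewrite !Cmod_mult.
set (A := Cmod (f y - f z)) in *. set (B := Cmod (g y - g z)) in *.
assert (0 <= A) by apply Cmod_ge_0. assert (0 <= B) by apply Cmod_ge_0.
assert (e <= 1) by apply Rmin_l.
assert (e * (2 * (Cmod (f z) + Cmod (g z) + 1)) <= eps).
{ apply Rle_trans with (eps / (2 * (Cmod (f z) + Cmod (g z) + 1)) * (2 * (Cmod (f z) + Cmod (g z) + 1))).
  apply Rmult_le_compat_r. lra. apply Rmin_r. right; field. lra. }
nra.
Qed.

Lemma Cd_inv_sub (p w : C) : w <> p -> Cd (fun w => / (w - p))%C w.
Proof.
intros H. apply Cd_inv. apply Cd_minus. apply Cd_id. apply Cd_const.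
intros E. apply H. replace w with ((w - p) + p)%C by ring. rewrite E. ring.
Qed.

(** The difference quotient of [u] at [p], completed by the derivative [l] at [p], is continuous
    there and holomorphic elsewhere, so [Goursat_except] kills its integral. On the boundary it
    splits into the wanted integrand and [u p / (w - p)], which [rect_inv] evaluates. *)
Theorem Cauchy_formula u (x1 x2 y1 y2 a b : R) : x1 < a < x2 -> y1 < b < y2 ->
  (forall x y, x1 <= x <= x2 -> y1 <= y <= y2 -> Cd u (x, y)) ->
  rect (fun w => u w / (w - (a, b)))%C x1 x2 y1 y2 = (RtoC (2 * PI) * Ci * u (a, b))%C.
Proof.
intros Hx Hy Hu. set (p := (a, b) : C).
destruct (Hu a b) as [l Hl]; try lra. fold p in Hl.
set (g := fun w => if excluded_middle_informative (w = p) then l else ((u w - u p) / (w - p))%C).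
assert (Hg : forall w, w <> p -> Cd (fun w => (u w - u p) / (w - p))%C w -> Cd g w).
{ intros w Hw H. assert (0 < Cmod (w - p)).
  { apply Cmod_gt_0. intros E. apply Hw. replace w with ((w - p) + p)%C by ring. rewrite E; ring. }
  apply (Cd_ext (fun w => (u w - u p) / (w - p))%C _ w (Cmod (w - p))); auto.
  intros v Hv. unfold g. destruct excluded_middle_informative as [->|]; auto.
  exfalso. replace (p - w)%C with (- (w - p))%C in Hv by ring. rewrite Cmod_opp in Hv. lra. }
assert (Hg' : forall x y, x1 <= x <= x2 -> y1 <= y <= y2 -> (x <> a \/ y <> b) -> Cd g (x, y)).
{ intros x y X Y N. assert ((x, y) <> p) by (intros E; inversion E; destruct N; auto).
  apply Hg; auto. apply Cd_mult. apply Cd_minus; auto. apply Cd_const. now apply Cd_inv_sub. }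
assert (E0 : rect g x1 x2 y1 y2 = 0%C).
{ apply (Goursat_except g x1 x2 y1 y2 a b); auto.
  intros eps He. destruct (Hl (eps / 2)) as [d [Hd H]]. lra. exists d. split; auto.
  intros w Hw. unfold g. fold p. destruct (excluded_middle_informative (p = p)) as [_|]; [|easy].
  destruct (excluded_middle_informative (w = p)) as [->|N].
  replace (l - l)%C with (RtoC 0) by ring. rewrite Cmod_0; lra.
  assert (N' : (w - p)%C <> 0%C). { intros E. apply N. replace w with ((w - p) + p)%C by ring. rewrite E; ring. }
  specialize (H (w - p)%C Hw). replace (p + (w - p))%C with w in H by ring.
  replace ((u w - u p) / (w - p) - l)%C with ((u w - u p - l * (w - p)) / (w - p))%C by (field; auto).
  rewrite Cmod_div by auto. apply Cmod_gt_0 in N'.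
  apply Rle_lt_trans with (eps / 2); [|lra].
  apply Rmult_le_reg_r with (Cmod (w - p)); auto. unfold Rdiv at 1. rewrite Rmult_assoc, Rinv_l, Rmult_1_r; lra. }
assert (Hne : forall x y, (x = x1 \/ x = x2 \/ y = y1 \/ y = y2) -> (x, y) <> p).
{ intros x y Hxy E. inversion E. lra. }
assert (C1 : cont_edges (fun w => u w / (w - p))%C x1 x2 y1 y2).
{ intros x y X Y N. apply Cd_Ccont. apply Cd_mult; auto. apply Cd_inv_sub; auto. }
assert (C2 : cont_edges (fun w => / (w - p))%C x1 x2 y1 y2).
{ intros x y X Y N. apply Cd_Ccont. apply Cd_inv_sub; auto. }
assert (C3 : cont_edges (fun w => u p * / (w - p))%C x1 x2 y1 y2).
{ intros x y X Y N. apply Ccont_mult; auto. apply Cd_Ccont, Cd_const. }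
assert (E1 : rect g x1 x2 y1 y2 = (rect (fun w => u w / (w - p))%C x1 x2 y1 y2 - u p * (RtoC (2 * PI) * Ci))%C).
{ pose proof (rect_inv a b x1 x2 y1 y2 Hx Hy) as RI. fold p in RI. rewrite <- RI, <- rect_mult_const; try lra; auto.
  rewrite <- rect_minus; try lra; auto.
  apply rect_ext; try lra. intros x y X Y N. unfold g. destruct excluded_middle_informative as [E|_].
  now apply Hne in E. fold p. unfold Cdiv. ring. }
rewrite E0 in E1.
replace (rect (fun w => u w / (w - p))%C x1 x2 y1 y2) with
 (rect (fun w => u w / (w - p))%C x1 x2 y1 y2 - u p * (RtoC (2 * PI) * Ci) + u p * (RtoC (2 * PI) * Ci))%C by ring.
rewrite <- E1. ring.
Qed.

Lemma continuous_bounded (f : R -> C) (a b : R) : a <= b ->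
  (forall t, a <= t <= b -> continuous (U := C_UniformSpace) f t) ->
  exists M, forall t, a <= t <= b -> Cmod (f t) <= M.
Proof.
intros Hab Hf.
assert (Hr : exists Mx, forall c, a <= c <= b -> Cmod (f c) <= Cmod (f Mx)).
{ destruct (continuity_ab_maj (fun t => Cmod (f t)) a b Hab) as [Mx [H _]].
  2: now exists Mx.
  intros c Hc eps He. destruct (continuous_eps_Cmod f c (Hf c Hc) eps He) as [d [Hd H]].
  exists d. split; auto. intros x [_ Hx]. specialize (H x Hx). simpl. unfold R_dist.
  eapply Rle_lt_trans. 2: exact H.
  apply Rabs_le.
  pose proof (Cmod_triangle (f x - f c) (f c)) as T1. replace (f x - f c + f c)%C with (f x) in T1 by ring.
  pose proof (Cmod_triangle (f c - f x) (f x)) as T2. replace (f c - f x + f x)%C with (f c) in T2 by ring.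
  rewrite <- (Cmod_opp (f c - f x)) in T2. replace (- (f c - f x))%C with (f x - f c)%C in T2 by ring. lra. }
destruct Hr as [Mx H]. exists (Cmod (f Mx)). auto.
Qed.

Lemma edges_bounded f x1 x2 y1 y2 : x1 <= x2 -> y1 <= y2 -> cont_edges f x1 x2 y1 y2 ->
  exists M, forall x y, x1 <= x <= x2 -> y1 <= y <= y2 ->
    (x = x1 \/ x = x2 \/ y = y1 \/ y = y2) -> Cmod (f (x, y)) <= M.
Proof.
intros Hx Hy H. destruct (edges_cont f x1 x2 y1 y2 Hx Hy H) as [H1 [H2 [H3 H4]]].
destruct (continuous_bounded (fun x => f (x, y1)) x1 x2 Hx) as [M1 K1]. { intros t Ht. apply (H1 t). now rewrite Rmin_left, Rmax_right. }
destruct (continuous_bounded (fun x => f (x, y2)) x1 x2 Hx) as [M2 K2]. { intros t Ht. apply (H2 t). now rewrite Rmin_left, Rmax_right. }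
destruct (continuous_bounded (fun y => f (x1, y)) y1 y2 Hy) as [M3 K3]. { intros t Ht. apply (H3 t). now rewrite Rmin_left, Rmax_right. }
destruct (continuous_bounded (fun y => f (x2, y)) y1 y2 Hy) as [M4 K4]. { intros t Ht. apply (H4 t). now rewrite Rmin_left, Rmax_right. }
exists (Rmax (Rmax M1 M2) (Rmax M3 M4)). intros x y X Y [->|[->|[->| ->]]].
- eapply Rle_trans. apply (K3 y Y). eapply Rle_trans; [|apply Rmax_r]. apply Rmax_l.
- eapply Rle_trans. apply (K4 y Y). eapply Rle_trans; [|apply Rmax_r]. apply Rmax_r.
- eapply Rle_trans. apply (K1 x X). eapply Rle_trans; [|apply Rmax_l]. apply Rmax_l.
- eapply Rle_trans. apply (K2 x X). eapply Rle_trans; [|apply Rmax_l]. apply Rmax_r.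
Qed.

Lemma Cd_pow f z n : Cd f z -> Cd (fun w => f w ^ n)%C z.
Proof.
intros H. induction n as [|n IH]; simpl. apply (Cd_const (RtoC 1)). now apply Cd_mult.
Qed.

(* Cauchy's formula for [h(w) / (w - c)^N], which is holomorphic because [h]
   vanishes near [c], gives [|h(z)| = O((|z - c| / L)^N)]. *)
Lemma local_identity h (c : C) L rho : 0 < L -> 0 < rho ->
  (forall x y, Rabs (x - fst c) <= L -> Rabs (y - snd c) <= L -> Cd h (x, y)) ->
  (forall w, Cmod (w - c) < rho -> h w = 0%C) ->
  forall z, Cmod (z - c) < L -> h z = 0%C.
Proof.
intros HL Hrho Hh H0 z Hz.
destruct c as [a b]. simpl fst in *; simpl snd in *. set (c := (a, b) : C) in *.
destruct z as [p q].
assert (Hp : Rabs (p - a) < L).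
{ eapply Rle_lt_trans. 2: exact Hz. apply (re_le_Cmod ((p, q) - c)%C). }
assert (Hq : Rabs (q - b) < L).
{ eapply Rle_lt_trans. 2: exact Hz. apply (Rabs_Im_le_Cmod ((p, q) - c)%C). }
apply Rabs_def2 in Hp. apply Rabs_def2 in Hq.
assert (Hsq : forall x y, a - L <= x <= a + L -> b - L <= y <= b + L -> Cd h (x, y)).
{ intros x y X Y. apply Hh; apply Rabs_le; lra. }
assert (HeL : forall x y, (x = a - L \/ x = a + L \/ y = b - L \/ y = b + L) -> L <= Cmod ((x, y) - c)).
{ intros x y E.
  pose proof (re_le_Cmod ((x, y) - c)%C) as R1. pose proof (Rabs_Im_le_Cmod ((x, y) - c)%C) as R2.
  simpl in R1, R2. destruct E as [->|[->|[->| ->]]].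
  - eapply Rle_trans; [|exact R1]. rewrite <- Rabs_Ropp. eapply Rle_trans; [|apply Rle_abs]. lra.
  - eapply Rle_trans; [|exact R1]. eapply Rle_trans; [|apply Rle_abs]. lra.
  - eapply Rle_trans; [|exact R2]. rewrite <- Rabs_Ropp. eapply Rle_trans; [|apply Rle_abs]. lra.
  - eapply Rle_trans; [|exact R2]. eapply Rle_trans; [|apply Rle_abs]. lra. }
assert (Hez : forall x y, (x = a - L \/ x = a + L \/ y = b - L \/ y = b + L) -> (x, y) <> ((p, q) : C)).
{ intros x y E1 E. inversion E. lra. }
set (F := fun w => (h w / (w - (p, q)))%C).
assert (CF : cont_edges F (a - L) (a + L) (b - L) (b + L)).
{ intros x y X Y E. apply Cd_Ccont. apply Cd_mult; auto. apply Cd_inv_sub; auto. }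
destruct (edges_bounded F (a - L) (a + L) (b - L) (b + L)) as [M HM]; try lra; auto.
assert (Hnc : forall w, Cmod (w - c) >= rho -> (w - c)%C <> 0%C).
{ intros w Hw E. rewrite E, Cmod_0 in Hw. lra. }
destruct (Rlt_or_le (Cmod ((p, q) - c)) rho) as [Hlt|Hge]. { now apply H0. }
assert (Hrz : 0 < Cmod ((p, q) - c)) by lra.
set (r := Cmod ((p, q) - c)) in *.
assert (Hbound : forall n, Cmod (h (p, q)) <= 2 * (2 * L + 2 * L) * M / (2 * PI) * (r / L) ^ n).
{ intros n. set (u := fun w => (h w * / (w - c) ^ n)%C).
  assert (Hu : forall x y, a - L <= x <= a + L -> b - L <= y <= b + L -> Cd u (x, y)).
  { intros x y X Y. destruct (Rlt_or_le (Cmod ((x, y) - c)) rho) as [Hl|Hg].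
    (* On the disc of radius [rho] the function [u] vanishes identically, at [c] too, whatever the
       inverse of 0 is. *)
    - apply (Cd_ext (fun _ => 0%C) _ _ (rho - Cmod ((x, y) - c))). lra.
      intros w Hw. unfold u. rewrite H0. ring.
      replace (w - c)%C with ((w - (x, y)) + ((x, y) - c))%C by ring.
      eapply Rle_lt_trans. apply Cmod_triangle. lra. apply Cd_const.
    - apply Cd_mult; auto. apply Cd_inv. apply Cd_pow. apply Cd_minus. apply Cd_id. apply Cd_const.
      apply Cpow_nz. apply Hnc. lra. }
  pose proof (Cauchy_formula u (a - L) (a + L) (b - L) (b + L) p q ltac:(lra) ltac:(lra) Hu) as CFm.
  assert (B : Cmod (rect (fun w => u w / (w - (p, q)))%C (a - L) (a + L) (b - L) (b + L)) <=
     2 * ((a + L - (a - L)) + (b + L - (b - L))) * (M / L ^ n)).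
  { apply rect_bound; try lra.
    - intros x y X Y E. apply Cd_Ccont. apply Cd_mult; auto. apply Cd_inv_sub; auto.
    - intros x y X Y E. pose proof (HM x y X Y E) as HMxy. unfold u.
      assert (Nz : ((x, y) - c)%C <> 0%C). { apply Cmod_gt_0. specialize (HeL x y E). lra. }
      replace (h (x, y) * / ((x, y) - c) ^ n / ((x, y) - (p, q)))%C with (F (x, y) * / ((x, y) - c) ^ n)%C by (unfold F, Cdiv; ring).
      rewrite Cmod_mult, Cmod_inv by now apply Cpow_nz. rewrite Cmod_pow.
      apply Rmult_le_compat; auto. apply Cmod_ge_0. left; apply Rinv_0_lt_compat, pow_lt. specialize (HeL x y E); lra.
      apply Rinv_le_contravar. now apply pow_lt. apply pow_incr. specialize (HeL x y E); lra. }
  rewrite CFm in B. rewrite !Cmod_mult, Cmod_R, Cmod_Ci, Rmult_1_r, Rabs_pos_eq in B by (pose proof PI_RGT_0; lra).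
  unfold u in B. rewrite Cmod_mult, Cmod_inv, Cmod_pow in B by (apply Cpow_nz; apply Hnc; fold r; lra). fold r in B.
  pose proof PI_RGT_0. assert (0 < L ^ n) by now apply pow_lt. assert (0 < r ^ n) by now apply pow_lt.
  unfold Rdiv. rewrite Rpow_mult_distr, pow_inv.
  apply Rmult_le_reg_l with (2 * PI * / r ^ n). { apply Rmult_lt_0_compat. lra. now apply Rinv_0_lt_compat. }
  eapply Rle_trans. 2: eapply Rle_trans. 2: exact B. right; ring. right; field; repeat split; lra. }
apply Cmod_eq_0, Rle_antisym; [|apply Cmod_ge_0].
apply le_epsilon. intros e He. rewrite Rplus_0_l.
set (K := 2 * (2 * L + 2 * L) * M / (2 * PI)) in *.
assert (HK : 0 < Rabs K + 1) by (pose proof (Rabs_pos K); lra).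
destruct (pow_lt_1_zero (r / L)) with (y := e / (Rabs K + 1)) as [N HN].
{ rewrite Rabs_pos_eq. apply Rmult_lt_reg_r with L; auto. unfold Rdiv. rewrite Rmult_assoc, Rinv_l; lra.
  left. apply Rdiv_lt_0_compat; lra. }
{ apply Rdiv_lt_0_compat; lra. }
specialize (HN N (Nat.le_refl N)). specialize (Hbound N).
assert (P : 0 < (r / L) ^ N) by (apply pow_lt, Rdiv_lt_0_compat; lra).
rewrite Rabs_pos_eq in HN by lra.
eapply Rle_trans. exact Hbound. pose proof (Rle_abs K).
apply Rle_trans with ((Rabs K + 1) * (e / (Rabs K + 1))). 2: right; field; lra.
apply Rle_trans with ((Rabs K + 1) * (r / L) ^ N). apply Rmult_le_compat_r; lra. apply Rmult_le_compat_l; lra.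
Qed.

(** Chain of discs of radius [L] with centres [c + k d]: the disc of radius [L - Cmod d] around each
    centre is contained in the preceding disc, so vanishing propagates by [local_identity]. *)
Lemma identity_chain h (c d : C) L rho n : 0 < L -> 0 < rho -> Cmod d < L ->
  (forall k x y, (k <= n)%nat -> Rabs (x - fst (c + INR k * d)%C) <= L ->
     Rabs (y - snd (c + INR k * d)%C) <= L -> Cd h (x, y)) ->
  (forall w, Cmod (w - c) < rho -> h w = 0%C) ->
  forall z, Cmod (z - (c + INR n * d)) < L -> h z = 0%C.
Proof.
intros HL Hr Hd. induction n as [|n IH]; intros Hh H0.
- intros z Hz. apply (local_identity h (c + INR 0 * d)%C L rho); auto.
  intros x y X Y. now apply (Hh O).
  intros w Hw. apply H0. replace (w - c)%C with (w - (c + INR 0 * d))%C by (simpl; ring). exact Hw.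
- assert (IH' : forall z : C, Cmod (z - (c + INR n * d)) < L -> h z = 0%C).
  { apply IH; auto. intros k x y Hk. apply (Hh k). lia. }
  apply (local_identity h (c + INR (S n) * d)%C L (L - Cmod d)); auto. lra.
  intros x y X Y. now apply (Hh (S n)).
  intros w Hw. apply IH'.
  replace (w - (c + INR n * d))%C with ((w - (c + INR (S n) * d)) + d)%C by (rewrite S_INR, RtoC_plus; ring).
  eapply Rle_lt_trans. apply Cmod_triangle. lra.
Qed.

(** * Absolutely convergent integrals over the real line *)

(** One weight for all integrands over the real line: [M * atan] is an explicit primitive, so tails
    are computed exactly, and the total mass is [PI * M]. *)
Definition decays_by (M : R) (f : R -> C) : Prop :=
  (forall t, continuous (U := C_UniformSpace) f t) /\ forall t, Cmod (f t) <= M / (1 + t ^ 2).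

Definition decays (f : R -> C) : Prop := exists M, decays_by M f.

Definition LInt (f : R -> C) : C := CInt f (Rbar_locally m_infty) (Rbar_locally p_infty).

Lemma one_plus_sq (t : R) : 0 < 1 + t ^ 2.
Proof. pose proof (pow2_ge_0 t). lra. Qed.

Lemma decays_by_nonneg M f : decays_by M f -> 0 <= M.
Proof.
intros [_ H]. specialize (H 0). pose proof (Cmod_ge_0 (f 0)).
replace (M / (1 + 0 ^ 2)) with M in H by field. lra.
Qed.

Lemma is_RInt_atan M a b : is_RInt (fun t => M / (1 + t ^ 2)) a b (M * (atan b - atan a)).
Proof.
replace (M * (atan b - atan a)) with (minus (M * atan b) (M * atan a)) by (unfold minus, plus, opp; simpl; ring).
apply (is_RInt_derive (fun t => M * atan t) (fun t => M / (1 + t ^ 2))).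
- intros x _. pose proof (one_plus_sq x). auto_derive; auto. simpl in *. field; lra.
- intros x _. pose proof (one_plus_sq x). apply (ex_derive_continuous (K := R_AbsRing) (V := R_NormedModule)).
  auto_derive. simpl in *; lra.
Qed.

Lemma cont_on_all (f : R -> C) a b : (forall t, continuous (U := C_UniformSpace) f t) -> cont_on f a b.
Proof. intros H t _. apply H. Qed.

Lemma CRInt_decays M f a b : a <= b -> decays_by M f -> Cmod (CRInt f a b) <= M * (atan b - atan a).
Proof.
intros Hab [Hc Hb]. apply (CRInt_bound_fun f (fun t => M / (1 + t ^ 2))); auto.
now apply cont_on_all. apply is_RInt_atan.
Qed.

Lemma CRInt_decays_abs M f a b : decays_by M f -> Cmod (CRInt f a b) <= M * Rabs (atan b - atan a).
Proof.
intros H. destruct (Rle_or_lt a b) as [L|L].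
- eapply Rle_trans. now apply (CRInt_decays M). apply Rmult_le_compat_l. now apply decays_by_nonneg in H. apply Rle_abs.
- replace (CRInt f a b) with (- CRInt f b a)%C.
  2:{ unfold CRInt. apply (opp_RInt_swap (V := C_R_CompleteNormedModule)).
      apply (ex_RInt_continuous (V := C_R_CompleteNormedModule)). intros; apply H. }
  rewrite Cmod_opp, <- Rabs_Ropp. eapply Rle_trans. apply (CRInt_decays M); auto. lra.
  apply Rmult_le_compat_l. now apply decays_by_nonneg in H. eapply Rle_trans; [|apply Rle_abs]. lra.
Qed.

Lemma atan_lim eps : 0 < eps -> exists T, forall t, T < t -> PI / 2 - atan t < eps.
Proof.
intros He. set (e := Rmin eps (PI / 4)).
assert (Hp : 0 < e) by (apply Rmin_pos; pose proof PI_RGT_0; lra).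
assert (e <= PI / 4) by apply Rmin_r. assert (e <= eps) by apply Rmin_l. pose proof PI_RGT_0.
exists (tan (PI / 2 - e)). intros t Ht. apply atan_increasing in Ht. rewrite atan_tan in Ht; lra.
Qed.

Lemma is_RInt_gen_eps (f : R -> C) Fa Fb (FFa : Filter Fa) (FFb : Filter Fb) l :
  (forall eps, 0 < eps -> filter_prod Fa Fb (fun ab => exists z,
     is_RInt (V := C_R_NormedModule) f (fst ab) (snd ab) z /\ Cmod (z - l) < eps)) ->
  is_RInt_gen (V := C_R_NormedModule) f Fa Fb l.
Proof.
intros H. apply (filterlimi_locally (U := C_UniformSpace)). intros eps.
apply (filter_imp (F := filter_prod Fa Fb) (fun ab => exists z,
     is_RInt (V := C_R_NormedModule) f (fst ab) (snd ab) z /\ Cmod (z - l) < eps)).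
- intros ab [z [H1 H2]]. exists z. split; auto. now apply C_NormedModule_mixin_compat1.
- apply H. apply cond_pos.
Qed.

Lemma is_RInt_gen_eps_inv (f : R -> C) Fa Fb (FFa : Filter Fa) (FFb : Filter Fb) l :
  is_RInt_gen (V := C_R_NormedModule) f Fa Fb l ->
  (forall eps, 0 < eps -> filter_prod Fa Fb (fun ab => exists z,
     is_RInt (V := C_R_NormedModule) f (fst ab) (snd ab) z /\ Cmod (z - l) < eps)).
Proof.
intros H eps He.
assert (He' : 0 < eps / sqrt 2) by (apply Rdiv_lt_0_compat; [lra | apply Rlt_sqrt2_0]).
apply (proj1 (filterlimi_locally (U := C_UniformSpace) _ _)) with (eps := mkposreal _ He') in H.
revert H. apply filter_imp. intros ab [z [H1 H2]]. exists z. split; auto.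
apply C_NormedModule_mixin_compat2 in H2. eapply Rlt_le_trans. exact H2. simpl. right. field.
apply Rgt_not_eq, Rlt_sqrt2_0.
Qed.

Lemma CInt_unique f Fa Fb (FFa : ProperFilter' Fa) (FFb : ProperFilter' Fb) l :
  is_RInt_gen (V := C_R_NormedModule) f Fa Fb l -> CInt f Fa Fb = l.
Proof. apply (is_RInt_gen_unique (V := C_R_CompleteNormedModule)). Qed.

(** Cauchy's criterion: two truncated integrals differ by two tail pieces, and each piece is at most
    [M] times a small variation of [atan]. *)
Lemma LInt_correct f : decays f ->
  is_RInt_gen (V := C_R_NormedModule) f (Rbar_locally m_infty) (Rbar_locally p_infty) (LInt f).
Proof.
intros [M H].
assert (Hex : ex_RInt_gen (V := C_R_NormedModule) f (Rbar_locally m_infty) (Rbar_locally p_infty)).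
{ apply (proj1 (filterlimi_locally_cauchy (U := C_R_CompleteNormedModule)
    (F := filter_prod (Rbar_locally m_infty) (Rbar_locally p_infty))
    (fun ab => is_RInt (V := C_R_NormedModule) f (fst ab) (snd ab))
    (filter_forall _ (fun ab => conj (ex_intro _ _ (CRInt_correct f _ _ (cont_on_all f _ _ (proj1 H))))
       (fun y1 y2 h1 h2 => eq_trans (eq_sym (CRInt_unique _ _ _ _ h1)) (CRInt_unique _ _ _ _ h2)))))).
  intros eps. pose proof (decays_by_nonneg M f H) as M0.
  assert (He : 0 < eps / (4 * (M + 1))). { apply Rdiv_lt_0_compat. apply cond_pos. lra. }
  destruct (atan_lim _ He) as [T HT].
  exists (fun ab => fst ab < - T /\ T < snd ab). split.
  { apply Filter_prod with (fun a => a < - T) (fun b => T < b). now exists (- T). now exists T. auto. }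
  intros [u1 u2] [v1 v2] [U1 U2] [V1 V2] u' v' Hu Hv. simpl in *.
  apply CRInt_unique in Hu. apply CRInt_unique in Hv. subst u' v'.
  apply C_NormedModule_mixin_compat1. unfold minus, plus, opp; simpl.
  change (Cmod (CRInt f v1 v2 - CRInt f u1 u2) < eps).
  rewrite <- (CRInt_Chasles f v1 u1 v2), <- (CRInt_Chasles f u1 u2 v2) by (apply cont_on_all, H).
  replace (CRInt f v1 u1 + (CRInt f u1 u2 + CRInt f u2 v2) - CRInt f u1 u2)%C with (CRInt f v1 u1 + CRInt f u2 v2)%C by ring.
  eapply Rle_lt_trans. apply Cmod_triangle.
  eapply Rle_lt_trans. apply Rplus_le_compat; apply (CRInt_decays_abs M); auto.
  pose proof (HT _ U2). pose proof (HT _ V2). pose proof (HT (- u1) ltac:(lra)). pose proof (HT (- v1) ltac:(lra)).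
  rewrite atan_opp in *.
  pose proof (atan_bound u1). pose proof (atan_bound u2). pose proof (atan_bound v1). pose proof (atan_bound v2).
  assert (Rabs (atan u1 - atan v1) <= eps / (4 * (M + 1))) by (apply Rabs_le; lra).
  assert (Rabs (atan v2 - atan u2) <= eps / (4 * (M + 1))) by (apply Rabs_le; lra).
  apply Rle_lt_trans with (2 * M * (eps / (4 * (M + 1)))). nra.
  apply Rlt_le_trans with (2 * (M + 1) * (eps / (4 * (M + 1)))). nra.
  apply Rle_trans with (eps / 2). right; field; lra. pose proof (cond_pos eps). lra. }
exact (RInt_gen_correct (V := C_R_CompleteNormedModule) f Hex).
Qed.

Lemma LInt_approx M f T : decays_by M f -> 0 <= T ->
  Cmod (LInt f - CRInt f (- T) T) <= 2 * M * (PI / 2 - atan T).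
Proof.
intros H HT. pose proof (LInt_correct f (ex_intro (fun M => decays_by M f) M H)) as HL.
pose proof (decays_by_nonneg M f H) as M0.
apply le_epsilon. intros e He.
apply is_RInt_gen_eps_inv with (eps := e) in HL; auto; try typeclasses eauto.
destruct HL as [P Q [m1 HP] [m2 HQ] HPQ].
set (a := Rmin (m1 - 1) (- T)). set (b := Rmax (m2 + 1) T).
assert (a <= m1 - 1) by apply Rmin_l. assert (a <= - T) by apply Rmin_r.
assert (m2 + 1 <= b) by apply Rmax_l. assert (T <= b) by apply Rmax_r.
destruct (HPQ a b) as [z [Hz1 Hz2]]. apply HP; lra. apply HQ; lra. simpl in Hz1.
apply CRInt_unique in Hz1. subst z.
rewrite <- (CRInt_Chasles f a (- T) b), <- (CRInt_Chasles f (- T) T b) in Hz2 by (apply cont_on_all, H).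
set (I := CRInt f (- T) T) in *.
replace (LInt f - I)%C with (- (CRInt f a (- T) + (I + CRInt f T b) - LInt f) + (CRInt f a (- T) + CRInt f T b))%C by ring.
eapply Rle_trans. apply Cmod_triangle. rewrite Cmod_opp.
eapply Rle_trans. apply Rplus_le_compat_l. apply Cmod_triangle.
pose proof (CRInt_decays M f a (- T) ltac:(lra) H). pose proof (CRInt_decays M f T b ltac:(lra) H).
pose proof (atan_bound a). pose proof (atan_bound b). rewrite atan_opp in *. nra.
Qed.

Lemma LInt_bound M f : decays_by M f -> Cmod (LInt f) <= PI * M.
Proof.
intros H. pose proof (LInt_approx M f 0 H (Rle_refl 0)) as L.
rewrite atan_0 in L. replace (- 0) with 0 in L by ring.
replace (CRInt f 0 0) with (RtoC 0) in L.
2:{ symmetry. apply CRInt_unique. apply (is_RInt_point (V := C_R_NormedModule)). }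
replace (LInt f - 0)%C with (LInt f) in L by ring. lra.
Qed.

Lemma LInt_approx_eps f eps : decays f -> 0 < eps ->
  exists T0, 0 <= T0 /\ forall T, T0 <= T -> Cmod (LInt f - CRInt f (- T) T) <= eps.
Proof.
intros [M H] He. pose proof (decays_by_nonneg M f H) as M0.
destruct (atan_lim (eps / (2 * (M + 1)))) as [T HT]. apply Rdiv_lt_0_compat; lra.
exists (Rmax 0 (T + 1)). split. apply Rmax_l. intros t Ht.
pose proof (Rmax_l 0 (T + 1)). pose proof (Rmax_r 0 (T + 1)).
eapply Rle_trans. apply (LInt_approx M); auto. lra. specialize (HT t ltac:(lra)).
apply Rle_trans with (2 * (M + 1) * (eps / (2 * (M + 1)))). 2: right; field; lra.
pose proof (atan_bound t). nra.
Qed.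

(** Symmetric truncations determine the integral. The rules for scalar multiples, sums, reflection
    and conjugation are transferred from finite intervals by this criterion. *)
Lemma LInt_lim f l : decays f ->
  (forall eps, 0 < eps -> exists T0, forall T, T0 <= T -> Cmod (l - CRInt f (- T) T) <= eps) -> LInt f = l.
Proof.
intros H Hl.
assert (E : (LInt f - l)%C = 0%C).
{ apply Cmod_eq_0, Rle_antisym; [|apply Cmod_ge_0]. apply le_epsilon. intros e He. rewrite Rplus_0_l.
  destruct (LInt_approx_eps f (e / 2) H ltac:(lra)) as [T1 [_ H1]].
  destruct (Hl (e / 2) ltac:(lra)) as [T2 H2].
  set (T := Rmax T1 T2). specialize (H1 T (Rmax_l _ _)). specialize (H2 T (Rmax_r _ _)).
  replace (LInt f - l)%C with ((LInt f - CRInt f (- T) T) + - (l - CRInt f (- T) T))%C by ring.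
  eapply Rle_trans. apply Cmod_triangle. rewrite Cmod_opp. lra. }
replace (LInt f) with (LInt f - l + l)%C by ring. rewrite E; ring.
Qed.

Lemma decays_plus f g : decays f -> decays g -> decays (fun t => f t + g t)%C.
Proof.
intros [M [C1 B1]] [N [C2 B2]]. exists (M + N). split.
- intros t. now apply continuous_Cplus.
- intros t. eapply Rle_trans. apply Cmod_triangle. specialize (B1 t). specialize (B2 t). unfold Rdiv in *. lra.
Qed.

Lemma decays_by_Cmult M f c : decays_by M f -> decays_by (Cmod c * M) (fun t => c * f t)%C.
Proof.
intros [H1 H2]. split.
- intros t. now apply continuous_Cmult_const.
- intros t. rewrite Cmod_mult. unfold Rdiv. rewrite Rmult_assoc. apply Rmult_le_compat_l. apply Cmod_ge_0. apply H2.
Qed.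

Lemma decays_Cmult f c : decays f -> decays (fun t => c * f t)%C.
Proof. intros [M H]. eexists. apply decays_by_Cmult; eauto. Qed.

Lemma decays_ext f g : (forall t, f t = g t) -> decays f -> decays g.
Proof.
intros E [M [H1 H2]]. exists M. split.
- intros t. apply (continuous_ext f g); auto.
- intros t. rewrite <- E. auto.
Qed.

Lemma decays_minus f g : decays f -> decays g -> decays (fun t => f t - g t)%C.
Proof.
intros H1 H2. apply (decays_ext (fun t => f t + (- 1) * g t)%C). intros; ring.
apply decays_plus; auto. now apply decays_Cmult.
Qed.

Lemma LInt_ext f g : (forall t, f t = g t) -> LInt f = LInt g.
Proof.
intros E. f_equal. now apply functional_extensionality.
Qed.

Lemma LInt_Cmult f c : decays f -> LInt (fun t => c * f t)%C = (c * LInt f)%C.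
Proof.
intros H. apply LInt_lim. now apply decays_Cmult.
intros eps He. pose proof (Cmod_ge_0 c).
destruct (LInt_approx_eps f (eps / (Cmod c + 1)) H) as [T0 [_ HT]]. apply Rdiv_lt_0_compat; lra.
exists T0. intros T L. specialize (HT T L). destruct H as [M H].
rewrite CRInt_Cmult by (apply cont_on_all, H).
replace (c * LInt f - c * CRInt f (- T) T)%C with (c * (LInt f - CRInt f (- T) T))%C by ring.
rewrite Cmod_mult.
apply Rle_trans with ((Cmod c + 1) * (eps / (Cmod c + 1))). 2: right; field; lra.
apply Rmult_le_compat; try lra. apply Cmod_ge_0.
Qed.

Lemma LInt_plus f g : decays f -> decays g -> LInt (fun t => f t + g t)%C = (LInt f + LInt g)%C.
Proof.
intros Hf Hg. apply LInt_lim. now apply decays_plus.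
intros eps He.
destruct (LInt_approx_eps f (eps / 2) Hf ltac:(lra)) as [T1 [_ H1]].
destruct (LInt_approx_eps g (eps / 2) Hg ltac:(lra)) as [T2 [_ H2]].
exists (Rmax T1 T2). intros T L.
specialize (H1 T (Rle_trans _ _ _ (Rmax_l _ _) L)). specialize (H2 T (Rle_trans _ _ _ (Rmax_r _ _) L)).
destruct Hf as [M Hf]. destruct Hg as [N Hg].
rewrite CRInt_plus by (apply cont_on_all; [apply Hf || apply Hg]).
match goal with |- Cmod (?a + ?b - (?c + ?d)) <= _ => replace (a + b - (c + d))%C with ((a - c) + (b - d))%C by ring end.
eapply Rle_trans. apply Cmod_triangle. lra.
Qed.

Lemma LInt_minus f g : decays f -> decays g -> LInt (fun t => f t - g t)%C = (LInt f - LInt g)%C.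
Proof.
intros Hf Hg. rewrite (LInt_ext _ (fun t => f t + (- 1) * g t)%C) by (intros; ring).
rewrite LInt_plus, LInt_Cmult; auto. ring. now apply decays_Cmult.
Qed.

Lemma decays_reflect f : decays f -> decays (fun t => f (- t)).
Proof.
intros [M [H1 H2]]. exists M. split.
- intros t. apply (continuous_comp (U := R_UniformSpace) (V := R_UniformSpace) (W := C_UniformSpace) (fun t => - t) f); auto.
  apply (continuous_opp (V := R_NormedModule)). apply continuous_id.
- intros t. specialize (H2 (- t)). replace ((- t) ^ 2) with (t ^ 2) in H2 by ring. exact H2.
Qed.

Lemma LInt_reflect f : decays f -> LInt (fun t => f (- t)) = LInt f.
Proof.
intros H. pose proof (decays_reflect f H) as Hd.
apply LInt_lim; auto. intros eps He.
destruct (LInt_approx_eps f eps H He) as [T0 [H0 HT]]. exists T0. intros T L. specialize (HT T L).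
replace (CRInt (fun t => f (- t)) (- T) T) with (CRInt f (- T) T); auto.
destruct H as [M H]. symmetry. apply CRInt_unique.
replace (CRInt f (- T) T) with (opp (CRInt f (- - T) (- T))).
2:{ rewrite Ropp_involutive. apply (opp_RInt_swap (V := C_R_CompleteNormedModule)).
    apply (ex_RInt_continuous (V := C_R_CompleteNormedModule)). intros; apply H. }
apply (is_RInt_ext (V := C_R_NormedModule) (fun t => opp (opp (f (- t))))).
{ intros x _. apply injective_projections; apply Ropp_involutive. }
apply (is_RInt_opp (V := C_R_NormedModule)).
apply (is_RInt_comp_opp (V := C_R_NormedModule)).
apply CRInt_correct. apply cont_on_all, H.
Qed.

(** Differentiation under the integral sign. A second-order remainder, uniform in [t] relative to
    the weight, takes the place of dominated convergence. *)
Lemma LInt_is_Cd (k : C -> R -> C) (k1 : R -> C) (z : C) eta M : 0 < eta ->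
  (forall h, Cmod h < eta -> decays (k (z + h)%C)) -> decays k1 ->
  (forall h t, Cmod h < eta -> Cmod (k (z + h)%C t - k z t - h * k1 t) <= Cmod h * Cmod h * (M / (1 + t ^ 2))) ->
  is_Cd (fun s => LInt (k s)) z (LInt k1).
Proof.
intros He Hk Hk1 Hr eps Heps.
assert (Hkz : decays (k z)).
{ replace z with (z + 0)%C by ring. apply Hk. rewrite Cmod_0; auto. }
assert (HM : 0 <= Rabs M) by apply Rabs_pos. pose proof PI_RGT_0.
exists (Rmin eta (eps / (PI * (Rabs M + 1)))). split.
{ apply Rmin_pos; auto. apply Rdiv_lt_0_compat; auto. nra. }
intros h Hh. apply Rmin_Rgt in Hh. destruct Hh as [H1 H2]. specialize (Hr h).
rewrite (Cmult_comm (LInt k1)). rewrite <- LInt_Cmult, <- !LInt_minus; auto.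
2: apply decays_minus; auto. 2: now apply decays_Cmult.
assert (D : decays_by (Cmod h * Cmod h * M) (fun t => k (z + h)%C t - k z t - h * k1 t)%C).
{ split.
  - intros t. destruct (Hk h H1) as [? [K1 _]]. destruct Hkz as [? [K2 _]]. destruct Hk1 as [? [K3 _]].
    apply continuous_Cminus. apply continuous_Cminus; auto. now apply continuous_Cmult_const.
  - intros t. unfold Rdiv. rewrite Rmult_assoc. now apply Hr. }
apply LInt_bound in D. eapply Rle_trans. exact D.
pose proof (Cmod_ge_0 h).
apply Rle_trans with (PI * (Rabs M + 1) * (eps / (PI * (Rabs M + 1))) * Cmod h). 2: right; field; nra.
replace (PI * (Cmod h * Cmod h * M)) with (PI * M * Cmod h * Cmod h) by ring.
apply Rmult_le_compat_r; auto. pose proof (Rle_abs M).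
apply Rle_trans with (PI * (Rabs M + 1) * Cmod h). apply Rmult_le_compat_r; nra.
apply Rmult_le_compat_l; nra.
Qed.

Lemma is_series_C_eps (u : nat -> C) l :
  (forall eps, 0 < eps -> exists N, forall n, (N <= n)%nat -> Cmod (sum_n (G := C_AbelianMonoid) u n - l) < eps) ->
  is_series (V := C_NormedModule) u l.
Proof.
intros H. intros P [eps HP]. destruct (H eps (cond_pos eps)) as [N HN].
exists N. intros n Hn. apply HP. apply C_NormedModule_mixin_compat1. now apply HN.
Qed.

Lemma sum_n_LInt (g : nat -> R -> C) N : (forall n, decays (g n)) ->
  decays (fun t => sum_n (G := C_AbelianMonoid) (fun n => g n t) N) /\
  LInt (fun t => sum_n (G := C_AbelianMonoid) (fun n => g n t) N) = sum_n (G := C_AbelianMonoid) (fun n => LInt (g n)) N.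
Proof.
intros H. induction N as [|N [IH1 IH2]].
- split. apply (decays_ext (g O)); auto. intros; now rewrite sum_O.
  rewrite sum_O. apply LInt_ext. intros; now rewrite sum_O.
- split.
  apply (decays_ext (fun t => sum_n (G := C_AbelianMonoid) (fun n => g n t) N + g (S N) t)%C).
  intros; now rewrite sum_Sn. apply decays_plus; auto.
  rewrite sum_Sn, <- IH2. rewrite (LInt_ext _ (fun t => sum_n (G := C_AbelianMonoid) (fun n => g n t) N + g (S N) t)%C).
  now apply LInt_plus. intros; now rewrite sum_Sn.
Qed.

(** Exchange of sum and integral: [e N] measures the error of the partial sums relative to the
    weight, uniformly in [t], and integration only multiplies it by [PI]. *)
Lemma LInt_series (g : nat -> R -> C) (G : R -> C) (e : nat -> R) :
  (forall n, decays (g n)) -> decays G -> is_lim_seq e 0 ->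
  (forall N t, Cmod (sum_n (G := C_AbelianMonoid) (fun n => g n t) N - G t) <= e N / (1 + t ^ 2)) ->
  is_series (V := C_NormedModule) (fun n => LInt (g n)) (LInt G).
Proof.
intros Hg HG He Hb. apply is_series_C_eps. intros eps Heps. pose proof PI_RGT_0.
apply is_lim_seq_spec in He. destruct (He (mkposreal (eps / PI) (Rdiv_lt_0_compat _ _ Heps H))) as [N HN].
exists N. intros n Hn. specialize (HN n Hn). simpl in HN. rewrite Rminus_0_r in HN.
destruct (sum_n_LInt g n Hg) as [S1 S2]. rewrite <- S2, <- LInt_minus; auto.
assert (D : decays_by (e n) (fun t => sum_n (G := C_AbelianMonoid) (fun n => g n t) n - G t)%C).
{ split; auto. intros t. destruct S1 as [? [K1 _]]. destruct HG as [? [K2 _]]. now apply continuous_Cminus. }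
apply LInt_bound in D. eapply Rle_lt_trans. exact D.
apply Rle_lt_trans with (PI * Rabs (e n)). apply Rmult_le_compat_l. lra. apply Rle_abs.
apply Rlt_le_trans with (PI * (eps / PI)). now apply Rmult_lt_compat_l. right; field; lra.
Qed.

(** * Cauchy's formula for vertical strips *)

(** Two orders more than [decays]. They are spent on the factor [(s - w) ^ 2] from the second-order
    remainder in [ln x]; the square of the weight is chosen so that a factor [K * (1 + t ^ 2)]
    leaves exactly the weight of [decays]. *)
Definition decays4 (f : R -> C) : Prop :=
  (forall t, continuous (U := C_UniformSpace) f t) /\
  exists M, 0 <= M /\ forall t, Cmod (f t) <= M / (1 + t ^ 2) ^ 2.

(** The bound is asked for [1 <= Rabs t] only, where [t ^ 4] is a usable denominator;
    [decays4_of_tail] covers the remaining segment by compactness. *)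
Definition strip_ok (u : C -> C) (x1 x2 : R) : Prop :=
  (forall x t, x1 <= x <= x2 -> Cd u (x, t)) /\
  exists M, 0 <= M /\ forall x t, x1 <= x <= x2 -> 1 <= Rabs t -> Cmod (u (x, t)) <= M / t ^ 4.

Lemma Rdiv_le_num (a b c : R) : 0 < c -> a <= b -> a / c <= b / c.
Proof. intros. apply Rmult_le_compat_r; auto. left; now apply Rinv_0_lt_compat. Qed.

Lemma Rdiv_le_den (M b c : R) : 0 <= M -> 0 < c -> c <= b -> M / b <= M / c.
Proof. intros. apply Rmult_le_compat_l; auto. apply Rinv_le_contravar; auto. Qed.

Lemma Rle_div_l_iff (a b c : R) : 0 < c -> a <= b / c <-> a * c <= b.
Proof. intros H. split; apply Rle_div_r; auto. Qed.

Lemma decays4_decays f : decays4 f -> decays f.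
Proof.
intros [Hc [M [H0 HM]]]. exists M. split; auto. intros t. eapply Rle_trans. apply HM.
pose proof (one_plus_sq t). apply Rdiv_le_den; auto. pose proof (pow2_ge_0 t). nra.
Qed.

Lemma decays4_mult_quadratic (f g : R -> C) K : decays4 f -> (forall t, continuous (U := C_UniformSpace) g t) ->
  (forall t, Cmod (g t) <= K * (1 + t ^ 2)) -> decays (fun t => f t * g t)%C.
Proof.
intros [Hc [M [H0 HM]]] Hg HK. exists (M * K). split.
intros t; now apply continuous_Cmult.
intros t. rewrite Cmod_mult. pose proof (one_plus_sq t).
replace (M * K / (1 + t ^ 2)) with (M / (1 + t ^ 2) ^ 2 * (K * (1 + t ^ 2))) by (field; lra).
apply Rmult_le_compat; auto; apply Cmod_ge_0.
Qed.

Lemma decays4_mult_bounded (f g : R -> C) K : decays4 f -> (forall t, continuous (U := C_UniformSpace) g t) ->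
  (forall t, Cmod (g t) <= K) -> decays4 (fun t => f t * g t)%C.
Proof.
intros [Hc [M [H0 HM]]] Hg HK. split.
intros t; now apply continuous_Cmult. exists (M * K). split.
apply Rmult_le_pos; auto. eapply Rle_trans; [apply Cmod_ge_0|apply (HK 0)].
intros t. rewrite Cmod_mult.
replace (M * K / (1 + t ^ 2) ^ 2) with (M / (1 + t ^ 2) ^ 2 * K) by (pose proof (one_plus_sq t); field; lra).
apply Rmult_le_compat; auto; apply Cmod_ge_0.
Qed.

Lemma decays4_ext (f g : R -> C) : (forall t, f t = g t) -> decays4 f -> decays4 g.
Proof. intros E H. replace g with f; auto. now apply functional_extensionality. Qed.

Lemma decays4_of_tail f M : 0 <= M -> (forall t, continuous (U := C_UniformSpace) f t) ->
  (forall t, 1 <= Rabs t -> Cmod (f t) <= M / t ^ 4) -> decays4 f.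
Proof.
intros H0 Hc HM. split; auto.
destruct (continuous_bounded f (-1) 1) as [N HN]. lra. intros; auto.
assert (N0 : 0 <= N) by (eapply Rle_trans; [apply Cmod_ge_0 | apply (HN 0); lra]).
exists (4 * (M + N)). split. lra. intros t. pose proof (one_plus_sq t).
destruct (Rle_or_lt 1 (Rabs t)) as [L|L].
- eapply Rle_trans. now apply HM.
  assert (T2 : 1 <= t ^ 2). { rewrite <- pow2_abs. simpl. nra. }
  assert (T4 : 0 < t ^ 4). { replace (t ^ 4) with (t ^ 2 * t ^ 2) by ring. nra. }
  apply Rle_trans with (4 * M / (1 + t ^ 2) ^ 2).
  + apply Rle_trans with (4 * M / (4 * t ^ 4)). right; field. intros E; rewrite E in T4; simpl in T4; lra.
    apply Rdiv_le_den. lra. apply pow_lt; auto. replace (4 * t ^ 4) with ((2 * t ^ 2) ^ 2) by ring. apply pow_incr. lra.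
  + apply Rdiv_le_num. now apply pow_lt. lra.
- apply Rabs_def2 in L. eapply Rle_trans. apply HN; lra.
  assert (t ^ 2 <= 1) by nra.
  apply Rle_trans with (4 * N / (1 + t ^ 2) ^ 2).
  + apply Rle_div_l_iff. now apply pow_lt. assert ((1 + t ^ 2) ^ 2 <= 2 ^ 2) by (apply pow_incr; lra). nra.
  + apply Rdiv_le_num. now apply pow_lt. lra.
Qed.

Lemma strip_line u x1 x2 x : strip_ok u x1 x2 -> x1 <= x <= x2 -> decays4 (fun t => u (x, t)).
Proof.
intros [Hd [M [H0 HM]]] Hx. apply (decays4_of_tail _ M); auto.
intros t. apply Ccont_vert, Cd_Ccont. auto.
Qed.

Lemma decays_inv_line u a s : decays4 (fun t => u (a, t)) -> Re s <> a ->
  decays4 (fun t => u (a, t) / ((a, t) - s))%C.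
Proof.
intros H Hs. apply (decays4_mult_bounded _ (fun t => / ((a, t) - s))%C (/ Rabs (a - Re s))); auto.
- intros t. apply (Ccont_vert (fun w => / (w - s))%C). apply Cd_Ccont, Cd_inv_sub.
  intros E. apply Hs. rewrite <- E. reflexivity.
- intros t. assert (L : Rabs (a - Re s) <= Cmod ((a, t) - s)). { apply (re_le_Cmod ((a, t) - s)%C). }
  assert (P : 0 < Rabs (a - Re s)) by (apply Rabs_pos_lt; lra).
  rewrite Cmod_inv. apply Rinv_le_contravar; auto. apply Cmod_gt_0; lra.
Qed.

(** The horizontal sides at height [T] vanish in the limit, being at most [(x2 - x1) * M / T ^ 2].
    Goursat's theorem and Cauchy's formula both pass to strips in this way, with [kappa] equal to 0
    or to 2 pi i u(p). *)
Lemma strip_limit f x1 x2 kappa T0 M : x1 <= x2 ->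
  decays (fun t => f (x1, t)) -> decays (fun t => f (x2, t)) ->
  (forall x t, x1 <= x <= x2 -> T0 <= Rabs t -> Ccont f (x, t) /\ Cmod (f (x, t)) <= M / t ^ 2) ->
  (forall T, T0 <= T -> 0 < T -> rect f x1 x2 (- T) T = kappa) ->
  (Ci * (LInt (fun t => f (x2, t)) - LInt (fun t => f (x1, t))))%C = kappa.
Proof.
intros Hx H1 H2 Hh Hr.
set (L1 := LInt (fun t => f (x1, t))). set (L2 := LInt (fun t => f (x2, t))).
assert (E : (Ci * (L2 - L1) - kappa)%C = 0%C).
{ apply Cmod_eq_0, Rle_antisym; [|apply Cmod_ge_0]. apply le_epsilon. intros e He. rewrite Rplus_0_l.
  destruct (LInt_approx_eps _ (e / 4) H1 ltac:(lra)) as [T1 [_ K1]].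
  destruct (LInt_approx_eps _ (e / 4) H2 ltac:(lra)) as [T2 [_ K2]].
  (* For [T >= 1] the bound [M / T ^ 2] is relaxed to [M / T]; beyond [T3] a horizontal side then
     contributes at most [e / 4]. *)
  set (T3 := 4 * (x2 - x1) * Rabs M / e).
  set (T := Rmax (Rmax T1 T2) (Rmax (Rmax T0 1) T3)).
  assert (T1 <= T /\ T2 <= T /\ T0 <= T /\ 1 <= T /\ T3 <= T) as [B1 [B2 [B3 [B4 B5]]]].
  { unfold T. repeat split.
    eapply Rle_trans; [|apply Rmax_l]. apply Rmax_l. eapply Rle_trans; [|apply Rmax_l]. apply Rmax_r.
    eapply Rle_trans; [|apply Rmax_r]. eapply Rle_trans; [|apply Rmax_l]. apply Rmax_l.
    eapply Rle_trans; [|apply Rmax_r]. eapply Rle_trans; [|apply Rmax_l]. apply Rmax_r.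
    eapply Rle_trans; [|apply Rmax_r]. apply Rmax_r. }
  specialize (K1 T B1). specialize (K2 T B2). rewrite <- (Hr T B3) by lra. unfold rect.
  fold L1 in K1. fold L2 in K2.
  set (I1 := CRInt (fun t => f (x1, t)) (- T) T) in *. set (I2 := CRInt (fun t => f (x2, t)) (- T) T) in *.
  assert (HT2 : (x2 - x1) * (Rabs M / T ^ 2) <= e / 4).
  { apply Rle_trans with ((x2 - x1) * (Rabs M / T)).
    apply Rmult_le_compat_l. lra. apply Rdiv_le_den. apply Rabs_pos. lra. nra.
    replace ((x2 - x1) * (Rabs M / T)) with (T3 * (e / 4) / T) by (unfold T3; field; lra).
    apply Rle_trans with (T * (e / 4) / T). apply Rdiv_le_num; nra. right; field; lra. }
  assert (J : forall t, Rabs t = T -> Cmod (CRInt (fun x => f (x, t)) x1 x2) <= e / 4).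
  { intros t Ht. eapply Rle_trans; [|exact HT2]. apply CRInt_bound; auto.
    - intros x X. rewrite Rmin_left, Rmax_right in X by auto. apply Ccont_horiz. apply Hh; lra.
    - intros x X. eapply Rle_trans. apply Hh; lra. rewrite <- pow2_abs, Ht.
      apply Rdiv_le_num. nra. apply Rle_abs. }
  pose proof (J T ltac:(rewrite Rabs_pos_eq; lra)) as J1.
  pose proof (J (- T) ltac:(rewrite Rabs_Ropp, Rabs_pos_eq; lra)) as J2.
  set (h1 := CRInt (fun x => f (x, - T)) x1 x2) in *. set (h2 := CRInt (fun x => f (x, T)) x1 x2) in *.
  replace (Ci * (L2 - L1) - (h1 + Ci * I2 - h2 - Ci * I1))%C with
   (Ci * (L2 - I2) + - (Ci * (L1 - I1)) + (h2 + - h1))%C by ring.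
  eapply Rle_trans. apply Cmod_triangle. eapply Rle_trans. apply Rplus_le_compat; apply Cmod_triangle.
  rewrite !Cmod_opp, !Cmod_mult, !Cmod_Ci. lra. }
replace (Ci * (L2 - L1))%C with (Ci * (L2 - L1) - kappa + kappa)%C by ring. rewrite E; ring.
Qed.

Lemma Ci_neq_0 : Ci <> 0%C.
Proof. intros E. apply (f_equal snd) in E. simpl in E. lra. Qed.

Lemma t4_le_t2 (M t : R) : 0 <= M -> 1 <= Rabs t -> M / t ^ 4 <= M / t ^ 2.
Proof.
intros H0 Ht. assert (T2 : 1 <= t ^ 2). { rewrite <- pow2_abs. simpl. nra. }
apply Rdiv_le_den; auto. lra. replace (t ^ 4) with (t ^ 2 * t ^ 2) by ring. nra.
Qed.

Lemma strip_shift u x1 x2 : x1 <= x2 -> strip_ok u x1 x2 ->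
  LInt (fun t => u (x1, t)) = LInt (fun t => u (x2, t)).
Proof.
intros Hx H. destruct H as [Hd [M [H0 HM]]] eqn:EH.
assert (E : (Ci * (LInt (fun t => u (x2, t)) - LInt (fun t => u (x1, t))))%C = 0%C).
{ apply (strip_limit u x1 x2 0%C 1 M); auto.
  - apply decays4_decays, (strip_line u x1 x2); auto; lra.
  - apply decays4_decays, (strip_line u x1 x2); auto; lra.
  - intros x t X T. split. now apply Cd_Ccont, Hd. eapply Rle_trans. now apply HM. now apply t4_le_t2.
  - intros T _ HT. apply Goursat; auto. lra. }
destruct (Ceq_dec (LInt (fun t => u (x1, t))) (LInt (fun t => u (x2, t)))) as [|N]; auto.
exfalso. revert E. apply Cmult_neq_0. apply Ci_neq_0. intros E. apply N.
replace (LInt (fun t => u (x2, t))) with ((LInt (fun t => u (x2, t)) - LInt (fun t => u (x1, t))) + LInt (fun t => u (x1, t)))%C by ring.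
rewrite E; ring.
Qed.

Lemma strip_Cauchy u x1 x2 p : x1 < Re p < x2 -> strip_ok u x1 x2 ->
  (LInt (fun t => u (x2, t) / ((x2, t) - p)) - LInt (fun t => u (x1, t) / ((x1, t) - p)))%C = (RtoC (2 * PI) * u p)%C.
Proof.
intros Hx H. destruct H as [Hd [M [H0 HM]]] eqn:EH. destruct p as [a b]. simpl in Hx.
assert (E : (Ci * (LInt (fun t => u (x2, t) / ((x2, t) - (a, b))) - LInt (fun t => u (x1, t) / ((x1, t) - (a, b)))))%C = (RtoC (2 * PI) * Ci * u (a, b))%C).
{ apply (strip_limit (fun w => u w / (w - (a, b)))%C x1 x2 _ (Rabs b + 1) M); auto. lra.
  - apply decays4_decays, decays_inv_line. apply (strip_line u x1 x2); auto; lra. simpl; lra.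
  - apply decays4_decays, decays_inv_line. apply (strip_line u x1 x2); auto; lra. simpl; lra.
  - intros x t X T. pose proof (Rabs_pos b).
    assert (L : 1 <= Cmod ((x, t) - (a, b))).
    { eapply Rle_trans; [|apply Rabs_Im_le_Cmod]. simpl. pose proof (Rabs_triang_inv t b). unfold Rminus in *. lra. }
    assert (N : ((x, t) - (a, b))%C <> 0%C) by (apply Cmod_gt_0; lra).
    split. apply Cd_Ccont, Cd_mult; auto. apply Cd_inv_sub. intros E; apply N; rewrite E; ring.
    rewrite Cmod_div by auto. eapply Rle_trans; [|apply (t4_le_t2 M t); auto; lra].
    eapply Rle_trans; [|apply (HM x t); auto; lra].
    apply Rle_trans with (Cmod (u (x, t)) / 1). apply Rdiv_le_den; auto. apply Cmod_ge_0. lra. right; field.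
  - intros T HT HT0. apply Cauchy_formula; auto. pose proof (Rle_abs b). pose proof (Rle_abs (- b)). rewrite Rabs_Ropp in *. lra. }
match type of E with (Ci * ?d)%C = _ => replace d with (/ Ci * (Ci * d))%C by (field; apply Ci_neq_0) end.
rewrite E. field. apply Ci_neq_0.
Qed.

(** The inverse Mellin integral V_a u of the overview. The i of dw = i dt has been cancelled against
    the one in 1/(2 pi i). *)
Definition inv_mellin (a : R) (u : C -> C) (x : R) : C :=
  (/ RtoC (2 * PI) * LInt (fun t => u (a, t) * Rcpow x (- (a, t))))%C.

(** The Cauchy integral (1/(2 pi i)) times the integral of u(w)/(w - s) dw, upwards along Re w =
    a. *)
Definition cauchy_line (a : R) (u : C -> C) (s : C) : C :=
  (/ RtoC (2 * PI) * LInt (fun t => u (a, t) / ((a, t) - s)))%C.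

Lemma two_pi_neq_0 : RtoC (2 * PI) <> 0%C.
Proof. intros E. apply RtoC_inj in E. pose proof PI_RGT_0. lra. Qed.

Lemma cauchy_line_strip u x1 x2 s : x1 < Re s < x2 -> strip_ok u x1 x2 ->
  (cauchy_line x2 u s - cauchy_line x1 u s)%C = u s.
Proof.
intros Hx H. unfold cauchy_line.
match goal with |- (?a * ?b - ?a * ?c)%C = _ => replace (a * b - a * c)%C with (a * (b - c))%C by ring end.
rewrite (strip_Cauchy u x1 x2 s) by auto. field. apply two_pi_neq_0.
Qed.

Lemma cauchy_line_Cd a u s : decays4 (fun t => u (a, t)) -> Re s <> a -> Cd (cauchy_line a u) s.
Proof.
intros H Hs. apply Cd_mult. apply Cd_const.
set (d := Rabs (a - Re s)). assert (Hd : 0 < d) by (apply Rabs_pos_lt; lra).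
assert (Hn : forall h t, Cmod h < d / 2 -> d / 2 <= Cmod ((a, t) - (s + h))).
{ intros h t Hh. pose proof (re_le_Cmod ((a, t) - (s + h))%C) as L. simpl in L.
  pose proof (re_le_Cmod h) as L2.
  pose proof (Rabs_triang (a + - (Re s + Re h)) (Re h)) as T. replace (a + - (Re s + Re h) + Re h) with (a - Re s) in T by ring.
  fold d in T. unfold Re in *. lra. }
destruct H as [Hc [M [M0 HM]]] eqn:EH.
exists (LInt (fun t => u (a, t) / ((a, t) - s) / ((a, t) - s))%C).
(* The remainder is [h ^ 2 * u / ((w - s) ^ 2 * (w - s - h))], and for [Cmod h < d / 2] the
   distances in the denominator are at least [d], [d] and [d / 2]. *)
apply (LInt_is_Cd (fun s t => u (a, t) / ((a, t) - s))%C _ s (d / 2) (2 * M / (d * d * d))).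
- lra.
- intros h Hh. apply decays4_decays, decays_inv_line; auto. simpl. intros E.
  pose proof (re_le_Cmod h) as L. unfold d in Hh. unfold Re in *. rewrite <- E in Hh.
  replace (fst s + fst h - fst s) with (fst h) in Hh by ring. pose proof (Rabs_pos (fst h)). lra.
- apply decays4_decays.
  apply (decays_inv_line (fun w => u w / (w - s))%C a s); auto. now apply decays_inv_line.
- intros h t Hh.
  pose proof (Hn h t Hh) as N1. pose proof (re_le_Cmod ((a, t) - s)%C) as N2. simpl in N2.
  change (Rabs (a - Re s) <= Cmod ((a, t) - s)) in N2. fold d in N2.
  assert (Z1 : ((a, t) - (s + h))%C <> 0%C) by (apply Cmod_gt_0; lra).
  assert (Z2 : ((a, t) - s)%C <> 0%C) by (apply Cmod_gt_0; lra).
  replace (u (a, t) / ((a, t) - (s + h)) - u (a, t) / ((a, t) - s) - h * (u (a, t) / ((a, t) - s) / ((a, t) - s)))%C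
   with (h * h * (u (a, t) / (((a, t) - s) * ((a, t) - s) * ((a, t) - (s + h)))))%C by (field; auto).
  rewrite !Cmod_mult. rewrite Cmod_div by (repeat apply Cmult_neq_0; auto). rewrite !Cmod_mult.
  apply Rmult_le_compat_l. pose proof (Cmod_ge_0 h); nra.
  pose proof (one_plus_sq t).
  apply Rle_trans with (M / (1 + t ^ 2) / (d * d * (d / 2))).
  + unfold Rdiv at 1. unfold Rdiv at 1. apply Rmult_le_compat. apply Cmod_ge_0.
    left. apply Rinv_0_lt_compat. repeat apply Rmult_lt_0_compat; lra.
    eapply Rle_trans. apply HM. apply Rdiv_le_den; auto. pose proof (pow2_ge_0 t). nra.
    apply Rinv_le_contravar. repeat apply Rmult_lt_0_compat; lra.
    apply Rmult_le_compat; try lra. nra. apply Rmult_le_compat; lra.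
  + right. field. lra.
Qed.

(** * Mellin transforms of vertical line integrals *)

Lemma Cd_exp_kernel v s w : Cd (fun w => Cexp (RtoC v * (s - w)))%C w.
Proof. apply Cd_Cexp, Cd_mult. apply Cd_const. apply Cd_minus. apply Cd_const. apply Cd_id. Qed.

Lemma Cmod_exp_kernel (v a t : R) s : Cmod (Cexp (RtoC v * (s - (a, t)))) = exp (v * (Re s - a)).
Proof. rewrite Cmod_Cexp. f_equal. simpl. unfold Re. ring. Qed.

Lemma line_quadratic (a : R) (s : C) : exists K, 0 <= K /\
  forall t, Cmod (s - (a, t)) * Cmod (s - (a, t)) <= K * (1 + t ^ 2).
Proof.
exists ((Re s - a) ^ 2 + 2 * Im s ^ 2 + 2). split.
pose proof (pow2_ge_0 (Re s - a)). pose proof (pow2_ge_0 (Im s)). lra.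
intros t. pose proof (Cmod2_alt (s - (a, t))%C) as E. simpl in E. unfold Re, Im in *.
replace (Cmod (s - (a, t)) * Cmod (s - (a, t))) with ((fst s - a) ^ 2 + (snd s - t) ^ 2) by (rewrite Rmult_1_r in E; rewrite E; ring).
pose proof (pow2_ge_0 (snd s + t)). pose proof (pow2_ge_0 (fst s - a)). pose proof (pow2_ge_0 (snd s)).
pose proof (pow2_ge_0 t). nra.
Qed.

Lemma decays_exp_kernel (f : R -> C) (a v : R) s : decays4 f ->
  decays4 (fun t => f t * Cexp (RtoC v * (s - (a, t))))%C.
Proof.
intros H. apply (decays4_mult_bounded f _ (exp (v * (Re s - a)))); auto.
- intros t. apply (Ccont_vert (fun w => Cexp (RtoC v * (s - w)))%C). apply Cd_Ccont, Cd_exp_kernel.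
- intros t. rewrite Cmod_exp_kernel. lra.
Qed.

Lemma decays_exp_kernel_deriv (f : R -> C) (a v : R) s : decays4 f ->
  decays (fun t => f t * ((s - (a, t)) * Cexp (RtoC v * (s - (a, t)))))%C.
Proof.
intros H. destruct (line_quadratic a s) as [K [K0 HK]].
apply (decays4_mult_quadratic f _ ((K + 1) * exp (v * (Re s - a)))); auto.
- intros t. apply (Ccont_vert (fun w => (s - w) * Cexp (RtoC v * (s - w)))%C).
  apply Cd_Ccont, Cd_mult. apply Cd_minus. apply Cd_const. apply Cd_id. apply Cd_exp_kernel.
- intros t. rewrite Cmod_mult, Cmod_exp_kernel. specialize (HK t). pose proof (exp_pos (v * (Re s - a))).
  pose proof (Cmod_ge_0 (s - (a, t))). pose proof (pow2_ge_0 t).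
  replace ((K + 1) * exp (v * (Re s - a)) * (1 + t ^ 2)) with ((K + 1) * (1 + t ^ 2) * exp (v * (Re s - a))) by ring.
  apply Rmult_le_compat_r. lra. nra.
Qed.

(** Here [v] stands for [ln x]. [Cexp_remainder2] produces the square of [Cmod (s - w)], of
    quadratic growth along the line, and [decays4] pays for it. *)
Lemma LInt_exp_derive (f : R -> C) (a v : R) s : decays4 f ->
  is_derive (K := R_AbsRing) (V := C_R_NormedModule)
   (fun v : R => LInt (fun t => f t * Cexp (RtoC v * (s - (a, t))))%C) v
   (LInt (fun t => f t * ((s - (a, t)) * Cexp (RtoC v * (s - (a, t)))))%C).
Proof.
intros H. apply is_derive_eps_C. intros eps He.
destruct (line_quadratic a s) as [K [K0 HK]].
destruct H as [Hc [M [M0 HM]]] eqn:EH.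
set (N := M * K * exp (v * (Re s - a)) * exp (Rabs (Re s - a))).
assert (N0 : 0 <= N). { unfold N. pose proof (exp_pos (v * (Re s - a))). pose proof (exp_pos (Rabs (Re s - a))).
  apply Rmult_le_pos; [|lra]. apply Rmult_le_pos; [|lra]. nra. }
pose proof PI_RGT_0.
exists (Rmin 1 (eps / (PI * (N + 1)))). split. { apply Rmin_pos. lra. apply Rdiv_lt_0_compat; auto. nra. }
intros h Hh. apply Rmin_Rgt in Hh. destruct Hh as [H1 H2].
pose proof (decays4_decays _ (decays_exp_kernel f a (v + h) s H)) as D1.
pose proof (decays4_decays _ (decays_exp_kernel f a v s H)) as D2.
pose proof (decays_exp_kernel_deriv f a v s H) as D3.
rewrite <- (LInt_Cmult _ (RtoC h) D3), <- (LInt_minus _ _ D1 D2),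
 <- (LInt_minus _ _ (decays_minus _ _ D1 D2) (decays_Cmult _ (RtoC h) D3)).
eapply Rle_trans. apply (LInt_bound (Rabs h * Rabs h * N)). split.
- intros t. apply continuous_Cminus. apply continuous_Cminus.
  apply (decays_exp_kernel f a (v + h) s H). apply (decays_exp_kernel f a v s H).
  destruct (decays_Cmult _ (RtoC h) (decays_exp_kernel_deriv f a v s H)) as [? [D _]]. apply D.
- intros t. set (z := (s - (a, t))%C).
  replace (f t * Cexp (RtoC (v + h) * z) - f t * Cexp (RtoC v * z) - RtoC h * (f t * (z * Cexp (RtoC v * z))))%C
   with (f t * (Cexp (RtoC v * z) * (Cexp (RtoC h * z) - 1 - RtoC h * z)))%C.
  2:{ rewrite RtoC_plus. replace ((v + h) * z)%C with (RtoC v * z + RtoC h * z)%C by ring. rewrite Cexp_plus. ring. }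
  rewrite !Cmod_mult. unfold z at 1. rewrite Cmod_exp_kernel.
  pose proof (one_plus_sq t) as P. pose proof (exp_pos (v * (Re s - a))) as P1.
  assert (B : Cmod (Cexp (RtoC h * z) - 1 - RtoC h * z) <= Rabs h * Rabs h * (K * (1 + t ^ 2)) * exp (Rabs (Re s - a))).
  { eapply Rle_trans. apply Cexp_remainder2. rewrite Cmod_mult, Cmod_R.
    apply Rmult_le_compat. pose proof (Rabs_pos h); pose proof (Cmod_ge_0 z); nra. left; apply exp_pos.
    replace (Rabs h * Cmod z * (Rabs h * Cmod z)) with (Rabs h * Rabs h * (Cmod z * Cmod z)) by ring.
    apply Rmult_le_compat_l. pose proof (Rabs_pos h); nra. apply HK.
    apply exp_le. replace (Re (RtoC h * z)) with (h * (Re s - a)) by (unfold z; simpl; unfold Re; ring).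
    rewrite Rabs_mult. pose proof (Rabs_pos (Re s - a)). nra. }
  apply Rle_trans with (M / (1 + t ^ 2) ^ 2 * (exp (v * (Re s - a)) * (Rabs h * Rabs h * (K * (1 + t ^ 2)) * exp (Rabs (Re s - a))))).
  apply Rmult_le_compat; auto. apply Cmod_ge_0. apply Rmult_le_pos. lra. apply Cmod_ge_0.
  apply Rmult_le_compat_l; lra. unfold N. right. field. lra.
- replace (PI * (Rabs h * Rabs h * N)) with (PI * N * Rabs h * Rabs h) by ring.
  apply Rmult_le_compat_r. apply Rabs_pos.
  apply Rle_trans with (PI * (N + 1) * (eps / (PI * (N + 1)))). 2: right; field; nra.
  pose proof (Rabs_pos h). apply Rmult_le_compat; try nra.
Qed.

(** A primitive in [x] of [inv_mellin a u x * x^(s-1)], found by integrating x^(s-w-1) inside the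
    line integral. Differentiating it under the integral sign replaces an exchange of two
    integrations. *)
Definition mellin_primitive (a : R) (u : C -> C) (s : C) (x : R) : C :=
  (/ RtoC (2 * PI) * LInt (fun t => u (a, t) / (s - (a, t)) * Cexp (RtoC (ln x) * (s - (a, t)))))%C.

Lemma decays_inv_line' u a s : decays4 (fun t => u (a, t)) -> Re s <> a ->
  decays4 (fun t => u (a, t) / (s - (a, t)))%C.
Proof.
intros H Hs. apply (decays4_ext (fun t => u (a, t) / ((a, t) - s) * (- 1))%C).
- intros t. field. assert (N : ((a, t) - s)%C <> 0%C).
  { intros E. apply Hs. apply (f_equal fst) in E. simpl in E. unfold Re. lra. }
  split; auto. intros E. apply N. replace ((a, t) - s)%C with (- (s - (a, t)))%C by ring. rewrite E; ring.
- apply (decays4_mult_bounded _ _ 1). now apply decays_inv_line. intros; apply continuous_Cconst.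
  intros _. rewrite Cmod_R, Rabs_left by lra. lra.
Qed.

Lemma line_neq (a t : R) s : Re s <> a -> (s - (a, t))%C <> 0%C.
Proof. intros Hs E. apply Hs. apply (f_equal fst) in E. simpl in E. unfold Re. lra. Qed.

Lemma mellin_primitive_derive a u s x : decays4 (fun t => u (a, t)) -> Re s <> a -> 0 < x ->
  is_derive (K := R_AbsRing) (V := C_R_NormedModule) (mellin_primitive a u s) x
   (inv_mellin a u x * Rcpow x (s - 1))%C.
Proof.
intros H Hs Hx.
pose proof (LInt_exp_derive _ a (ln x) s (decays_inv_line' u a s H Hs)) as D.
apply (is_derive_comp (K := R_AbsRing) (V := C_R_NormedModule) _ ln x _ (/ x)) in D.
2:{ auto_derive; auto. field; lra. }
assert (E : forall z : C, scal (K := R_AbsRing) (V := C_R_NormedModule) (/ x) z = (RtoC (/ x) * z)%C).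
{ intros z. apply injective_projections; simpl; unfold scal; simpl; unfold mult; simpl; ring. }
rewrite E in D. clear E.
apply (is_derive_Cmult_const _ _ (/ RtoC (2 * PI))%C) in D.
match type of D with is_derive _ _ ?m => replace (inv_mellin a u x * Rcpow x (s - 1))%C with m end.
exact D.
unfold inv_mellin.
rewrite <- Cmult_assoc. f_equal.
rewrite (Cmult_comm (LInt _)), <- !LInt_Cmult.
- apply LInt_ext. intros t.
  replace (Cexp (RtoC (ln x) * (s - (a, t)))) with (Rcpow x (- (a, t)) * Rcpow x (s - 1) * RtoC x)%C.
  2:{ replace (RtoC x) with (Rcpow x 1). rewrite <- !Rcpow_plus. unfold Rcpow. f_equal. ring.
      change (RtoC 1) with (RtoC 1%R). rewrite Rcpow_real. f_equal. now apply Rpower_1. }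
  rewrite RtoC_inv by lra. field. split. apply (line_neq a t s Hs). intros E. apply RtoC_inj in E. lra.
- apply decays4_decays. apply (decays4_ext (fun t => u (a, t) * Cexp (RtoC (ln x) * (0 - (a, t))))%C).
  intros t. unfold Rcpow. do 2 f_equal. ring. now apply (decays_exp_kernel (fun t => u (a, t))).
- apply decays_exp_kernel_deriv. now apply decays_inv_line'.
Qed.

Lemma inv_mellin_continuous a u x : decays4 (fun t => u (a, t)) -> 0 < x ->
  continuous (U := C_UniformSpace) (inv_mellin a u) x.
Proof.
intros H Hx. unfold inv_mellin. apply continuous_Cmult_const.
pose proof (LInt_exp_derive _ a (ln x) 0%C H) as D.
apply (is_derive_comp (K := R_AbsRing) (V := C_R_NormedModule) _ ln x _ (/ x)) in D.
2:{ auto_derive; auto. field; lra. }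
apply continuous_of_derive in D. revert D. apply continuous_ext.
intros y. apply LInt_ext. intros t. unfold Rcpow. do 2 f_equal. ring.
Qed.

Lemma Rcpow_continuous z x : 0 < x -> continuous (U := C_UniformSpace) (fun x => Rcpow x z) x.
Proof.
intros Hx. unfold Rcpow.
pose proof (is_derive_Cexp_line z (ln x)) as D.
apply (is_derive_comp (K := R_AbsRing) (V := C_R_NormedModule) _ ln x _ (/ x)) in D.
2:{ auto_derive; auto. field; lra. }
apply continuous_of_derive in D. revert D. apply continuous_ext.
intros y. f_equal. ring.
Qed.

Lemma mellin_finite a u s p q : decays4 (fun t => u (a, t)) -> Re s <> a -> 0 < p -> 0 < q ->
  is_RInt (V := C_R_NormedModule) (fun x => inv_mellin a u x * Rcpow x (s - 1))%C p q
   (mellin_primitive a u s q - mellin_primitive a u s p)%C.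
Proof.
intros H Hs Hp Hq.
assert (Hpos : forall x, Rmin p q <= x <= Rmax p q -> 0 < x).
{ intros x [X _]. eapply Rlt_le_trans; [|exact X]. now apply Rmin_pos. }
apply (is_RInt_derive (V := C_R_CompleteNormedModule)).
- intros x X. apply mellin_primitive_derive; auto.
- intros x X. apply continuous_Cmult. apply inv_mellin_continuous; auto. apply Rcpow_continuous; auto.
Qed.

Lemma is_RInt_gen_at_right_0 (g F : R -> C) (l : C) :
  (forall p q, 0 < p -> 0 < q -> is_RInt (V := C_R_NormedModule) g p q (F q - F p)%C) ->
  (forall eps, 0 < eps -> exists d, 0 < d /\ forall x, 0 < x < d -> Cmod (F x - l) < eps) ->
  is_RInt_gen (V := C_R_NormedModule) g (at_right 0) (at_point 1) (F 1 - l)%C.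
Proof.
intros H Hl. apply is_RInt_gen_eps; try typeclasses eauto. intros eps He.
destruct (Hl eps He) as [d [Hd Hx]].
apply Filter_prod with (fun x => 0 < x < d) (fun x => x = 1).
- exists (mkposreal d Hd). intros y Hy Hy0. split; auto.
  change (Rabs (y - 0) < d) in Hy. rewrite Rminus_0_r in Hy. apply Rabs_def2 in Hy. lra.
- reflexivity.
- intros x y X ->. simpl. exists (F 1 - F x)%C. split. apply H; lra.
  replace (F 1 - F x - (F 1 - l))%C with (- (F x - l))%C by ring. rewrite Cmod_opp. auto.
Qed.

Lemma is_RInt_gen_at_infty (g F : R -> C) (l : C) :
  (forall p q, 0 < p -> 0 < q -> is_RInt (V := C_R_NormedModule) g p q (F q - F p)%C) ->
  (forall eps, 0 < eps -> exists m, forall x, m < x -> Cmod (F x - l) < eps) ->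
  is_RInt_gen (V := C_R_NormedModule) g (at_point 1) (Rbar_locally p_infty) (l - F 1)%C.
Proof.
intros H Hl. apply is_RInt_gen_eps; try typeclasses eauto. intros eps He.
destruct (Hl eps He) as [m Hx].
apply Filter_prod with (fun x => x = 1) (fun x => Rmax 0 m < x).
- reflexivity.
- exists (Rmax 0 m). auto.
- intros x y -> Y. simpl. pose proof (Rmax_l 0 m). pose proof (Rmax_r 0 m). exists (F y - F 1)%C. split. apply H; lra.
  replace (F y - F 1 - (l - F 1))%C with (F y - l)%C by ring. apply Hx; lra.
Qed.

Lemma Rpower_small_0 (b K eps : R) : 0 < b -> 0 <= K -> 0 < eps ->
  exists d, 0 < d /\ forall x, 0 < x < d -> K * Rpower x b < eps.
Proof.
intros Hb HK He. exists (Rpower (eps / (K + 1)) (/ b)). split. apply exp_pos.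
intros x [X1 X2].
assert (P : 0 < eps / (K + 1)) by (apply Rdiv_lt_0_compat; lra).
assert (Rpower x b < eps / (K + 1)).
{ replace (eps / (K + 1)) with (Rpower (Rpower (eps / (K + 1)) (/ b)) b).
  apply Rlt_Rpower_l; auto. rewrite Rpower_mult, Rinv_l, Rpower_1; lra. }
pose proof (exp_pos (b * ln x)). fold (Rpower x b) in H0.
apply Rlt_le_trans with ((K + 1) * (eps / (K + 1))). 2: right; field; lra. nra.
Qed.

Lemma Rpower_small_infty (b K eps : R) : b < 0 -> 0 <= K -> 0 < eps ->
  exists m, forall x, m < x -> K * Rpower x b < eps.
Proof.
intros Hb HK He. destruct (Rpower_small_0 (- b) K eps) as [d [Hd H]]; auto. lra.
exists (/ d). intros x Hx. assert (0 < / d) by now apply Rinv_0_lt_compat.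
replace (Rpower x b) with (Rpower (/ x) (- b)).
apply H. split. apply Rinv_0_lt_compat; lra. rewrite <- (Rinv_inv d). apply Rinv_lt_contravar; auto. nra.
unfold Rpower. rewrite ln_Rinv by lra. f_equal. ring.
Qed.

Lemma mellin_primitive_bound a u s : decays4 (fun t => u (a, t)) -> Re s <> a ->
  exists K, 0 <= K /\ forall x, 0 < x -> Cmod (mellin_primitive a u s x) <= K * Rpower x (Re s - a).
Proof.
intros H Hs. destruct (decays4_decays _ (decays_inv_line' u a s H Hs)) as [M [HC HM]].
pose proof (decays_by_nonneg M _ (conj HC HM)) as M0. pose proof PI_RGT_0.
exists (Cmod (/ RtoC (2 * PI)) * (PI * M)). split. apply Rmult_le_pos. apply Cmod_ge_0. nra.
intros x Hx. unfold mellin_primitive. rewrite Cmod_mult, Rmult_assoc. apply Rmult_le_compat_l. apply Cmod_ge_0.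
rewrite Rmult_assoc. apply LInt_bound. split.
- apply decays_exp_kernel. now apply decays_inv_line'.
- intros t. rewrite Cmod_mult, Cmod_exp_kernel. unfold Rpower. rewrite (Rmult_comm (Re s - a)).
  replace (M * exp (ln x * (Re s - a)) / (1 + t ^ 2)) with (M / (1 + t ^ 2) * exp (ln x * (Re s - a))).
  apply Rmult_le_compat_r. left; apply exp_pos. apply HM. field. pose proof (one_plus_sq t); lra.
Qed.

Lemma mellin_primitive_1 a u s : decays4 (fun t => u (a, t)) -> Re s <> a ->
  mellin_primitive a u s 1 = (- cauchy_line a u s)%C.
Proof.
intros H Hs. unfold mellin_primitive, cauchy_line.
replace (- (/ RtoC (2 * PI) * LInt (fun t => u (a, t) / ((a, t) - s))))%C with
 (/ RtoC (2 * PI) * ((- 1) * LInt (fun t => u (a, t) / ((a, t) - s))))%C by ring.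
f_equal. rewrite <- LInt_Cmult by now apply decays4_decays, decays_inv_line.
apply LInt_ext. intros t. rewrite ln_1. replace (0 * (s - (a, t)))%C with (RtoC 0) by ring. rewrite Cexp_0.
pose proof (line_neq a t s Hs). field. split; auto.
intros E. apply H0. replace (s - (a, t))%C with (- ((a, t) - s))%C by ring. rewrite E; ring.
Qed.

(** The primitive is O(x^(Re s - a)) and so vanishes at infinity; what is left is minus its value at
    1, a Cauchy integral by [mellin_primitive_1]. For [a < Re s] the same happens at 0, with the
    opposite sign. *)
Lemma mellin_infty a u s : decays4 (fun t => u (a, t)) -> Re s < a ->
  is_RInt_gen (V := C_R_NormedModule) (fun x => inv_mellin a u x * Rcpow x (s - 1))%C
   (at_point 1) (Rbar_locally p_infty) (cauchy_line a u s).
Proof.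
intros H Hs. assert (Hs' : Re s <> a) by lra.
replace (cauchy_line a u s) with (0 - mellin_primitive a u s 1)%C by (rewrite mellin_primitive_1 by auto; ring).
apply is_RInt_gen_at_infty.
- intros p q Hp Hq. now apply mellin_finite.
- intros eps He. destruct (mellin_primitive_bound a u s H Hs') as [K [K0 HK]].
  destruct (Rpower_small_infty (Re s - a) K eps) as [m Hm]; auto. lra.
  exists (Rmax 0 m). intros x Hx. pose proof (Rmax_l 0 m). pose proof (Rmax_r 0 m).
  replace (mellin_primitive a u s x - 0)%C with (mellin_primitive a u s x) by ring.
  eapply Rle_lt_trans. apply HK. lra. apply Hm. lra.
Qed.

Lemma mellin_zero a u s : decays4 (fun t => u (a, t)) -> a < Re s ->
  is_RInt_gen (V := C_R_NormedModule) (fun x => inv_mellin a u x * Rcpow x (s - 1))%C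
   (at_right 0) (at_point 1) (- cauchy_line a u s)%C.
Proof.
intros H Hs. assert (Hs' : Re s <> a) by lra.
replace (- cauchy_line a u s)%C with (mellin_primitive a u s 1 - 0)%C by (rewrite mellin_primitive_1 by auto; ring).
apply is_RInt_gen_at_right_0.
- intros p q Hp Hq. now apply mellin_finite.
- intros eps He. destruct (mellin_primitive_bound a u s H Hs') as [K [K0 HK]].
  destruct (Rpower_small_0 (Re s - a) K eps) as [d [Hd Hm]]; auto. lra.
  exists d. split; auto. intros x Hx.
  replace (mellin_primitive a u s x - 0)%C with (mellin_primitive a u s x) by ring.
  eapply Rle_lt_trans. apply HK. lra. auto.
Qed.

Lemma strip_ok_mult u v x1 x2 K : strip_ok u x1 x2 ->
  (forall x t, x1 <= x <= x2 -> Cd v (x, t)) ->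
  (forall x t, x1 <= x <= x2 -> 1 <= Rabs t -> Cmod (v (x, t)) <= K) ->
  strip_ok (fun w => u w * v w)%C x1 x2.
Proof.
intros [Hd [M [M0 HM]]] Hv HK. split.
- intros x t X. apply Cd_mult; auto.
- exists (M * Rabs K). split. apply Rmult_le_pos; auto. apply Rabs_pos.
  intros x t X T. rewrite Cmod_mult. unfold Rdiv. rewrite Rmult_assoc, (Rmult_comm (Rabs K)), <- Rmult_assoc.
  apply Rmult_le_compat; try apply Cmod_ge_0. now apply HM.
  eapply Rle_trans. now apply HK. apply Rle_abs.
Qed.

Lemma strip_ok_ext u v x1 x2 : (forall w, u w = v w) -> strip_ok u x1 x2 -> strip_ok v x1 x2.
Proof. intros E H. replace v with u; auto. now apply functional_extensionality. Qed.

Lemma Rpower_between x y1 y y2 : y1 <= y <= y2 -> Rpower x y <= Rpower x y1 + Rpower x y2.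
Proof.
intros Hy. unfold Rpower. pose proof (exp_pos (y1 * ln x)). pose proof (exp_pos (y2 * ln x)).
destruct (Rle_or_lt 0 (ln x)) as [L|L].
- apply Rle_trans with (exp (y2 * ln x)). apply exp_le. nra. lra.
- apply Rle_trans with (exp (y1 * ln x)). apply exp_le. nra. lra.
Qed.

Lemma Cd_Rcpow_opp x w : Cd (fun w => Rcpow x (- w)) w.
Proof. apply Cd_Rcpow, Cd_opp, Cd_id. Qed.

Lemma strip_ok_Rcpow u x1 x2 x : strip_ok u x1 x2 -> strip_ok (fun w => u w * Rcpow x (- w))%C x1 x2.
Proof.
intros H. apply (strip_ok_mult u (fun w => Rcpow x (- w)) x1 x2 (Rpower x (- x2) + Rpower x (- x1))); auto.
intros; apply Cd_Rcpow_opp.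
intros y t Y _. rewrite Cmod_Rcpow. apply Rpower_between. simpl; lra.
Qed.

Lemma inv_mellin_shift u x1 x2 x : x1 <= x2 -> strip_ok u x1 x2 ->
  inv_mellin x1 u x = inv_mellin x2 u x.
Proof.
intros Hx H. unfold inv_mellin. f_equal.
apply (strip_shift (fun w => u w * Rcpow x (- w))%C); auto. now apply strip_ok_Rcpow.
Qed.

(** [v] is the continuation of [(w - p) * u] over the pole. The relation to [u] is asked on the two
    lines only, because the value of [u] at [p] is meaningless. *)
Lemma inv_mellin_residue u v p x1 x2 x : x1 < Re p < x2 -> strip_ok v x1 x2 ->
  (forall w, Re w = x1 \/ Re w = x2 -> u w = (v w / (w - p))%C) ->
  inv_mellin x2 u x = (inv_mellin x1 u x + v p * Rcpow x (- p))%C.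
Proof.
intros Hp H Hu. unfold inv_mellin.
pose proof (strip_Cauchy (fun w => v w * Rcpow x (- w))%C x1 x2 p Hp (strip_ok_Rcpow v x1 x2 x H)) as E. cbv beta in E.
rewrite (LInt_ext (fun t => v (x2, t) * Rcpow x (- (x2, t)) / ((x2, t) - p))%C (fun t => u (x2, t) * Rcpow x (- (x2, t)))%C) in E.
2:{ intros t. rewrite Hu by (simpl; auto). unfold Cdiv. ring. }
rewrite (LInt_ext (fun t => v (x1, t) * Rcpow x (- (x1, t)) / ((x1, t) - p))%C (fun t => u (x1, t) * Rcpow x (- (x1, t)))%C) in E.
2:{ intros t. rewrite Hu by (simpl; auto). unfold Cdiv. ring. }
replace (v p * Rcpow x (- p))%C with (/ RtoC (2 * PI) * (RtoC (2 * PI) * (v p * Rcpow x (- p))))%C by (field; apply two_pi_neq_0).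
rewrite <- E. ring.
Qed.

Lemma vertical_integral_LInt a f : decays (fun t => f (a, t)) ->
  vertical_integral a f = (/ RtoC (2 * PI) * LInt (fun t => f (a, t)))%C.
Proof.
intros H. unfold vertical_integral. fold (LInt (fun t => f (a, t) * Ci)%C).
rewrite (LInt_ext _ (fun t => Ci * f (a, t))%C) by (intros; ring). rewrite LInt_Cmult by auto.
rewrite RtoC_mult. field. pose proof two_pi_neq_0 as P. rewrite RtoC_mult in P.
repeat split; try apply Ci_neq_0; intros E; apply P; rewrite E; ring.
Qed.

(** * Mellin transforms of polynomials over (0,1) and (1,oo) *)

Lemma power_primitive s (k : nat) p q : (s + RtoC (INR k))%C <> 0%C -> 0 < p -> 0 < q ->
  is_RInt (V := C_R_NormedModule) (fun x => RtoC (x ^ k) * Rcpow x (s - 1))%C p q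
   (Rcpow q (s + RtoC (INR k)) / (s + RtoC (INR k)) - Rcpow p (s + RtoC (INR k)) / (s + RtoC (INR k)))%C.
Proof.
intros Hs Hp Hq. set (z := (s + RtoC (INR k))%C) in *.
assert (Hpos : forall x, Rmin p q <= x <= Rmax p q -> 0 < x).
{ intros x [X _]. eapply Rlt_le_trans; [|exact X]. now apply Rmin_pos. }
assert (E : forall x, 0 < x -> (/ z * (RtoC (/ x) * (z * Cexp (RtoC (ln x) * z))))%C = (RtoC (x ^ k) * Rcpow x (s - 1))%C).
{ intros x X. rewrite <- Rpower_pow, <- Rcpow_real by auto.
  replace (Cexp (RtoC (ln x) * z)) with (Rcpow x (RtoC (INR k)) * Rcpow x (s - 1) * RtoC x)%C.
  rewrite RtoC_inv by lra. field. split; auto. intros E. apply RtoC_inj in E. lra.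
  replace (RtoC x) with (Rcpow x 1). rewrite <- !Rcpow_plus. unfold Rcpow, z. f_equal. ring.
  change (RtoC 1) with (RtoC 1%R). rewrite Rcpow_real. f_equal. now apply Rpower_1. }
apply (is_RInt_ext (V := C_R_NormedModule) (fun x => / z * (RtoC (/ x) * (z * Cexp (RtoC (ln x) * z))))%C).
{ intros x X. apply E. apply Hpos; lra. }
replace (Rcpow q z / z - Rcpow p z / z)%C with (/ z * Cexp (RtoC (ln q) * z) - / z * Cexp (RtoC (ln p) * z))%C.
2:{ unfold Rcpow, Cdiv. rewrite !(Cmult_comm z). ring. }
apply (is_RInt_derive (V := C_R_CompleteNormedModule) (fun x => / z * Cexp (RtoC (ln x) * z))%C).
- intros x X. apply is_derive_Cmult_const. specialize (Hpos x X).
  pose proof (is_derive_Cexp_line z (ln x)) as D.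
  apply (is_derive_comp (K := R_AbsRing) (V := C_R_NormedModule) _ ln x _ (/ x)) in D.
  2:{ auto_derive; auto. field; lra. }
  replace (RtoC (/ x) * (z * Cexp (RtoC (ln x) * z)))%C with (scal (K := R_AbsRing) (V := C_R_NormedModule) (/ x) (z * Cexp (RtoC (ln x) * z))%C). exact D.
  apply injective_projections; simpl; unfold scal; simpl; unfold mult; simpl; ring.
- intros x X. specialize (Hpos x X).
  apply (continuous_ext_loc (T := R_UniformSpace) (U := C_UniformSpace) _ (fun x => RtoC (x ^ k) * Rcpow x (s - 1))%C).
  { exists (mkposreal x Hpos). intros y Hy. symmetry. apply E. change (Rabs (y - x) < x) in Hy. apply Rabs_def2 in Hy. lra. }
  apply continuous_Cmult. 2: now apply Rcpow_continuous.
  apply continuous_C_pair. apply (ex_derive_continuous (K := R_AbsRing) (V := R_NormedModule)). auto_derive; auto.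
  apply continuous_const.
Qed.

Lemma power_bound s (k : nat) x : Cmod (Rcpow x (s + RtoC (INR k)) / (s + RtoC (INR k)) - 0) =
  Cmod (/ (s + RtoC (INR k))) * Rpower x (Re s + INR k).
Proof.
replace (Rcpow x (s + RtoC (INR k)) / (s + RtoC (INR k)) - 0)%C with (/ (s + RtoC (INR k)) * Rcpow x (s + RtoC (INR k)))%C by (unfold Cdiv; ring).
now rewrite Cmod_mult, Cmod_Rcpow.
Qed.

Lemma line_neq_nat s (k : nat) : Re s <> - INR k -> (s + RtoC (INR k))%C <> 0%C.
Proof. intros H E. apply H. apply (f_equal fst) in E. simpl in E. unfold Re. lra. Qed.

Lemma mellin_power_zero s (k : nat) : - INR k < Re s ->
  is_RInt_gen (V := C_R_NormedModule) (fun x => RtoC (x ^ k) * Rcpow x (s - 1))%C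
   (at_right 0) (at_point 1) (/ (s + RtoC (INR k)))%C.
Proof.
intros H. assert (N : (s + RtoC (INR k))%C <> 0%C) by (apply line_neq_nat; lra).
set (F := fun x => (Rcpow x (s + RtoC (INR k)) / (s + RtoC (INR k)))%C).
replace (/ (s + RtoC (INR k)))%C with (F 1 - 0)%C.
2:{ unfold F, Rcpow. rewrite ln_1. replace ((s + RtoC (INR k)) * 0)%C with (RtoC 0) by ring. rewrite Cexp_0. field; auto. }
apply is_RInt_gen_at_right_0. intros p q Hp Hq. now apply power_primitive.
intros eps He.
destruct (Rpower_small_0 (Re s + INR k) (Cmod (/ (s + RtoC (INR k)))) eps) as [d [Hd Hx]]; auto. lra. apply Cmod_ge_0.
exists d. split; auto. intros x X. unfold F. rewrite power_bound. auto.
Qed.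

(** Minus this integral is the same rational function as in [mellin_power_zero]: a monomial behaves
    like a residual function, so the polynomial part does not disturb the continuation. *)
Lemma mellin_power_infty s (k : nat) : Re s < - INR k ->
  is_RInt_gen (V := C_R_NormedModule) (fun x => RtoC (x ^ k) * Rcpow x (s - 1))%C
   (at_point 1) (Rbar_locally p_infty) (- / (s + RtoC (INR k)))%C.
Proof.
intros H. assert (N : (s + RtoC (INR k))%C <> 0%C) by (apply line_neq_nat; lra).
set (F := fun x => (Rcpow x (s + RtoC (INR k)) / (s + RtoC (INR k)))%C).
replace (- / (s + RtoC (INR k)))%C with (0 - F 1)%C.
2:{ unfold F, Rcpow. rewrite ln_1. replace ((s + RtoC (INR k)) * 0)%C with (RtoC 0) by ring. rewrite Cexp_0. field; auto. }
apply is_RInt_gen_at_infty. intros p q Hp Hq. now apply power_primitive.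
intros eps He.
destruct (Rpower_small_infty (Re s + INR k) (Cmod (/ (s + RtoC (INR k)))) eps) as [d Hx]; auto. lra. apply Cmod_ge_0.
exists d. intros x X. unfold F. rewrite power_bound. auto.
Qed.

Lemma is_RInt_gen_Cmult f c Fa Fb (FFa : Filter Fa) (FFb : Filter Fb) l :
  is_RInt_gen (V := C_R_NormedModule) f Fa Fb l ->
  is_RInt_gen (V := C_R_NormedModule) (fun x => c * f x)%C Fa Fb (c * l)%C.
Proof.
intros H. apply is_RInt_gen_eps; auto. intros eps He. pose proof (Cmod_ge_0 c).
assert (He' : 0 < eps / (Cmod c + 1)) by (apply Rdiv_lt_0_compat; lra).
pose proof (is_RInt_gen_eps_inv f Fa Fb FFa FFb l H _ He') as G.
revert G. apply filter_imp. intros ab [z [Z1 Z2]]. exists (c * z)%C. split. now apply is_RInt_Cmult.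
replace (c * z - c * l)%C with (c * (z - l))%C by ring. rewrite Cmod_mult.
apply Rle_lt_trans with ((Cmod c + 1) * Cmod (z - l)). pose proof (Cmod_ge_0 (z - l)). nra.
apply Rlt_le_trans with ((Cmod c + 1) * (eps / (Cmod c + 1))). apply Rmult_lt_compat_l; lra. right; field; lra.
Qed.

Fixpoint csum (f : nat -> C) (n : nat) : C :=
  match n with O => 0%C | S m => (csum f m + f m)%C end.

Lemma csum_ext f g n : (forall k, (k < n)%nat -> f k = g k) -> csum f n = csum g n.
Proof. induction n as [|n IH]; intros H; simpl; auto. rewrite IH, H; auto. Qed.

Lemma mellin_csum_zero (c : nat -> C) N s : 0 < Re s ->
  is_RInt_gen (V := C_R_NormedModule) (fun x => csum (fun k => c k * RtoC (x ^ k))%C N * Rcpow x (s - 1))%C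
   (at_right 0) (at_point 1) (csum (fun k => c k / (s + RtoC (INR k)))%C N).
Proof.
intros Hs. induction N as [|N IH]; simpl csum.
(* The empty sum is read as 0 times the monomial of degree 0, whose integral is already known. *)
- replace (fun x => 0 * Rcpow x (s - 1))%C with (fun x => 0 * (RtoC (x ^ 0) * Rcpow x (s - 1)))%C
   by (apply functional_extensionality; intros; ring).
  pose proof (mellin_power_zero s 0 ltac:(simpl; lra)) as Z.
  apply (is_RInt_gen_Cmult _ 0%C) in Z; try typeclasses eauto. now rewrite Cmult_0_l in Z.
- replace (fun x => (csum (fun k => c k * RtoC (x ^ k)) N + c N * RtoC (x ^ N)) * Rcpow x (s - 1))%C with
   (fun x => plus (csum (fun k => c k * RtoC (x ^ k)) N * Rcpow x (s - 1))%C (c N * (RtoC (x ^ N) * Rcpow x (s - 1))))%C.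
  2:{ apply functional_extensionality; intros x. unfold plus; simpl. change (prod_plus ?a ?b) with (a + b)%C. ring. }
  apply (is_RInt_gen_plus (V := C_R_NormedModule)); auto.
  apply is_RInt_gen_Cmult; try typeclasses eauto. apply mellin_power_zero. pose proof (pos_INR N). lra.
Qed.

Lemma mellin_csum_infty (c : nat -> C) N s : Re s < 0 -> Re s < 1 - INR N ->
  is_RInt_gen (V := C_R_NormedModule) (fun x => csum (fun k => c k * RtoC (x ^ k))%C N * Rcpow x (s - 1))%C
   (at_point 1) (Rbar_locally p_infty) (- csum (fun k => c k / (s + RtoC (INR k)))%C N)%C.
Proof.
intros H0. induction N as [|N IH]; intros Hs; simpl csum.
- replace (fun x => 0 * Rcpow x (s - 1))%C with (fun x => 0 * (RtoC (x ^ 0) * Rcpow x (s - 1)))%C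
   by (apply functional_extensionality; intros; ring).
  pose proof (mellin_power_infty s 0 ltac:(simpl in *; lra)) as Z.
  apply (is_RInt_gen_Cmult _ 0%C) in Z; try typeclasses eauto. rewrite Cmult_0_l in Z.
  replace (- 0)%C with (RtoC 0) by ring. exact Z.
- rewrite S_INR in Hs.
  replace (fun x => (csum (fun k => c k * RtoC (x ^ k)) N + c N * RtoC (x ^ N)) * Rcpow x (s - 1))%C with
   (fun x => plus (csum (fun k => c k * RtoC (x ^ k)) N * Rcpow x (s - 1))%C (c N * (RtoC (x ^ N) * Rcpow x (s - 1))))%C.
  2:{ apply functional_extensionality; intros x. unfold plus; simpl. change (prod_plus ?a ?b) with (a + b)%C. ring. }
  replace (- (csum (fun k => c k / (s + RtoC (INR k))) N + c N / (s + RtoC (INR N))))%C with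
   (- csum (fun k => c k / (s + RtoC (INR k))) N + c N * (- / (s + RtoC (INR N))))%C by (unfold Cdiv; ring).
  apply (is_RInt_gen_plus (V := C_R_NormedModule)). apply IH; lra.
  apply is_RInt_gen_Cmult; try typeclasses eauto. apply mellin_power_infty. lra.
Qed.

(** * The Gamma function *)

Definition gamma_kernel (s : C) (x : R) : C := Cexp (RtoC x * s - RtoC (exp x)).

(* Euler's integral after the substitution [t = exp x]. *)
Definition GI (s : C) : C := LInt (gamma_kernel s).

Lemma Cmod_gamma_kernel s x : Cmod (gamma_kernel s x) = exp (Re s * x - exp x).
Proof. unfold gamma_kernel. rewrite Cmod_Cexp. f_equal. simpl. unfold Re. ring. Qed.

Lemma one_plus_sq_le_exp x : 1 + x ^ 2 <= 4 * exp (Rabs x).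
Proof.
assert (H : forall y, 0 <= y -> 1 + y ^ 2 <= 4 * exp y).
{ intros y Hy. replace y with (y / 2 + y / 2) at 2 by field. rewrite exp_plus.
  pose proof (exp_ineq1_le (y / 2)). nra. }
rewrite <- pow2_abs. apply H, Rabs_pos.
Qed.

Lemma gamma_kernel_bound sigma : 0 < sigma -> exists M, 0 <= M /\
  forall x, exp (sigma * x - exp x) <= M / (1 + x ^ 2).
Proof.
(* [K1] serves [x >= 0], where [exp x >= 1 + x + x ^ 2 / 4] leaves [(sigma + 1) * x] an excess of at
   most [(sigma + 1) ^ 2]. [K2] serves [x < 0], where [exp (sigma * x)] decays by itself. *)
intros Hs. set (K1 := 4 * exp ((sigma + 1) ^ 2)). set (K2 := 4 * (1 + / (sigma ^ 2))).
assert (P1 : 0 < K1) by (unfold K1; pose proof (exp_pos ((sigma + 1) ^ 2)); lra).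
assert (P3 : 0 < sigma ^ 2) by (apply pow_lt; auto).
assert (P2 : 0 < K2) by (unfold K2; pose proof (Rinv_0_lt_compat _ P3); lra).
exists (K1 + K2). split. lra. intros x. pose proof (one_plus_sq x) as P.
apply Rle_div_l_iff; auto. destruct (Rle_or_lt 0 x) as [L|L].
- apply Rle_trans with K1; [|lra].
  apply Rle_trans with (exp (sigma * x - exp x) * (4 * exp x)).
  { apply Rmult_le_compat_l. left; apply exp_pos. pose proof (one_plus_sq_le_exp x). rewrite Rabs_pos_eq in H; auto. }
  replace (exp (sigma * x - exp x) * (4 * exp x)) with (4 * exp (sigma * x - exp x + x)) by (rewrite exp_plus; ring).
  apply Rmult_le_compat_l. lra. apply exp_le.
  assert (1 + x + x ^ 2 / 4 <= exp x).
  { replace x with (x / 2 + x / 2) at 3 by field. rewrite exp_plus. pose proof (exp_ineq1_le (x / 2)). nra. }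
  assert (0 <= (x / 2 - (sigma + 1)) ^ 2) by apply pow2_ge_0. nra.
- apply Rle_trans with K2; [|lra].
  assert (1 + x ^ 2 <= K2 * exp (- (sigma * x))).
  { pose proof (one_plus_sq_le_exp (sigma * x)) as Q. rewrite Rabs_left in Q by nra.
    unfold K2. apply Rle_trans with ((1 + / sigma ^ 2) * (1 + (sigma * x) ^ 2)).
    - replace ((1 + / sigma ^ 2) * (1 + (sigma * x) ^ 2)) with (1 + x ^ 2 + / sigma ^ 2 + (sigma * x) ^ 2) by (field; lra).
      pose proof (Rinv_0_lt_compat _ P3). pose proof (pow2_ge_0 (sigma * x)). lra.
    - replace (4 * (1 + / sigma ^ 2) * exp (- (sigma * x))) with ((1 + / sigma ^ 2) * (4 * exp (- (sigma * x)))) by ring.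
      apply Rmult_le_compat_l; auto. pose proof (Rinv_0_lt_compat _ P3). lra. }
  apply Rle_trans with (exp (sigma * x) * (K2 * exp (- (sigma * x)))).
  { apply Rmult_le_compat; try lra. left; apply exp_pos. apply exp_le. pose proof (exp_pos x). lra. }
  replace (exp (sigma * x) * (K2 * exp (- (sigma * x)))) with (K2 * exp (sigma * x + - (sigma * x))) by (rewrite exp_plus; ring).
  rewrite Rplus_opp_r, exp_0. lra.
Qed.

Lemma gamma_kernel_continuous s x : continuous (U := C_UniformSpace) (gamma_kernel s) x.
Proof.
unfold gamma_kernel. apply (Ccont_path Cexp). apply Cd_Ccont. eexists. apply is_Cd_Cexp.
apply continuous_Cminus.
- apply (continuous_ext (T := R_UniformSpace) (U := C_UniformSpace) (fun t => s * RtoC t)%C (fun t => RtoC t * s)%C). intros t; apply Cmult_comm. apply continuous_Cmult_const.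
  apply continuous_C_pair. apply continuous_id. apply continuous_const.
- apply continuous_C_pair. apply (ex_derive_continuous (K := R_AbsRing) (V := R_NormedModule)). auto_derive; auto.
  apply continuous_const.
Qed.

Lemma gamma_kernel_decays s : 0 < Re s -> decays (gamma_kernel s).
Proof.
intros Hs. destruct (gamma_kernel_bound (Re s) Hs) as [M [_ HM]]. exists M. split.
apply gamma_kernel_continuous. intros t. rewrite Cmod_gamma_kernel. apply HM.
Qed.

Lemma exp_between s1 s s2 x : s1 <= s <= s2 -> exp (s * x - exp x) <= exp (s1 * x - exp x) + exp (s2 * x - exp x).
Proof.
intros Hs. pose proof (exp_pos (s1 * x - exp x)). pose proof (exp_pos (s2 * x - exp x)).
destruct (Rle_or_lt 0 x).
apply Rle_trans with (exp (s2 * x - exp x)). apply exp_le. nra. lra.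
apply Rle_trans with (exp (s1 * x - exp x)). apply exp_le. nra. lra.
Qed.

Lemma GI_bounded s1 s2 : 0 < s1 -> exists M, 0 <= M /\ forall s, s1 <= Re s <= s2 -> Cmod (GI s) <= M.
Proof.
intros H1. destruct (Rle_or_lt s1 s2) as [L|L].
2:{ exists 0. split. lra. intros s Hs. lra. }
destruct (gamma_kernel_bound s1 H1) as [M1 [M10 HM1]].
destruct (gamma_kernel_bound s2 ltac:(lra)) as [M2 [M20 HM2]].
pose proof PI_RGT_0. exists (PI * (M1 + M2)). split. nra. intros s Hs.
apply LInt_bound. split. apply gamma_kernel_continuous.
intros t. rewrite Cmod_gamma_kernel. eapply Rle_trans. now apply (exp_between s1 (Re s) s2).
specialize (HM1 t). specialize (HM2 t). unfold Rdiv in *. lra.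
Qed.

(** The second-order remainder of the kernel carries [x ^ 2 * exp (eta * Rabs x)]. Up to a constant
    each factor costs at most [exp (sigma / 4 * Rabs x)]; together they move [sigma] to half or to
    three halves of itself, which is still positive. *)
Lemma gamma_weight_bound sigma : 0 < sigma -> exists M, 0 <= M /\ forall eta x, 0 <= eta <= sigma / 4 ->
  x ^ 2 * exp (eta * Rabs x) * exp (sigma * x - exp x) <= M / (1 + x ^ 2).
Proof.
intros Hs. destruct (gamma_kernel_bound (3 / 2 * sigma) ltac:(lra)) as [M1 [M10 HM1]].
destruct (gamma_kernel_bound (1 / 2 * sigma) ltac:(lra)) as [M2 [M20 HM2]].
set (K := 4 / (sigma / 4) ^ 2).
assert (K0 : 0 < K). { unfold K. apply Rdiv_lt_0_compat. lra. apply pow_lt; lra. }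
exists (K * (M1 + M2)). split. nra. intros eta x He.
assert (B : x ^ 2 <= K * exp (sigma / 4 * Rabs x)).
{ pose proof (one_plus_sq_le_exp (sigma / 4 * x)) as Q. rewrite Rabs_mult, (Rabs_pos_eq (sigma / 4)) in Q by lra.
  unfold K. apply Rmult_le_reg_l with ((sigma / 4) ^ 2). apply pow_lt; lra.
  replace ((sigma / 4) ^ 2 * (4 / (sigma / 4) ^ 2 * exp (sigma / 4 * Rabs x))) with (4 * exp (sigma / 4 * Rabs x)) by (field; lra).
  rewrite <- Rpow_mult_distr. lra. }
assert (Hx : exp (sigma / 4 * Rabs x) * exp (eta * Rabs x) <= exp (sigma / 2 * x) + exp (- (sigma / 2 * x))).
{ rewrite <- exp_plus. pose proof (Rabs_pos x).
  apply Rle_trans with (exp (sigma / 2 * Rabs x)). apply exp_le. nra.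
  pose proof (exp_pos (sigma / 2 * x)). pose proof (exp_pos (- (sigma / 2 * x))).
  destruct (Rle_or_lt 0 x). rewrite Rabs_pos_eq by auto. lra.
  rewrite Rabs_left by auto. replace (sigma / 2 * - x) with (- (sigma / 2 * x)) by ring. lra. }
apply Rle_trans with (K * (exp (sigma / 2 * x) + exp (- (sigma / 2 * x))) * exp (sigma * x - exp x)).
{ apply Rmult_le_compat_r. left; apply exp_pos.
  apply Rle_trans with (K * exp (sigma / 4 * Rabs x) * exp (eta * Rabs x)).
  apply Rmult_le_compat_r. left; apply exp_pos. auto.
  rewrite Rmult_assoc. apply Rmult_le_compat_l; lra. }
replace (K * (exp (sigma / 2 * x) + exp (- (sigma / 2 * x))) * exp (sigma * x - exp x)) with
 (K * (exp (3 / 2 * sigma * x - exp x) + exp (1 / 2 * sigma * x - exp x))).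
2:{ replace (3 / 2 * sigma * x - exp x) with (sigma / 2 * x + (sigma * x - exp x)) by field.
    replace (1 / 2 * sigma * x - exp x) with (- (sigma / 2 * x) + (sigma * x - exp x)) by field. rewrite !exp_plus. ring. }
specialize (HM1 x). specialize (HM2 x).
replace (K * (M1 + M2) / (1 + x ^ 2)) with (K * (M1 / (1 + x ^ 2) + M2 / (1 + x ^ 2))) by (unfold Rdiv; ring).
apply Rmult_le_compat_l; lra.
Qed.

Lemma GI_Cd s : 0 < Re s -> Cd GI s.
Proof.
intros Hs. destruct (gamma_weight_bound (Re s) Hs) as [M [M0 HM]].
exists (LInt (fun x => gamma_kernel s x * RtoC x)%C).
apply (LInt_is_Cd gamma_kernel _ s (Re s / 4) M). lra.
- intros h Hh. apply gamma_kernel_decays. pose proof (re_le_Cmod h) as L.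
  pose proof (Rle_abs (- Re h)) as L2. rewrite Rabs_Ropp in L2. simpl. unfold Re in *. lra.
- destruct (gamma_kernel_bound (Re s) Hs) as [N [N0 HN]]. exists (N + M). split.
  + intros t. apply continuous_Cmult. apply gamma_kernel_continuous. apply continuous_C_pair. apply continuous_id. apply continuous_const.
  + intros t. rewrite Cmod_mult, Cmod_R, Cmod_gamma_kernel.
    specialize (HM 0 t ltac:(lra)). rewrite Rmult_0_l, exp_0, Rmult_1_r in HM. specialize (HN t).
    replace ((N + M) / (1 + t ^ 2)) with (N / (1 + t ^ 2) + M / (1 + t ^ 2)) by (unfold Rdiv; ring).
    pose proof (exp_pos (Re s * t - exp t)).
    assert (Rabs t <= 1 + t ^ 2). { rewrite <- pow2_abs. pose proof (Rabs_pos t). nra. } nra.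
- intros h t Hh. unfold gamma_kernel at 1 2 3.
  replace (RtoC t * (s + h) - RtoC (exp t))%C with ((RtoC t * s - RtoC (exp t)) + RtoC t * h)%C by ring.
  rewrite Cexp_plus. fold (gamma_kernel s t).
  replace (gamma_kernel s t * Cexp (RtoC t * h) - gamma_kernel s t - h * (gamma_kernel s t * RtoC t))%C
   with (gamma_kernel s t * (Cexp (RtoC t * h) - 1 - RtoC t * h))%C by ring.
  rewrite Cmod_mult, Cmod_gamma_kernel.
  apply Rle_trans with (exp (Re s * t - exp t) * (Rabs t * Cmod h * (Rabs t * Cmod h) * exp (Cmod h * Rabs t))).
  { apply Rmult_le_compat_l. left; apply exp_pos. eapply Rle_trans. apply Cexp_remainder2.
    rewrite Cmod_mult, Cmod_R. apply Rmult_le_compat_l. pose proof (Rabs_pos t); pose proof (Cmod_ge_0 h). nra.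
    apply exp_le. replace (Re (RtoC t * h)) with (t * Re h) by (simpl; unfold Re; ring). rewrite Rabs_mult.
    pose proof (re_le_Cmod h). pose proof (Rabs_pos t). nra. }
  specialize (HM (Cmod h) t). pose proof (Cmod_ge_0 h).
  replace (exp (Re s * t - exp t) * (Rabs t * Cmod h * (Rabs t * Cmod h) * exp (Cmod h * Rabs t))) with
   (Cmod h * Cmod h * (t ^ 2 * exp (Cmod h * Rabs t) * exp (Re s * t - exp t))).
  2:{ rewrite <- (pow2_abs t). ring. }
  apply Rmult_le_compat_l. nra. apply HM. lra.
Qed.

Lemma gamma_kernel_shift s x : gamma_kernel (s + 1) x = (RtoC (exp x) * gamma_kernel s x)%C.
Proof.
unfold gamma_kernel. replace (RtoC x * (s + 1) - RtoC (exp x))%C with (RtoC x + (RtoC x * s - RtoC (exp x)))%C by ring.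
rewrite Cexp_plus. f_equal. unfold Cexp; simpl. rewrite cos_0, sin_0. apply injective_projections; simpl; ring.
Qed.

Lemma gamma_kernel_derive s (x : R) :
  is_derive (K := R_AbsRing) (V := C_R_NormedModule) (gamma_kernel s) x (s * gamma_kernel s x - gamma_kernel (s + 1) x)%C.
Proof.
rewrite gamma_kernel_shift. destruct s as [a b].
apply (is_derive_ext (K := R_AbsRing) (V := C_R_NormedModule)
  (fun t => (exp (t * a - exp t) * cos (t * b), exp (t * a - exp t) * sin (t * b)) : C)).
{ intros u. unfold gamma_kernel, Cexp; simpl.
  replace (u * a - 0 * b + - exp u) with (u * a - exp u) by ring. replace (u * b + 0 * a + - 0) with (u * b) by ring. reflexivity. }
unfold gamma_kernel, Cexp; simpl.
replace (x * a - 0 * b + - exp x) with (x * a - exp x) by ring. replace (x * b + 0 * a + - 0) with (x * b) by ring.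
unfold Cminus, Cplus, Copp, Cmult; simpl. apply is_derive_pair; auto_derive; auto; unfold Rminus; ring.
Qed.

Lemma inv_sq_small M eps : 0 <= M -> 0 < eps -> exists T0, 0 <= T0 /\ forall T, T0 <= T -> M / (1 + T ^ 2) <= eps.
Proof.
intros HM He. exists (M / eps). split. apply Rmult_le_pos; auto. left; now apply Rinv_0_lt_compat.
intros T HT. pose proof (one_plus_sq T). apply Rmult_le_reg_r with (1 + T ^ 2); auto.
replace (M / (1 + T ^ 2) * (1 + T ^ 2)) with M by (field; lra).
assert (M <= eps * T). { apply Rmult_le_compat_l with (r := eps) in HT; [|lra]. replace (eps * (M / eps)) with M in HT by (field; lra). auto. }
assert (T <= 1 + T ^ 2) by nra. nra.
Qed.

(** Integration by parts: [s * gamma_kernel s - gamma_kernel (s + 1)] is the derivative of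
    [gamma_kernel s], which vanishes at both ends of the line. *)
Lemma GI_succ s : 0 < Re s -> GI (s + 1) = (s * GI s)%C.
Proof.
intros Hs. assert (Hs1 : 0 < Re (s + 1)) by (simpl; unfold Re in *; lra).
assert (E : LInt (fun t => s * gamma_kernel s t - gamma_kernel (s + 1) t)%C = 0%C).
{ apply LInt_lim. apply decays_minus. apply decays_Cmult. now apply gamma_kernel_decays. now apply gamma_kernel_decays.
  intros eps He. destruct (gamma_kernel_bound (Re s) Hs) as [M [M0 HM]].
  destruct (inv_sq_small M (eps / 2) M0 ltac:(lra)) as [T0 [H0 HT]]. exists T0. intros T L. specialize (HT T L).
  rewrite (CRInt_derive (gamma_kernel s)).
  - replace (0 - (gamma_kernel s T - gamma_kernel s (- T)))%C with (- gamma_kernel s T + gamma_kernel s (- T))%C by ring.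
    eapply Rle_trans. apply Cmod_triangle. rewrite Cmod_opp, !Cmod_gamma_kernel.
    pose proof (HM T). pose proof (HM (- T)). replace ((- T) ^ 2) with (T ^ 2) in H1 by ring. lra.
  - intros; apply gamma_kernel_derive.
  - intros t _. apply continuous_Cminus. apply continuous_Cmult_const. all: apply gamma_kernel_continuous. }
rewrite (LInt_minus _ _ (decays_Cmult _ s (gamma_kernel_decays s Hs)) (gamma_kernel_decays _ Hs1)), (LInt_Cmult _ s (gamma_kernel_decays s Hs)) in E.
unfold GI. replace (LInt (gamma_kernel (s + 1))) with
 (s * LInt (gamma_kernel s) - (s * LInt (gamma_kernel s) - LInt (gamma_kernel (s + 1))))%C by ring. rewrite E; ring.
Qed.

Lemma Gamma_Euler_GI s : 0 < Re s -> Gamma_Euler s = GI s.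
Proof.
intros Hs. unfold Gamma_Euler. apply CInt_unique; try typeclasses eauto.
apply is_RInt_gen_eps; try typeclasses eauto. intros eps He.
pose proof (is_RInt_gen_eps_inv _ _ _ _ _ _ (LInt_correct _ (gamma_kernel_decays s Hs)) eps He) as H.
destruct H as [P Q [m1 HP] [m2 HQ] HPQ].
(* Under [t = exp x] neighbourhoods of 0 on the right and of infinity correspond to those of the two
   ends of the real line; on each finite interval it is the usual change of variables. *)
apply Filter_prod with (fun x => 0 < x < exp m1) (fun x => Rmax 0 (exp m2) < x).
- exists (mkposreal _ (exp_pos m1)). intros y Hy Hy0. change (Rabs (y - 0) < exp m1) in Hy.
  rewrite Rminus_0_r in Hy. apply Rabs_def2 in Hy. lra.
- exists (Rmax 0 (exp m2)). auto.
- intros p q Hp Hq. simpl. pose proof (Rmax_l 0 (exp m2)). pose proof (Rmax_r 0 (exp m2)).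
  destruct (HPQ (ln p) (ln q)) as [z [Z1 Z2]].
  apply HP. rewrite <- (ln_exp m1). apply ln_increasing; lra.
  apply HQ. rewrite <- (ln_exp m2). apply ln_increasing. apply exp_pos. lra.
  simpl in Z1. exists z. split; auto. apply CRInt_unique in Z1. subst z.
  assert (Hpos : forall x, Rmin p q <= x <= Rmax p q -> 0 < x).
  { intros x [X _]. eapply Rlt_le_trans; [|exact X]. apply Rmin_pos; lra. }
  apply (is_RInt_ext (V := C_R_NormedModule) (fun t => scal (/ t) (gamma_kernel s (ln t)))).
  + intros x X. assert (X0 : 0 < x) by (apply Hpos; lra).
    unfold gamma_kernel. rewrite exp_ln by auto.
    replace (RtoC (exp (- x))) with (Cexp (- RtoC x)%C).
    2:{ unfold Cexp; simpl. rewrite Ropp_0, cos_0, sin_0. apply injective_projections; simpl; ring. }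
    replace (RtoC (ln x) * s - RtoC x)%C with (RtoC (ln x) * (s - 1) + (RtoC (ln x) + - RtoC x))%C by ring.
    rewrite !Cexp_plus. unfold Rcpow. rewrite (Cmult_comm (s - 1)).
    replace (Cexp (RtoC (ln x))) with (RtoC x).
    2:{ unfold Cexp; simpl. rewrite cos_0, sin_0, exp_ln by auto. apply injective_projections; simpl; ring. }
    set (e1 := Cexp (RtoC (ln x) * (s - 1))). set (e2 := Cexp (- RtoC x)).
    transitivity (RtoC (/ x) * (e1 * (RtoC x * e2)))%C.
    apply injective_projections; simpl; unfold scal; simpl; unfold mult; simpl; ring.
    rewrite RtoC_inv by lra. match goal with |- ?a = ?b => change (@eq C a b) end.
    field. intros E. apply RtoC_inj in E. lra.
  + apply (is_RInt_comp (V := C_R_CompleteNormedModule) (gamma_kernel s) ln (fun t => / t)).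
    * intros; apply gamma_kernel_continuous.
    * intros x X. specialize (Hpos x X). split. auto_derive; auto. field; lra.
      apply (ex_derive_continuous (K := R_AbsRing) (V := R_NormedModule)). auto_derive. lra.
Qed.

Definition not_pole (s : C) : Prop := forall k : nat, (s + RtoC (INR k))%C <> 0%C.

Lemma Cprod_neq_0 (f : nat -> C) n : (forall k, (k < n)%nat -> f k <> 0%C) -> Cprod f n <> 0%C.
Proof.
induction n as [|n IH]; intros H; simpl.
- intros E. apply RtoC_inj in E. lra.
- apply Cmult_neq_0. apply IH. intros; apply H; lia. apply H; lia.
Qed.

Lemma Cd_Cprod (f : nat -> C -> C) n z : (forall k, (k < n)%nat -> Cd (f k) z) ->
  Cd (fun w => Cprod (fun k => f k w) n) z.
Proof.
induction n as [|n IH]; intros H; simpl. apply (Cd_const (RtoC 1)). apply Cd_mult. apply IH. intros; apply H; lia. apply H; lia.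
Qed.

(** The iterated recurrence in cross-multiplied form, so that nothing has to be said about zeros of
    the products. *)
Lemma GI_add s n j : 0 < Re s + INR n ->
  (GI (s + RtoC (INR (n + j))) * Cprod (fun k => s + RtoC (INR k)) n)%C =
  (GI (s + RtoC (INR n)) * Cprod (fun k => s + RtoC (INR k)) (n + j))%C.
Proof.
intros Hs. induction j as [|j IH]. rewrite Nat.add_0_r. ring.
rewrite Nat.add_succ_r. simpl Cprod. rewrite S_INR, RtoC_plus.
replace (s + (RtoC (INR (n + j)) + 1))%C with ((s + RtoC (INR (n + j))) + 1)%C by ring.
rewrite GI_succ.
2:{ simpl. rewrite plus_INR. pose proof (pos_INR j). unfold Re in *. lra. }
transitivity ((s + RtoC (INR (n + j))) * (GI (s + RtoC (INR (n + j))) * Cprod (fun k => s + RtoC (INR k)) n))%C. ring.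
rewrite IH. ring.
Qed.

(** Replaces the minimal shift in the definition of [Gamma] by any admissible one. Near a point, or
    on a strip, one common [N] is wanted, whereas the minimal shift jumps with [Re s]. *)
Lemma Gamma_shift s N : 0 < Re s + INR N -> (forall k, (k < N)%nat -> (s + RtoC (INR k))%C <> 0%C) ->
  Gamma s = (GI (s + RtoC (INR N)) / Cprod (fun k => s + RtoC (INR k)) N)%C.
Proof.
intros Hs Hk. unfold Gamma. set (n := Z.to_nat (up (- Re s))).
destruct (archimed (- Re s)) as [A1 A2].
assert (Hn : 0 < Re s + INR n).
{ unfold n. rewrite INR_IZR_INZ. destruct (Z_le_gt_dec 0 (up (- Re s))) as [L|L].
  rewrite Z2Nat.id by auto. lra.
  assert (IZR (up (- Re s)) <= -1) by (apply IZR_le; lia).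
  assert (0 <= IZR (Z.of_nat (Z.to_nat (up (- Re s))))) by (apply IZR_le; lia). lra. }
assert (HnN : (n <= N)%nat).
{ unfold n. assert (IZR (up (- Re s)) < IZR (Z.of_nat N + 1)) by (rewrite plus_IZR, <- INR_IZR_INZ; lra).
  apply lt_IZR in H. lia. }
rewrite Gamma_Euler_GI by (simpl; unfold Re in *; lra).
pose proof (GI_add s n (N - n) Hn) as E. replace (n + (N - n))%nat with N in E by lia.
assert (P1 : Cprod (fun k => s + RtoC (INR k))%C n <> 0%C) by (apply Cprod_neq_0; intros; apply Hk; lia).
assert (P2 : Cprod (fun k => s + RtoC (INR k))%C N <> 0%C) by (apply Cprod_neq_0; auto).
replace (GI (s + RtoC (INR n))) with (GI (s + RtoC (INR n)) * Cprod (fun k => s + RtoC (INR k)) N / Cprod (fun k => s + RtoC (INR k)) N)%C by (field; auto).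
rewrite <- E. field; auto.
Qed.

Lemma Gamma_GI s : 0 < Re s -> Gamma s = GI s.
Proof.
intros Hs. rewrite (Gamma_shift s 0). simpl. replace (s + 0)%C with s by ring. field.
simpl; lra. intros k Hk. lia.
Qed.

Lemma not_pole_nbhd s N : (forall k, (k < N)%nat -> (s + RtoC (INR k))%C <> 0%C) ->
  exists r, 0 < r /\ forall w, Cmod (w - s) < r -> forall k, (k < N)%nat -> (w + RtoC (INR k))%C <> 0%C.
Proof.
induction N as [|N IH]; intros H.
- exists 1. split. lra. intros; lia.
- destruct IH as [r [Hr IH]]. intros; apply H; lia.
  pose proof (proj1 (Cmod_gt_0 _) (H N (Nat.lt_succ_diag_r N))) as P.
  exists (Rmin r (Cmod (s + RtoC (INR N)))). split. now apply Rmin_pos.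
  intros w Hw k Hk. apply Rmin_Rgt in Hw. destruct Hw as [W1 W2].
  destruct (Nat.eq_dec k N) as [->|]. 2: apply IH; auto; lia.
  intros E. replace (w - s)%C with ((w + RtoC (INR N)) + - (s + RtoC (INR N)))%C in W2 by ring.
  rewrite E, Cplus_0_l, Cmod_opp in W2. lra.
Qed.

Lemma nat_above x : exists N : nat, x < INR N.
Proof. destruct (INR_unbounded x) as [N HN]. exists N. lra. Qed.

Lemma Cd_GI_shift s N : 0 < Re s + INR N -> Cd (fun w => GI (w + RtoC (INR N)))%C s.
Proof.
intros H. apply (Cd_comp GI). apply Cd_plus. apply Cd_id. apply Cd_const.
apply GI_Cd. simpl. unfold Re in *. lra.
Qed.

Lemma Cd_shift_prod s N : Cd (fun w => Cprod (fun k => w + RtoC (INR k)) N)%C s.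
Proof.
apply (Cd_Cprod (fun k w => w + RtoC (INR k))%C). intros. apply Cd_plus. apply Cd_id. apply Cd_const.
Qed.

Lemma Gamma_Cd s : not_pole s -> Cd Gamma s.
Proof.
intros H. destruct (nat_above (1 - Re s)) as [N HN].
destruct (not_pole_nbhd s N) as [r [Hr Hw]]. intros; apply H.
apply (Cd_ext (fun w => GI (w + RtoC (INR N)) / Cprod (fun k => w + RtoC (INR k)) N)%C _ s (Rmin 1 r)).
- apply Rmin_pos; lra.
- intros w W. apply Rmin_Rgt in W. destruct W as [W1 W2].
  symmetry. apply Gamma_shift. 2: now apply Hw.
  pose proof (re_le_Cmod (w - s)) as L. pose proof (Rle_abs (- Re (w - s))) as L2. rewrite Rabs_Ropp in L2.
  simpl in *. unfold Re in *. simpl in *. lra.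
- apply Cd_div. apply Cd_GI_shift; lra. apply Cd_shift_prod. apply Cprod_neq_0. intros; apply H.
Qed.

Lemma not_pole_pos s : 0 < Re s -> not_pole s.
Proof. intros H k. apply line_neq_nat. pose proof (pos_INR k). lra. Qed.

Lemma not_pole_im s : Im s <> 0 -> not_pole s.
Proof. intros H k E. apply H. apply (f_equal snd) in E. simpl in E. unfold Im. lra. Qed.

Lemma Cprod_lower (f : nat -> C) n m : 0 <= m -> (forall k, (k < n)%nat -> m <= Cmod (f k)) -> m ^ n <= Cmod (Cprod f n).
Proof.
intros Hm. induction n as [|n IH]; intros H; simpl.
- rewrite Cmod_1. lra.
- rewrite Cmod_mult, Rmult_comm. apply Rmult_le_compat; auto. now apply pow_le.
Qed.

Lemma Gamma_decay x1 x2 n : exists M, 0 <= M /\ forall x t, x1 <= x <= x2 -> 1 <= Rabs t ->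
  Cmod (Gamma (x, t)) <= M / Rabs t ^ n.
Proof.
(* [N0] brings [s + N] into a strip where [GI] is bounded, and [n] guarantees enough factors
   [s + k], each of modulus at least [Rabs t]. Since [1 <= Rabs t], additional factors do no
   harm. *)
destruct (nat_above (1 - x1)) as [N0 HN0]. set (N := (N0 + n)%nat).
assert (HN : 1 - x1 < INR N). { unfold N. rewrite plus_INR. pose proof (pos_INR n). lra. }
destruct (GI_bounded (x1 + INR N) (x2 + INR N)) as [M [M0 HM]]. lra.
exists M. split; auto. intros x t X T.
assert (P : forall k : nat, Rabs t <= Cmod ((x, t) + RtoC (INR k))).
{ intros k. eapply Rle_trans; [|apply Rabs_Im_le_Cmod]. simpl. rewrite Rplus_0_r. lra. }
rewrite (Gamma_shift (x, t) N); [ | simpl; lra | intros k _; apply Cmod_gt_0; specialize (P k); lra].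
rewrite Cmod_div by (apply Cprod_neq_0; intros k _; apply Cmod_gt_0; specialize (P k); lra).
assert (L : Rabs t ^ n <= Cmod (Cprod (fun k => (x, t) + RtoC (INR k))%C N)).
{ apply Rle_trans with (Rabs t ^ N). apply Rle_pow; auto. unfold N; lia.
  apply Cprod_lower. lra. intros; apply P. }
assert (0 < Rabs t ^ n) by (apply pow_lt; lra).
apply Rle_trans with (M / Cmod (Cprod (fun k => (x, t) + RtoC (INR k))%C N)).
apply Rdiv_le_num. lra. apply HM. simpl; lra. apply Rdiv_le_den; auto.
Qed.

Lemma Rabs_pow4 t : Rabs t ^ 4 = t ^ 4.
Proof. replace (Rabs t ^ 4) with ((Rabs t ^ 2) ^ 2) by ring. rewrite pow2_abs. ring. Qed.

Lemma Gamma_strip_ok x1 x2 : (forall x t, x1 <= x <= x2 -> not_pole (x, t)) -> strip_ok Gamma x1 x2.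
Proof.
intros H. split. intros; apply Gamma_Cd; auto.
destruct (Gamma_decay x1 x2 4) as [M [M0 HM]]. exists M. split; auto.
intros x t X T. rewrite <- Rabs_pow4. now apply HM.
Qed.

(* [(s + k) Gamma s], continued over the pole [- k]. *)
Definition Gamma_reg (k : nat) (s : C) : C :=
  (GI (s + RtoC (INR (S k))) / Cprod (fun j => s + RtoC (INR j)) k)%C.

Lemma Gamma_reg_eq k s : - INR (S k) < Re s -> (forall j, (j < S k)%nat -> (s + RtoC (INR j))%C <> 0%C) ->
  Gamma s = (Gamma_reg k s / (s + RtoC (INR k)))%C.
Proof.
intros Hs Hj. rewrite (Gamma_shift s (S k)); auto. 2: lra. unfold Gamma_reg. simpl Cprod. field.
split. 2: apply Hj; lia. apply Cprod_neq_0. intros; apply Hj; lia.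
Qed.

Lemma Gamma_reg_strip_ok k x1 x2 : - INR (S k) < x1 -> x2 < - INR k + 1 -> strip_ok (Gamma_reg k) x1 x2.
Proof.
intros H1 H2.
assert (Hnz : forall x t j, x1 <= x <= x2 -> (j < k)%nat -> ((x, t) + RtoC (INR j))%C <> 0%C).
{ intros x t j X J. apply line_neq_nat. simpl. apply Rlt_not_eq.
  apply lt_INR in J. assert (INR j + 1 <= INR k). { rewrite <- S_INR. apply le_INR. apply INR_lt in J. lia. } lra. }
split.
- intros x t X. apply Cd_div. apply Cd_GI_shift. simpl Re. lra. apply Cd_shift_prod.
  apply Cprod_neq_0. intros j J. now apply Hnz.
(* One of the five powers is spent on the factor [s + k], whose modulus is at most the second
   constant times [Rabs t]; four remain. *)
- destruct (Gamma_decay x1 x2 5) as [M [M0 HM]]. exists (M * (Rabs x1 + Rabs x2 + INR k + 1)).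
  split. { apply Rmult_le_pos; auto. pose proof (Rabs_pos x1). pose proof (Rabs_pos x2). pose proof (pos_INR k). lra. }
  intros x t X T.
  assert (N : ((x, t) + RtoC (INR k))%C <> 0%C).
  { intros E. apply (f_equal snd) in E. simpl in E. rewrite Rplus_0_r in E. subst t. rewrite Rabs_R0 in T. lra. }
  replace (Gamma_reg k (x, t)) with (Gamma (x, t) * ((x, t) + RtoC (INR k)))%C.
  2:{ rewrite (Gamma_reg_eq k). field; auto. simpl Re; lra. intros j J.
      destruct (Nat.eq_dec j k) as [->|]; auto. apply Hnz; auto; lia. }
  rewrite Cmod_mult, <- Rabs_pow4.
  assert (L : Cmod ((x, t) + RtoC (INR k)) <= (Rabs x1 + Rabs x2 + INR k + 1) * Rabs t).
  { eapply Rle_trans. apply Cmod_le_sum. simpl. rewrite Rplus_0_r.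
    assert (Rabs (x + INR k) <= Rabs x1 + Rabs x2 + INR k).
    { pose proof (Rle_abs x2). pose proof (Rle_abs (- x1)). rewrite Rabs_Ropp in *. pose proof (pos_INR k).
      pose proof (Rabs_pos x1). pose proof (Rabs_pos x2). apply Rabs_le. lra. }
    pose proof (Rabs_pos (x + INR k)). nra. }
  apply Rle_trans with (M / Rabs t ^ 5 * ((Rabs x1 + Rabs x2 + INR k + 1) * Rabs t)).
  apply Rmult_le_compat; auto; try apply Cmod_ge_0. right. field. lra.
Qed.

(** * Absence of zeros of the Gamma function *)

Lemma LInt_le f g : decays f -> decays (fun t => RtoC (g t)) -> (forall t, Cmod (f t) <= g t) ->
  Cmod (LInt f) <= Re (LInt (fun t => RtoC (g t))).
Proof.
intros Hf Hg H. apply le_epsilon. intros e He.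
destruct (LInt_approx_eps f (e / 2) Hf ltac:(lra)) as [T1 [P1 H1]].
destruct (LInt_approx_eps _ (e / 2) Hg ltac:(lra)) as [T2 [P2 H2]].
set (T := Rmax T1 T2). specialize (H1 T (Rmax_l _ _)). specialize (H2 T (Rmax_r _ _)).
assert (T0 : 0 <= T) by (eapply Rle_trans; [exact P1 | apply Rmax_l]).
destruct Hf as [Mf [Cf _]]. destruct Hg as [Mg [Cg _]].
assert (B : Cmod (CRInt f (- T) T) <= Re (CRInt (fun t => RtoC (g t)) (- T) T)).
{ apply (CRInt_bound_fun f g). lra. now apply cont_on_all. auto.
  apply (is_RInt_fct_extend_fst (U := R_NormedModule) (V := R_NormedModule) (fun t => RtoC (g t))).
  apply CRInt_correct. now apply cont_on_all. }
set (I1 := CRInt f (- T) T) in *. set (I2 := CRInt (fun t => RtoC (g t)) (- T) T) in *.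
replace (LInt f) with ((LInt f - I1) + I1)%C by ring.
eapply Rle_trans. apply Cmod_triangle.
pose proof (re_le_Cmod (LInt (fun t => RtoC (g t)) - I2)) as L.
pose proof (Rle_abs (- Re (LInt (fun t => RtoC (g t)) - I2))) as L2. rewrite Rabs_Ropp in L2.
set (G := LInt (fun t => RtoC (g t))) in *. change (Re (G - I2)) with (Re G - Re I2) in *. lra.
Qed.

(** Integrate the derivative, using [exp (t * Re s) <= exp t + exp (2 * t)]. With [u = exp v] the
    bound becomes the polynomial expression [Rabs (u - 1) * (3 + u) / 2], whose majorants can be
    integrated against the Gamma kernel in closed form. *)
Lemma Cexp_lipschitz s v : 1 <= Re s <= 2 ->
  Cmod (Cexp (RtoC v * s) - 1) <= Cmod s * (Rabs (exp v - 1) * (3 + exp v) / 2).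
Proof.
intros Hs.
assert (Hc : forall a b, cont_on (fun t => s * Cexp (RtoC t * s))%C a b).
{ intros a b t _. apply continuous_Cmult_const. eapply continuous_of_derive. apply is_derive_Cexp_line. }
assert (Hd : forall a b, CRInt (fun t => s * Cexp (RtoC t * s))%C a b = (Cexp (RtoC b * s) - Cexp (RtoC a * s))%C).
{ intros a b. apply (CRInt_derive (fun t => Cexp (RtoC t * s))). intros; apply is_derive_Cexp_line. apply Hc. }
assert (Hb : forall a b, a <= b -> Cmod (Cexp (RtoC b * s) - Cexp (RtoC a * s)) <=
   Cmod s * ((exp b + exp (2 * b) / 2) - (exp a + exp (2 * a) / 2))).
{ intros a b Hab. rewrite <- Hd.
  apply (CRInt_bound_fun _ (fun t => Cmod s * (exp t + exp (2 * t)))); auto.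
  - intros t _. rewrite Cmod_mult, Cmod_Cexp. apply Rmult_le_compat_l. apply Cmod_ge_0.
    replace (Re (RtoC t * s)) with (t * Re s) by (simpl; unfold Re; ring).
    pose proof (exp_pos t). pose proof (exp_pos (2 * t)).
    destruct (Rle_or_lt 0 t).
    apply Rle_trans with (exp (2 * t)). apply exp_le. nra. lra.
    apply Rle_trans with (exp t). apply exp_le. nra. lra.
  - replace (Cmod s * ((exp b + exp (2 * b) / 2) - (exp a + exp (2 * a) / 2))) with
      (minus (Cmod s * (exp b + exp (2 * b) / 2)) (Cmod s * (exp a + exp (2 * a) / 2))) by (unfold minus, plus, opp; simpl; ring).
    apply (is_RInt_derive (fun t => Cmod s * (exp t + exp (2 * t) / 2))).
    intros x _. auto_derive; auto. field.
    intros x _. apply (ex_derive_continuous (K := R_AbsRing) (V := R_NormedModule)). auto_derive; auto. }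
assert (E2 : exp (2 * v) = exp v * exp v) by (rewrite <- exp_plus; f_equal; ring).
assert (E0 : Cexp (RtoC 0 * s) = 1%C). { replace (0 * s)%C with (RtoC 0) by ring. apply Cexp_0. }
destruct (Rle_or_lt 0 v) as [L|L].
- specialize (Hb 0 v L). rewrite E0, Rmult_0_r, exp_0, E2 in Hb. eapply Rle_trans. exact Hb.
  assert (1 <= exp v) by (rewrite <- exp_0; apply exp_le; auto). rewrite Rabs_pos_eq by lra. right. field.
- specialize (Hb v 0 ltac:(lra)). rewrite E0, Rmult_0_r, exp_0, E2 in Hb.
  replace (Cexp (RtoC v * s) - 1)%C with (- (1 - Cexp (RtoC v * s)))%C by ring. rewrite Cmod_opp.
  eapply Rle_trans. exact Hb.
  assert (exp v <= 1) by (rewrite <- exp_0; apply exp_le; lra). rewrite Rabs_left1 by lra. right. field.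
Qed.

Lemma gamma_kernel_real y x : gamma_kernel (RtoC y) x = RtoC (exp (y * x - exp x)).
Proof.
unfold gamma_kernel, Cexp; simpl. replace (x * 0 + 0 * y + - 0) with 0 by ring. rewrite cos_0, sin_0.
replace (x * y - 0 * 0 + - exp x) with (y * x - exp x) by ring. apply injective_projections; simpl; ring.
Qed.

Lemma GI_1 : GI 1 = 1%C.
Proof.
apply LInt_lim. apply gamma_kernel_decays. simpl; lra.
intros eps He. exists (2 / eps). intros T HT.
assert (T0 : 0 < 2 / eps) by (apply Rdiv_lt_0_compat; lra).
rewrite (CRInt_derive (fun x => RtoC (- exp (- exp x)))).
- rewrite <- !RtoC_minus, Cmod_R.
  assert (B1 : exp (- exp T) <= eps / 2 /\ exp (- T) <= eps / 2).
  { assert (H : forall y, 0 < y -> exp (- y) <= / y).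
    { intros y Hy. rewrite exp_Ropp. apply Rinv_le_contravar; auto. pose proof (exp_ineq1_le y). lra. }
    assert (/ T <= eps / 2). { replace (eps / 2) with (/ (2 / eps)) by (field; lra). apply Rinv_le_contravar; auto. }
    split.
    - eapply Rle_trans. apply exp_le with (y := - T). pose proof (exp_ineq1_le T). lra.
      eapply Rle_trans. apply H; lra. auto.
    - eapply Rle_trans. apply H; lra. auto. }
  pose proof (exp_ineq1_le (- exp (- T))). pose proof (exp_pos (- T)). pose proof (exp_pos (- exp T)).
  assert (exp (- exp (- T)) <= 1). { rewrite <- exp_0. apply exp_le. lra. }
  apply Rabs_le. lra.
- intros x _. change (RtoC 1) with (RtoC 1%R). rewrite gamma_kernel_real. apply is_derive_pair.
  auto_derive; auto. unfold Rminus. rewrite exp_plus, !Rmult_1_l. ring.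
  apply (is_derive_const (K := R_AbsRing) (V := R_NormedModule)).
- intros t _. apply gamma_kernel_continuous.
Qed.

Lemma GI_nat_neq_0 n : GI (RtoC (INR (S n))) <> 0%C.
Proof.
induction n as [|n IH].
- simpl. rewrite GI_1. intros E. apply RtoC_inj in E. lra.
- rewrite S_INR, RtoC_plus. rewrite GI_succ. 2: { change (0 < INR (S n)). apply lt_0_INR. lia. }
  apply Cmult_neq_0; auto. intros E. apply RtoC_inj in E. pose proof (lt_0_INR (S n) ltac:(lia)). lra.
Qed.

(* Under the probability density proportional to [exp (N x - exp x)], the
   variable [u = exp x / N] has mean 1 and variance 1/N, so that
   [Gamma (s + N) N^(-s)] stays close to [Gamma N]. *)
Lemma GI_ratio s (N : nat) eta : 1 <= Re s <= 2 -> (0 < N)%nat -> 0 < eta ->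
  Cmod (Cexp (- (RtoC (ln (INR N)) * s)) * GI (s + RtoC (INR N)) - GI (RtoC (INR N))) <=
  Cmod s / 4 * (4 * eta + (4 / INR N + 2 / INR N ^ 2) / eta) * Cmod (GI (RtoC (INR N))).
Proof.
intros Hs HN He. pose proof (lt_0_INR N HN) as PN. set (n := INR N) in *.
set (q := Cmod s / 4).
assert (q0 : 0 <= q) by (unfold q; pose proof (Cmod_ge_0 s); lra).
(* Coefficients of [q * (eta + (u - 1) ^ 2 / eta) * (3 + u)], [u = exp x / n], by powers of [exp x].
   Each power of [exp x] raises the argument of the kernel by one. *)
set (c0 := q * (3 * eta + 3 / eta)). set (c1 := q * (eta - 5 / eta) / n).
set (c2 := q / eta / n ^ 2). set (c3 := q / eta / n ^ 3).
set (g := fun x => q * ((eta + (exp x / n - 1) ^ 2 / eta) * (3 + exp x / n)) * exp (n * x - exp x)).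
assert (D : forall y, 0 < y -> decays (gamma_kernel (RtoC y))).
{ intros y Hy. apply gamma_kernel_decays. exact Hy. }
assert (Hg : forall x, RtoC (g x) = (RtoC c0 * gamma_kernel (RtoC n) x + RtoC c1 * gamma_kernel (RtoC (n + 1)) x
   + RtoC c2 * gamma_kernel (RtoC (n + 1 + 1)) x + RtoC c3 * gamma_kernel (RtoC (n + 1 + 1 + 1)) x)%C).
{ intros x. rewrite !gamma_kernel_real, <- !RtoC_mult, <- !RtoC_plus. f_equal. unfold g, c0, c1, c2, c3.
  replace ((n + 1 + 1 + 1) * x - exp x) with (x + (x + (x + (n * x - exp x)))) by ring.
  replace ((n + 1 + 1) * x - exp x) with (x + (x + (n * x - exp x))) by ring.
  replace ((n + 1) * x - exp x) with (x + (n * x - exp x)) by ring.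
  rewrite !(exp_plus x). field. lra. }
assert (D1 : decays (fun x => RtoC c0 * gamma_kernel (RtoC n) x)%C) by (apply decays_Cmult, D; lra).
assert (D2 : decays (fun x => RtoC c1 * gamma_kernel (RtoC (n + 1)) x)%C) by (apply decays_Cmult, D; lra).
assert (D3 : decays (fun x => RtoC c2 * gamma_kernel (RtoC (n + 1 + 1)) x)%C) by (apply decays_Cmult, D; lra).
assert (D4 : decays (fun x => RtoC c3 * gamma_kernel (RtoC (n + 1 + 1 + 1)) x)%C) by (apply decays_Cmult, D; lra).
assert (Dg : decays (fun x => RtoC (g x))).
{ apply (decays_ext (fun x => RtoC c0 * gamma_kernel (RtoC n) x + RtoC c1 * gamma_kernel (RtoC (n + 1)) x
   + RtoC c2 * gamma_kernel (RtoC (n + 1 + 1)) x + RtoC c3 * gamma_kernel (RtoC (n + 1 + 1 + 1)) x)%C).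
  intros; now rewrite Hg. exact (decays_plus _ _ (decays_plus _ _ (decays_plus _ _ D1 D2) D3) D4). }
set (G := GI (RtoC n)).
assert (G1 : GI (RtoC (n + 1)) = (RtoC n * G)%C) by (rewrite RtoC_plus; now apply GI_succ).
assert (G2 : GI (RtoC (n + 1 + 1)) = (RtoC (n + 1) * (RtoC n * G))%C).
{ rewrite RtoC_plus, GI_succ, G1; auto. simpl; lra. }
assert (G3 : GI (RtoC (n + 1 + 1 + 1)) = (RtoC (n + 1 + 1) * (RtoC (n + 1) * (RtoC n * G)))%C).
{ rewrite RtoC_plus, GI_succ, G2; auto. simpl; lra. }
(* Relative to [G] the first three moments of [u] are 1, 1 + 1/n and (1 + 1/n)(1 + 2/n). The terms
   in [1 / eta] that are free of [n] cancel, since 3 - 5 + 1 + 1 = 0. *)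
assert (EL : LInt (fun x => RtoC (g x)) = (RtoC (q * (4 * eta + (4 / n + 2 / n ^ 2) / eta)) * G)%C).
{ rewrite (LInt_ext _ _ Hg), (LInt_plus _ _ (decays_plus _ _ (decays_plus _ _ D1 D2) D3) D4),
   (LInt_plus _ _ (decays_plus _ _ D1 D2) D3), (LInt_plus _ _ D1 D2).
  rewrite (LInt_Cmult _ _ (D n ltac:(lra))), (LInt_Cmult _ _ (D (n + 1) ltac:(lra))),
   (LInt_Cmult _ _ (D (n + 1 + 1) ltac:(lra))), (LInt_Cmult _ _ (D (n + 1 + 1 + 1) ltac:(lra))).
  change (LInt (gamma_kernel (RtoC n))) with G. change (LInt (gamma_kernel (RtoC (n + 1)))) with (GI (RtoC (n + 1))).
  change (LInt (gamma_kernel (RtoC (n + 1 + 1)))) with (GI (RtoC (n + 1 + 1))).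
  change (LInt (gamma_kernel (RtoC (n + 1 + 1 + 1)))) with (GI (RtoC (n + 1 + 1 + 1))).
  rewrite G1, G2, G3.
  replace (RtoC c0 * G + RtoC c1 * (RtoC n * G) + RtoC c2 * (RtoC (n + 1) * (RtoC n * G)) + RtoC c3 * (RtoC (n + 1 + 1) * (RtoC (n + 1) * (RtoC n * G))))%C with
   (RtoC (c0 + c1 * n + c2 * ((n + 1) * n) + c3 * ((n + 1 + 1) * ((n + 1) * n))) * G)%C by (rewrite !RtoC_plus, !RtoC_mult, !RtoC_plus; ring).
  f_equal. f_equal. unfold c0, c1, c2, c3. field. lra. }
assert (Hsn : 0 < Re (s + RtoC n)) by (simpl; unfold Re in *; lra).
set (f := fun x => (Cexp (- (RtoC (ln n) * s)) * gamma_kernel (s + RtoC n) x - gamma_kernel (RtoC n) x)%C).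
assert (Df : decays f).
{ exact (decays_minus _ _ (decays_Cmult _ _ (gamma_kernel_decays _ Hsn)) (D n PN)). }
assert (Ef : LInt f = (Cexp (- (RtoC (ln n) * s)) * GI (s + RtoC n) - G)%C).
{ unfold f. now rewrite (LInt_minus _ _ (decays_Cmult _ _ (gamma_kernel_decays _ Hsn)) (D n PN)), (LInt_Cmult _ _ (gamma_kernel_decays _ Hsn)). }
rewrite <- Ef.
eapply Rle_trans. apply (LInt_le f g); auto.
- intros x. unfold f.
  replace (Cexp (- (RtoC (ln n) * s)) * gamma_kernel (s + RtoC n) x - gamma_kernel (RtoC n) x)%C with
   ((Cexp (RtoC (x - ln n) * s) - 1) * gamma_kernel (RtoC n) x)%C.
  2:{ unfold gamma_kernel. replace (RtoC x * (s + RtoC n) - RtoC (exp x))%C with (RtoC x * s + (RtoC x * RtoC n - RtoC (exp x)))%C by ring.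
      rewrite RtoC_minus. replace ((x - ln n) * s)%C with (- (RtoC (ln n) * s) + RtoC x * s)%C by ring. rewrite !Cexp_plus. ring. }
  rewrite Cmod_mult, Cmod_gamma_kernel. unfold g. simpl Re.
  apply Rmult_le_compat_r. left; apply exp_pos.
  eapply Rle_trans. now apply Cexp_lipschitz.
  replace (exp (x - ln n)) with (exp x / n).
  2:{ unfold Rminus. rewrite exp_plus, exp_Ropp, exp_ln; auto. }
  assert (U : 0 < exp x / n) by (apply Rdiv_lt_0_compat; auto; apply exp_pos).
  set (u := exp x / n) in *.
  replace (Cmod s * (Rabs (u - 1) * (3 + u) / 2)) with (q * (2 * Rabs (u - 1) * (3 + u))) by (unfold q; field).
  apply Rmult_le_compat_l; auto. apply Rmult_le_compat_r. lra.
  (* The inequality [2 * Rabs (u - 1) <= eta + (u - 1) ^ 2 / eta] trades the absolute deviation for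
     the variance. *)
  apply Rmult_le_reg_r with eta; auto.
  replace ((eta + (u - 1) ^ 2 / eta) * eta) with (eta ^ 2 + Rabs (u - 1) ^ 2) by (rewrite pow2_abs; field; lra).
  pose proof (pow2_ge_0 (eta - Rabs (u - 1))). nra.
- rewrite EL. eapply Rle_trans. apply Rle_abs. eapply Rle_trans. apply re_le_Cmod.
  rewrite Cmod_mult, Cmod_R, Rabs_pos_eq. lra.
  apply Rmult_le_pos; auto. assert (0 < / n) by now apply Rinv_0_lt_compat.
  assert (0 < / n ^ 2) by (apply Rinv_0_lt_compat, pow_lt; auto). assert (0 < / eta) by now apply Rinv_0_lt_compat.
  unfold Rdiv. nra.
Qed.

Lemma GI_zero_succ s : 0 < Re s -> GI s = 0%C -> forall m : nat, GI (s + RtoC (INR m)) = 0%C.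
Proof.
intros Hs H0. induction m as [|m IH].
- simpl. replace (s + 0)%C with s by ring. auto.
- rewrite S_INR, RtoC_plus. replace (s + (RtoC (INR m) + 1))%C with ((s + RtoC (INR m)) + 1)%C by ring.
  rewrite GI_succ, IH. ring. simpl. pose proof (pos_INR m). unfold Re in *. lra.
Qed.

(** With [A = Cmod s + 1], [eta = 1 / (4 A)] and [N > 32 A ^ 2], the deviation in [GI_ratio] is at
    most half of [Cmod (GI N)]; a zero would make it all of [Cmod (GI N)]. *)
Lemma GI_neq_0_strip s : 1 <= Re s <= 2 -> exists N0 : nat, forall N, (N0 <= N)%nat -> GI (s + RtoC (INR N)) <> 0%C.
Proof.
intros Hs. set (A := Cmod s + 1).
assert (A1 : 1 <= A) by (unfold A; pose proof (Cmod_ge_0 s); lra).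
destruct (nat_above (32 * A ^ 2)) as [N0 HN0]. exists N0. intros N HN E.
assert (HNr : 32 * A ^ 2 < INR N) by (eapply Rlt_le_trans; [exact HN0 | now apply le_INR]).
assert (PN : 1 < INR N) by nra.
assert (HN1 : (0 < N)%nat) by (apply INR_lt; simpl; lra).
assert (Hk : Cmod s / 4 * (4 * (/ (4 * A)) + (4 / INR N + 2 / INR N ^ 2) / (/ (4 * A))) <= 1 / 2).
{ assert (P : 4 / INR N + 2 / INR N ^ 2 <= 6 / INR N).
  { replace (6 / INR N) with (4 / INR N + 2 / INR N) by (field; lra).
    assert (2 / INR N ^ 2 <= 2 / INR N) by (apply Rdiv_le_den; nra). lra. }
  assert (Q : 6 / INR N <= 6 / (32 * A ^ 2)) by (apply Rdiv_le_den; nra).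
  replace (4 * / (4 * A) + (4 / INR N + 2 / INR N ^ 2) / / (4 * A)) with (/ A + 4 * A * (4 / INR N + 2 / INR N ^ 2)) by (field; lra).
  apply Rle_trans with (A / 4 * (/ A + 4 * A * (6 / (32 * A ^ 2)))).
  - apply Rmult_le_compat.
    + pose proof (Cmod_ge_0 s). lra.
    + assert (0 < / A) by (apply Rinv_0_lt_compat; lra).
      assert (0 < 4 / INR N) by (apply Rdiv_lt_0_compat; lra). assert (0 < 2 / INR N ^ 2) by (apply Rdiv_lt_0_compat; nra). nra.
    + unfold A. lra.
    + apply Rplus_le_compat_l. apply Rmult_le_compat_l; lra.
  - replace (A / 4 * (/ A + 4 * A * (6 / (32 * A ^ 2)))) with (7 / 16) by (field; lra). lra. }
pose proof (GI_ratio s N (/ (4 * A)) Hs HN1 ltac:(apply Rinv_0_lt_compat; lra)) as R.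
rewrite E in R. rewrite Cmult_0_r in R.
replace (0 - GI (RtoC (INR N)))%C with (- GI (RtoC (INR N)))%C in R by ring. rewrite Cmod_opp in R.
assert (P : 0 < Cmod (GI (RtoC (INR N)))).
{ apply Cmod_gt_0. replace N with (S (N - 1)) by lia. apply GI_nat_neq_0. }
apply (Rmult_le_compat_r (Cmod (GI (RtoC (INR N))))) in Hk; lra.
Qed.

(** By the recurrence a zero repeats itself at all integer translates to the right. One translate
    gives real part above 1, hence a point of the strip 1 <= Re <= 2 plus an integer, and far out
    [GI_neq_0_strip] forbids the zero. *)
Lemma GI_neq_0 s : 0 < Re s -> GI s <> 0%C.
Proof.
intros Hs E. set (z := (s + RtoC (INR 1))%C).
assert (Hz : 1 < Re z) by (unfold z; simpl; unfold Re in *; lra).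
assert (Ez : GI z = 0%C) by (apply GI_zero_succ; auto).
destruct (nfloor_ex (Re z - 1)) as [n [Hn1 Hn2]]; [lra|].
set (s' := (z - RtoC (INR n))%C).
assert (Hs' : 1 <= Re s' <= 2) by (change (Re s') with (Re z - INR n); lra).
destruct (GI_neq_0_strip s' Hs') as [N0 HN0].
apply (HN0 (n + N0)%nat ltac:(lia)).
replace (s' + RtoC (INR (n + N0)))%C with (z + RtoC (INR N0))%C by (unfold s'; rewrite plus_INR, RtoC_plus; ring).
apply GI_zero_succ; auto. lra.
Qed.

Lemma Gamma_neq_0 s : not_pole s -> Gamma s <> 0%C.
Proof.
intros H. destruct (nat_above (- Re s)) as [N HN].
rewrite (Gamma_shift s N); [ | lra | intros; apply H].
apply Cmult_neq_0. apply GI_neq_0. simpl. unfold Re in *. lra.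
intros E. assert (P : Cprod (fun k => s + RtoC (INR k))%C N <> 0%C) by (apply Cprod_neq_0; intros; apply H).
assert (Cprod (fun k => s + RtoC (INR k))%C N * / Cprod (fun k => s + RtoC (INR k))%C N = 1)%C by (field; auto).
rewrite E, Cmult_0_r in H0. apply RtoC_inj in H0. lra.
Qed.

(** * Dirichlet series and products of Gamma factors *)

Notation Csum_n := (sum_n (G := C_AbelianMonoid)).
Notation is_Cseries := (is_series (K := C_AbsRing) (V := C_NormedModule)).
Notation ex_Cseries := (ex_series (K := C_AbsRing) (V := C_NormedModule)).

Lemma is_Cseries_eps_inv (u : nat -> C) (l : C) : is_Cseries u l ->
  forall eps, 0 < eps -> exists N, forall n, (N <= n)%nat -> Cmod (Csum_n u n - l) < eps.
Proof.
intros H eps He.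
assert (He' : 0 < eps / sqrt 2) by (apply Rdiv_lt_0_compat; [lra | apply Rlt_sqrt2_0]).
destruct (H (fun z => Cmod (z - l) < eps)) as [N HN].
- exists (mkposreal _ He'). intros z Hz. apply C_NormedModule_mixin_compat2 in Hz.
  eapply Rlt_le_trans. exact Hz. simpl. right. field. apply Rgt_not_eq, Rlt_sqrt2_0.
- exists N. exact HN.
Qed.

Lemma is_Cseries_unique (u : nat -> C) (l l' : C) : is_Cseries u l -> is_Cseries u l' -> l = l'.
Proof.
intros H H'. assert (E : (l - l')%C = 0%C).
{ apply Cmod_eq_0, Rle_antisym; [|apply Cmod_ge_0]. apply le_epsilon. intros e He. rewrite Rplus_0_l.
  destruct (is_Cseries_eps_inv u l H (e / 2) ltac:(lra)) as [N1 H1].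
  destruct (is_Cseries_eps_inv u l' H' (e / 2) ltac:(lra)) as [N2 H2].
  specialize (H1 (max N1 N2) ltac:(lia)). specialize (H2 (max N1 N2) ltac:(lia)).
  replace (l - l')%C with (- (Csum_n u (max N1 N2) - l) + (Csum_n u (max N1 N2) - l'))%C by ring.
  eapply Rle_trans. apply Cmod_triangle. rewrite Cmod_opp. lra. }
replace l with (l - l' + l')%C by ring. rewrite E; ring.
Qed.

Lemma CSeries_unique (u : nat -> C) (l : C) : is_Cseries u l -> CSeries u = l.
Proof.
intros H. unfold CSeries. apply (iota_unique (V := C_CompleteNormedModule)).
- intros y Hy. now apply (is_Cseries_unique u y l).
- exact H.
Qed.

Lemma is_Cseries_plus (u v : nat -> C) (l m : C) : is_Cseries u l -> is_Cseries v m -> is_Cseries (fun n => u n + v n)%C (l + m)%C.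
Proof. intros H H'. apply (is_series_plus (V := C_NormedModule) u v l m H H'). Qed.

Lemma is_Cseries_mult (c : C) (u : nat -> C) (l : C) : is_Cseries u l -> is_Cseries (fun n => c * u n)%C (c * l)%C.
Proof. intros H. apply (is_series_scal (V := C_NormedModule) c u l H). Qed.

Lemma is_Cseries_minus (u v : nat -> C) (l m : C) : is_Cseries u l -> is_Cseries v m -> is_Cseries (fun n => u n - v n)%C (l - m)%C.
Proof. intros H H'. apply (is_series_minus (V := C_NormedModule) u v l m H H'). Qed.

Lemma is_Cseries_ext (u v : nat -> C) (l : C) : (forall n, u n = v n) -> is_Cseries u l -> is_Cseries v l.
Proof. intros E. now apply is_series_ext. Qed.

Lemma ex_Cseries_le (u : nat -> C) (b : nat -> R) : (forall n, Cmod (u n) <= b n) -> ex_series b -> ex_Cseries u.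
Proof. intros H Hb. apply (ex_series_le (V := C_CompleteNormedModule) u b); auto. Qed.

Lemma Csum_n_tail (u : nat -> C) (b : nat -> R) N k : (forall n, Cmod (u n) <= b n) ->
  Cmod (Csum_n u (N + k) - Csum_n u N) <= sum_n b (N + k) - sum_n b N.
Proof.
intros H. induction k as [|k IH].
- rewrite Nat.add_0_r. replace (Csum_n u N - Csum_n u N)%C with (RtoC 0) by ring. rewrite Cmod_0. lra.
- rewrite Nat.add_succ_r, !sum_Sn. change (plus (Csum_n u (N + k)) (u (S (N + k)))) with (Csum_n u (N + k) + u (S (N + k)))%C.
  change (plus (sum_n b (N + k)) (b (S (N + k)))) with (sum_n b (N + k) + b (S (N + k))).
  replace (Csum_n u (N + k) + u (S (N + k)) - Csum_n u N)%C with ((Csum_n u (N + k) - Csum_n u N) + u (S (N + k)))%C by ring.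
  eapply Rle_trans. apply Cmod_triangle. specialize (H (S (N + k))). lra.
Qed.

Lemma sum_n_le_series (b : nat -> R) B n : (forall n, 0 <= b n) -> is_series b B -> sum_n b n <= B.
Proof.
intros Hb H. apply (is_lim_seq_le_loc (fun _ => sum_n b n) (sum_n b) (sum_n b n) B).
- exists n. intros m Hm. induction Hm. lra. rewrite sum_Sn. unfold plus; simpl. specialize (Hb (S m)). lra.
- apply is_lim_seq_const.
- exact H.
Qed.

Lemma Cseries_tail (u : nat -> C) (b : nat -> R) (l : C) (B : R) N : (forall n, Cmod (u n) <= b n) ->
  is_Cseries u l -> is_series b B -> Cmod (Csum_n u N - l) <= B - sum_n b N.
Proof.
intros H Hu Hb. apply le_epsilon. intros e He.
destruct (is_Cseries_eps_inv u l Hu e He) as [N1 H1]. specialize (H1 (N + N1)%nat ltac:(lia)).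
pose proof (Csum_n_tail u b N N1 H) as T.
assert (sum_n b (N + N1) <= B).
{ apply sum_n_le_series; auto. intros n. eapply Rle_trans; [apply Cmod_ge_0 | apply H]. }
replace (Csum_n u N - l)%C with (- (Csum_n u (N + N1) - Csum_n u N) + (Csum_n u (N + N1) - l))%C by ring.
eapply Rle_trans. apply Cmod_triangle. rewrite Cmod_opp. lra.
Qed.

Lemma Cseries_bound (u : nat -> C) (b : nat -> R) (l : C) (B : R) : (forall n, Cmod (u n) <= b n) ->
  is_Cseries u l -> is_series b B -> Cmod l <= B.
Proof.
intros H Hu Hb. pose proof (Cseries_tail u b l B 0 H Hu Hb) as T. rewrite !sum_O in T.
replace l with (u O + - (u O - l))%C by ring. eapply Rle_trans. apply Cmod_triangle. rewrite Cmod_opp.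
specialize (H O). lra.
Qed.

Lemma tail_to_0 (b : nat -> R) B : is_series b B -> is_lim_seq (fun N => B - sum_n b N) 0.
Proof.
intros H. replace (Finite 0) with (Rbar_minus B B) by (simpl; f_equal; ring).
apply is_lim_seq_minus'. apply is_lim_seq_const. exact H.
Qed.

Definition abs_term (a : nat -> C) (lam : nat -> R) (sigma : R) (n : nat) : R := Cmod (a n) * Rpower (lam n) (- sigma).

Lemma Cmod_dirichlet_term a lam s n : Cmod (dirichlet_term a lam s n) = abs_term a lam (Re s) n.
Proof. unfold dirichlet_term, abs_term. now rewrite Cmod_mult, Cmod_Rcpow. Qed.

Lemma abs_term_nonneg a lam sigma n : 0 <= abs_term a lam sigma n.
Proof. apply Rmult_le_pos. apply Cmod_ge_0. left; apply exp_pos. Qed.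

Lemma Rpower_ge_1_le x y z : 1 <= x -> y <= z -> Rpower x y <= Rpower x z.
Proof.
intros Hx Hy. unfold Rpower. apply exp_le. apply Rmult_le_compat_r; auto.
rewrite <- ln_1. apply ln_le; lra.
Qed.

(** As an infimum, the abscissa has points of convergence arbitrarily close on its right. Comparison
    with such a point needs [1 <= lam n], so finitely many terms are dropped first. *)
Lemma abs_convergence a lam sigma_a sigma : is_lim_seq lam p_infty -> abscissa_abs a lam = Finite sigma_a ->
  sigma_a < sigma -> ex_series (abs_term a lam sigma).
Proof.
intros Hl Ha Hs.
assert (Hex : exists s', s' < sigma /\ ex_series (fun n => Cmod (dirichlet_term a lam (RtoC s') n))).
{ apply NNPP. intros Hn. unfold abscissa_abs in Ha.
  pose proof (Glb_Rbar_correct (fun sigma => ex_series (fun n => Cmod (dirichlet_term a lam (RtoC sigma) n)))) as [_ G].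
  rewrite Ha in G. specialize (G (Finite sigma)). simpl in G.
  assert (sigma <= sigma_a). { apply G. intros x Hx. simpl. destruct (Rle_or_lt sigma x); auto. exfalso. apply Hn. exists x. auto. }
  lra. }
destruct Hex as [s' [Hs' He]].
apply is_lim_seq_spec in Hl. destruct (Hl 1) as [N HN].
apply (ex_series_incr_n (K := R_AbsRing) (V := R_NormedModule) _ N).
apply (ex_series_incr_n (K := R_AbsRing) (V := R_NormedModule) _ N) in He.
revert He. apply (ex_series_le (K := R_AbsRing) (V := R_CompleteNormedModule)).
intros n. change (norm (abs_term a lam sigma (N + n))) with (Rabs (abs_term a lam sigma (N + n))).
rewrite Rabs_pos_eq by apply abs_term_nonneg. rewrite Cmod_dirichlet_term. unfold abs_term.
apply Rmult_le_compat_l. apply Cmod_ge_0. apply Rpower_ge_1_le. specialize (HN (N + n)%nat ltac:(lia)). simpl in HN. lra.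
simpl. lra.
Qed.

Section Dirichlet.
Variables (a : nat -> C) (lam : nat -> R) (sigma_a : R).
Hypothesis lam_infty : is_lim_seq lam p_infty.
Hypothesis abscissa : abscissa_abs a lam = Finite sigma_a.

Lemma dirichlet_correct s : sigma_a < Re s -> is_Cseries (dirichlet_term a lam s) (dirichlet a lam s).
Proof.
intros Hs. destruct (ex_Cseries_le (dirichlet_term a lam s) (abs_term a lam (Re s))) as [l Hl].
intros n. rewrite Cmod_dirichlet_term. lra. now apply (abs_convergence a lam sigma_a).
unfold dirichlet. now rewrite (CSeries_unique _ l Hl).
Qed.

Lemma dirichlet_bounded x1 x2 : sigma_a < x1 -> exists M, forall s, x1 <= Re s <= x2 -> Cmod (dirichlet a lam s) <= M.
Proof.
intros H1. destruct (Rle_or_lt x1 x2) as [L|L].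
2:{ exists 0. intros s Hs. lra. }
destruct (abs_convergence a lam sigma_a x1 lam_infty abscissa H1) as [B1 HB1].
destruct (abs_convergence a lam sigma_a x2 lam_infty abscissa ltac:(lra)) as [B2 HB2].
exists (B1 + B2). intros s Hs.
apply (Cseries_bound (dirichlet_term a lam s) (fun n => abs_term a lam x1 n + abs_term a lam x2 n)).
- intros n. rewrite Cmod_dirichlet_term. unfold abs_term. rewrite <- Rmult_plus_distr_l.
  apply Rmult_le_compat_l. apply Cmod_ge_0. rewrite Rplus_comm. apply Rpower_between. lra.
- apply dirichlet_correct. lra.
- now apply (is_series_plus (K := R_AbsRing) (V := R_NormedModule)).
Qed.

(** With [y = ln (lam n)], the first power of [y] is for the termwise derivative, and the square
    with the exponential for its remainder. Both are absorbed by moving [Re s] by [2 * eta] to one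
    side or the other. *)
Lemma log_weight_bound eta : 0 < eta -> exists K, 0 <= K /\ forall y z, 0 <= z <= eta ->
  (Rabs y + y ^ 2) * exp (z * Rabs y) <= K * (exp (- (2 * eta * y)) + exp (2 * eta * y)).
Proof.
intros He. set (K := 4 / eta ^ 2 + 4).
assert (Pe : 0 < / eta ^ 2) by (apply Rinv_0_lt_compat, pow_lt; auto).
exists (2 * K). split. unfold K, Rdiv; lra.
intros y z Hz. pose proof (Rabs_pos y) as Py.
assert (B : y ^ 2 <= 4 / eta ^ 2 * exp (eta * Rabs y)).
{ pose proof (one_plus_sq_le_exp (eta * y)) as Q. rewrite Rabs_mult, (Rabs_pos_eq eta) in Q by lra.
  apply Rmult_le_reg_l with (eta ^ 2). apply pow_lt; lra.
  replace (eta ^ 2 * (4 / eta ^ 2 * exp (eta * Rabs y))) with (4 * exp (eta * Rabs y)) by (field; lra).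
  rewrite <- Rpow_mult_distr. lra. }
assert (E1 : 1 <= exp (eta * Rabs y)). { rewrite <- exp_0. apply exp_le. nra. }
assert (B2 : Rabs y <= 1 + y ^ 2) by (rewrite <- pow2_abs; nra).
assert (B3 : Rabs y + y ^ 2 <= 2 * K * exp (eta * Rabs y)). { unfold K. nra. }
assert (E2 : exp (z * Rabs y) <= exp (eta * Rabs y)) by (apply exp_le; nra).
apply Rle_trans with (2 * K * exp (eta * Rabs y) * exp (eta * Rabs y)).
{ pose proof (pow2_ge_0 y). apply Rmult_le_compat; auto. lra. left; apply exp_pos. }
rewrite Rmult_assoc, <- exp_plus. apply Rmult_le_compat_l. unfold K, Rdiv; lra.
pose proof (exp_pos (2 * eta * y)). pose proof (exp_pos (- (2 * eta * y))).
destruct (Rle_or_lt 0 y). rewrite Rabs_pos_eq by auto. replace (eta * y + eta * y) with (2 * eta * y) by ring. lra.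
rewrite Rabs_left by auto. replace (eta * - y + eta * - y) with (- (2 * eta * y)) by ring. lra.
Qed.

Lemma dirichlet_Cd s : sigma_a < Re s -> Cd (dirichlet a lam) s.
Proof.
(* A quarter of the distance keeps [Re s - 2 * eta] to the right of [sigma_a]; the other point
   [Re s + 2 * eta] takes care of the [lam n] below 1. *)
intros Hs. set (eta := (Re s - sigma_a) / 4).
assert (He : 0 < eta) by (unfold eta; lra).
destruct (log_weight_bound eta He) as [K [K0 HK]].
destruct (abs_convergence a lam sigma_a (Re s - 2 * eta) lam_infty abscissa ltac:(unfold eta; lra)) as [B1 HB1].
destruct (abs_convergence a lam sigma_a (Re s + 2 * eta) lam_infty abscissa ltac:(unfold eta; lra)) as [B2 HB2].
set (b := fun n => K * (abs_term a lam (Re s + 2 * eta) n + abs_term a lam (Re s - 2 * eta) n)).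
assert (Hb : is_series b (K * (B2 + B1))).
{ apply (is_series_scal (K := R_AbsRing) (V := R_NormedModule) K).
  now apply (is_series_plus (K := R_AbsRing) (V := R_NormedModule)). }
assert (Hw : forall n z, 0 <= z <= eta -> Cmod (dirichlet_term a lam s n) *
   ((Rabs (ln (lam n)) + ln (lam n) ^ 2) * exp (z * Rabs (ln (lam n)))) <= b n).
{ intros n z Hz. rewrite Cmod_dirichlet_term. unfold b, abs_term. set (y := ln (lam n)).
  replace (K * (Cmod (a n) * Rpower (lam n) (- (Re s + 2 * eta)) + Cmod (a n) * Rpower (lam n) (- (Re s - 2 * eta)))) with
   (Cmod (a n) * Rpower (lam n) (- Re s) * (K * (exp (- (2 * eta * y)) + exp (2 * eta * y)))).
  2:{ unfold Rpower. fold y. replace (- (Re s + 2 * eta) * y) with (- Re s * y + - (2 * eta * y)) by ring.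
      replace (- (Re s - 2 * eta) * y) with (- Re s * y + (2 * eta * y)) by ring. rewrite !exp_plus. ring. }
  apply Rmult_le_compat_l. apply Rmult_le_pos. apply Cmod_ge_0. left; apply exp_pos. now apply HK. }
destruct (ex_Cseries_le (fun n => dirichlet_term a lam s n * - RtoC (ln (lam n)))%C b) as [D1 HD1].
{ intros n. eapply Rle_trans; [|apply (Hw n 0); lra]. rewrite Rmult_0_l, exp_0, Rmult_1_r.
  rewrite Cmod_mult, Cmod_opp, Cmod_R. apply Rmult_le_compat_l. apply Cmod_ge_0.
  pose proof (pow2_ge_0 (ln (lam n))). lra. }
{ eexists; exact Hb. }
set (B := K * (B2 + B1)) in *.
assert (B0 : 0 <= B).
{ apply Rle_trans with (sum_n b 0). rewrite sum_O. unfold b. apply Rmult_le_pos; auto.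
  pose proof (abs_term_nonneg a lam (Re s + 2 * eta) 0). pose proof (abs_term_nonneg a lam (Re s - 2 * eta) 0). lra.
  apply sum_n_le_series; auto. intros n. unfold b. apply Rmult_le_pos; auto.
  pose proof (abs_term_nonneg a lam (Re s + 2 * eta) n). pose proof (abs_term_nonneg a lam (Re s - 2 * eta) n). lra. }
exists D1. intros eps Heps.
exists (Rmin eta (eps / (B + 1))). split. apply Rmin_pos; auto. apply Rdiv_lt_0_compat; lra.
intros h Hh. apply Rmin_Rgt in Hh. destruct Hh as [H1 H2]. pose proof (Cmod_ge_0 h) as Ph.
assert (Hsh : sigma_a < Re (s + h)).
{ pose proof (re_le_Cmod h). pose proof (Rle_abs (- Re h)) as L. rewrite Rabs_Ropp in L.
  change (Re (s + h)) with (Re s + Re h). unfold eta in H1. lra. }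
rewrite (Cmult_comm D1).
assert (Hser : is_Cseries (fun n => dirichlet_term a lam (s + h) n - dirichlet_term a lam s n - h * (dirichlet_term a lam s n * - RtoC (ln (lam n))))%C
  (dirichlet a lam (s + h) - dirichlet a lam s - h * D1)%C).
{ apply is_Cseries_minus. apply is_Cseries_minus; now apply dirichlet_correct. now apply is_Cseries_mult. }
assert (Hb2 : is_series (fun n => Cmod h * Cmod h * b n) (Cmod h * Cmod h * B)).
{ now apply (is_series_scal (K := R_AbsRing) (V := R_NormedModule) (Cmod h * Cmod h)). }
eapply Rle_trans. apply (Cseries_bound _ _ _ _) with (2 := Hser) (3 := Hb2).
- intros n. set (y := ln (lam n)).
  replace (dirichlet_term a lam (s + h) n - dirichlet_term a lam s n - h * (dirichlet_term a lam s n * - RtoC y))%C with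
   (dirichlet_term a lam s n * (Cexp (- h * RtoC y) - 1 - - h * RtoC y))%C.
  2:{ unfold dirichlet_term, Rcpow. fold y. replace (- (s + h) * RtoC y)%C with (- s * RtoC y + - h * RtoC y)%C by ring.
      rewrite Cexp_plus. ring. }
  rewrite Cmod_mult.
  apply Rle_trans with (Cmod (dirichlet_term a lam s n) * (Cmod h * Cmod h * ((Rabs y + y ^ 2) * exp (Cmod h * Rabs y)))).
  + apply Rmult_le_compat_l. apply Cmod_ge_0. eapply Rle_trans. apply Cexp_remainder2.
    rewrite Cmod_mult, Cmod_opp, Cmod_R.
    replace (Cmod h * Rabs y * (Cmod h * Rabs y)) with (Cmod h * Cmod h * Rabs y ^ 2) by ring. rewrite pow2_abs.
    rewrite Rmult_assoc. apply Rmult_le_compat_l. nra. pose proof (Rabs_pos y). pose proof (pow2_ge_0 y).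
    apply Rmult_le_compat; auto. left; apply exp_pos. lra.
    apply exp_le. replace (Re (- h * RtoC y)) with (- Re h * y) by (simpl; unfold Re; ring).
    rewrite Rabs_mult, Rabs_Ropp. apply Rmult_le_compat_r; auto. apply re_le_Cmod.
  + replace (Cmod (dirichlet_term a lam s n) * (Cmod h * Cmod h * ((Rabs y + y ^ 2) * exp (Cmod h * Rabs y)))) with
     (Cmod h * Cmod h * (Cmod (dirichlet_term a lam s n) * ((Rabs y + y ^ 2) * exp (Cmod h * Rabs y)))) by ring.
    apply Rmult_le_compat_l. nra. apply Hw. lra.
- replace (Cmod h * Cmod h * B) with (Cmod h * B * Cmod h) by ring. apply Rmult_le_compat_r; auto.
  apply Rle_trans with (eps / (B + 1) * (B + 1)). 2: right; field; lra. nra.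
Qed.

End Dirichlet.

Lemma gamma_factor_Cd r alpha beta s : (forall i, (i < r)%nat -> not_pole (RtoC (alpha i) * s + beta i)%C) ->
  Cd (gamma_factor r alpha beta) s.
Proof.
intros H. unfold gamma_factor. apply (Cd_Cprod (fun i s => Gamma (RtoC (alpha i) * s + beta i))%C).
intros i Hi. apply (Cd_comp Gamma). apply Cd_plus. apply Cd_mult. apply Cd_const. apply Cd_id. apply Cd_const.
now apply Gamma_Cd, H.
Qed.

Lemma Re_affine_pos (al : R) (be s : C) : 0 < al -> 0 <= Re be -> 0 < Re s -> 0 < Re (RtoC al * s + be).
Proof. intros. simpl. unfold Re in *. nra. Qed.

Lemma gamma_factor_bounded r alpha beta x1 x2 :
  (forall i, (i < r)%nat -> 0 < alpha i) -> (forall i, (i < r)%nat -> 0 <= Re (beta i)) -> 0 < x1 ->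
  exists M, forall s, x1 <= Re s <= x2 -> Cmod (gamma_factor r alpha beta s) <= M.
Proof.
intros Ha Hb H1. induction r as [|r IH].
- exists 1. intros s _. unfold gamma_factor. simpl. rewrite Cmod_1. lra.
- destruct IH as [M HM]. intros; apply Ha; lia. intros; apply Hb; lia.
  pose proof (Ha r (Nat.lt_succ_diag_r r)). pose proof (Hb r (Nat.lt_succ_diag_r r)).
  destruct (GI_bounded (alpha r * x1 + Re (beta r)) (alpha r * x2 + Re (beta r))) as [K [K0 HK]]. nra.
  exists (M * K). intros s Hs. unfold gamma_factor. simpl Cprod. rewrite Cmod_mult.
  apply Rmult_le_compat; try apply Cmod_ge_0. now apply HM.
  rewrite Gamma_GI by (apply Re_affine_pos; auto; lra). apply HK. simpl. unfold Re in *. nra.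
Qed.

(** Replacing [x] by [2 x] and subtracting [2 ^ N] times the original removes the top power and
    multiplies each lower coefficient by the nonzero number [2 ^ k - 2 ^ N], so induction
    applies. *)
Lemma csum_series_coeffs N : forall p : nat -> nat -> C,
  (forall x, 0 < x -> ex_Cseries (fun n => csum (fun k => p n k * RtoC (x ^ k)) N)%C) ->
  forall k, (k < N)%nat -> ex_Cseries (fun n => p n k).
Proof.
induction N as [|N IH]; intros p H k Hk. lia.
assert (Hlow : forall j, (j < N)%nat -> ex_Cseries (fun n => p n j)).
{ intros j Hj.
  assert (Hne : (RtoC (2 ^ j) - RtoC (2 ^ N))%C <> 0%C).
  { intros E. rewrite <- RtoC_minus in E. apply RtoC_inj in E.
    assert (2 ^ j < 2 ^ N) by (apply Rlt_pow; auto; lra). lra. }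
  assert (Hq : ex_Cseries (fun n => p n j * (RtoC (2 ^ j) - RtoC (2 ^ N)))%C).
  { apply (IH (fun n k => p n k * (RtoC (2 ^ k) - RtoC (2 ^ N)))%C); auto.
    intros x Hx. destruct (H x Hx) as [l1 Hl1]. destruct (H (2 * x) ltac:(lra)) as [l2 Hl2].
    exists (l2 - RtoC (2 ^ N) * l1)%C.
    apply (is_Cseries_ext (fun n => csum (fun k => p n k * RtoC ((2 * x) ^ k)) (S N) - RtoC (2 ^ N) * csum (fun k => p n k * RtoC (x ^ k)) (S N))%C).
    - intros n. simpl csum. rewrite Rpow_mult_distr, RtoC_mult.
      transitivity (csum (fun k => p n k * RtoC ((2 * x) ^ k)) N - RtoC (2 ^ N) * csum (fun k => p n k * RtoC (x ^ k)) N)%C. ring.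
      generalize (RtoC (2 ^ N)) as d. intros d. clear. induction N as [|N IH]; simpl csum. ring.
      rewrite Rpow_mult_distr, RtoC_mult.
      transitivity ((csum (fun k => p n k * RtoC ((2 * x) ^ k)) N - d * csum (fun k => p n k * RtoC (x ^ k)) N) + p n N * (RtoC (2 ^ N) - d) * RtoC (x ^ N))%C. ring.
      rewrite IH. ring.
    - apply is_Cseries_minus; auto. now apply is_Cseries_mult. }
  destruct Hq as [l Hl]. exists (/ (RtoC (2 ^ j) - RtoC (2 ^ N)) * l)%C.
  apply (is_Cseries_ext (fun n => / (RtoC (2 ^ j) - RtoC (2 ^ N)) * (p n j * (RtoC (2 ^ j) - RtoC (2 ^ N))))%C).
  intros n. field; auto. now apply is_Cseries_mult. }
destruct (Nat.eq_dec k N) as [->|]. 2: apply Hlow; lia.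
(* The top coefficient is what remains at [x = 1] once the lower ones are known to give a convergent
   series. *)
assert (Hc : ex_Cseries (fun n => csum (fun k => p n k * RtoC (1 ^ k)) N)%C).
{ clear -Hlow. induction N as [|N IH]; simpl csum.
  - exists (0 * 0)%C. apply (is_Cseries_ext (fun n => 0 * 0)%C). intros; ring.
    apply is_series_C_eps. intros eps He. exists O. intros n _.
    replace (Csum_n (fun _ => 0 * 0)%C n) with (0 * 0)%C. replace (0 * 0 - 0 * 0)%C with (RtoC 0) by ring. now rewrite Cmod_0.
    induction n as [|n IHn]. now rewrite sum_O. rewrite sum_Sn, <- IHn. unfold plus; simpl. change ((0 * 0)%C = (0 * 0 + 0 * 0)%C). ring.
  - destruct IH as [l1 H1]. intros; apply Hlow; lia. destruct (Hlow N (Nat.lt_succ_diag_r N)) as [l2 H2].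
    exists (l1 + RtoC (1 ^ N) * l2)%C.
    apply (is_Cseries_ext (fun n => csum (fun k => p n k * RtoC (1 ^ k)) N + RtoC (1 ^ N) * p n N)%C). intros; ring.
    apply is_Cseries_plus; auto. now apply is_Cseries_mult. }
destruct Hc as [l1 H1]. destruct (H 1 Rlt_0_1) as [l2 H2]. exists (l2 - l1)%C.
apply (is_Cseries_ext (fun n => csum (fun k => p n k * RtoC (1 ^ k)) (S N) - csum (fun k => p n k * RtoC (1 ^ k)) N)%C).
- intros n. simpl csum. rewrite pow1. ring.
- now apply is_Cseries_minus.
Qed.

(** * Conjugation, and the exterior of a square *)

Lemma Cconj_Cexp z : Cconj (Cexp z) = Cexp (Cconj z).
Proof.
destruct z as [x y]. unfold Cexp, Cconj; simpl. rewrite cos_neg, sin_neg.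
apply injective_projections; simpl; ring.
Qed.

Lemma Cconj_RtoC x : Cconj (RtoC x) = RtoC x.
Proof. apply injective_projections; simpl; ring. Qed.

Lemma Cconj_Rcpow x z : Cconj (Rcpow x z) = Rcpow x (Cconj z).
Proof. unfold Rcpow. now rewrite Cconj_Cexp, Cmult_conj, Cconj_RtoC. Qed.

Lemma Cconj_inv z : Cconj (/ z) = (/ Cconj z)%C.
Proof.
destruct z as [x y]. unfold Cconj, Cinv; simpl.
replace (- y * (- y * 1)) with (y * (y * 1)) by ring. apply injective_projections; simpl; unfold Rdiv; ring.
Qed.

Lemma Cconj_Cprod f n : Cconj (Cprod f n) = Cprod (fun k => Cconj (f k)) n.
Proof. induction n as [|n IH]; simpl. apply Cconj_RtoC. now rewrite Cmult_conj, IH. Qed.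

Lemma CRInt_conj f a b : cont_on f a b -> CRInt (fun t => Cconj (f t)) a b = Cconj (CRInt f a b).
Proof.
intros H. apply CRInt_unique. pose proof (CRInt_correct f a b H) as I.
apply (is_RInt_fct_extend_pair (U := R_NormedModule) (V := R_NormedModule)).
- apply (is_RInt_fct_extend_fst (U := R_NormedModule) (V := R_NormedModule) f a b _ I).
- apply (is_RInt_opp (V := R_NormedModule)).
  apply (is_RInt_fct_extend_snd (U := R_NormedModule) (V := R_NormedModule) f a b _ I).
Qed.

Lemma LInt_conj f : decays f -> LInt (fun t => Cconj (f t)) = Cconj (LInt f).
Proof.
intros H. apply LInt_lim.
- destruct H as [M [H1 H2]]. exists M. split.
  + intros t. apply continuous_Cmod_eps. intros eps He.
    destruct (continuous_eps_Cmod f t (H1 t) eps He) as [d [Hd Hy]]. exists d. split; auto.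
    intros y Y. rewrite <- Cminus_conj, Cmod_conj. auto.
  + intros t. rewrite Cmod_conj. auto.
- intros eps He. destruct (LInt_approx_eps f eps H He) as [T0 [_ HT]]. exists T0. intros T L.
  rewrite CRInt_conj, <- Cminus_conj, Cmod_conj. auto. destruct H as [M [H1 _]]. now apply cont_on_all.
Qed.

Lemma GI_conj s : 0 < Re s -> GI (Cconj s) = Cconj (GI s).
Proof.
intros Hs. unfold GI. rewrite <- LInt_conj by now apply gamma_kernel_decays.
apply LInt_ext. intros x. unfold gamma_kernel. now rewrite Cconj_Cexp, Cminus_conj, Cmult_conj, !Cconj_RtoC.
Qed.

(** No pole has to be excluded: the shift [n] depends on [Re s] only, and [Cconj_inv] holds at 0 as
    well. *)
Lemma Gamma_conj s : Gamma (Cconj s) = Cconj (Gamma s).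
Proof.
unfold Gamma. rewrite re_conj. set (n := Z.to_nat (up (- Re s))).
assert (Hn : 0 < Re s + INR n).
{ destruct (archimed (- Re s)) as [A1 A2]. unfold n. rewrite INR_IZR_INZ. destruct (Z_le_gt_dec 0 (up (- Re s))) as [L|L].
  rewrite Z2Nat.id by auto. lra.
  assert (IZR (up (- Re s)) <= -1) by (apply IZR_le; lia).
  assert (0 <= IZR (Z.of_nat (Z.to_nat (up (- Re s))))) by (apply IZR_le; lia). lra. }
unfold Cdiv. rewrite Cmult_conj, Cconj_inv, Cconj_Cprod.
assert (P : 0 < Re (s + RtoC (INR n))) by (change (Re (s + RtoC (INR n))) with (Re s + INR n); lra).
f_equal.
- rewrite (Gamma_Euler_GI (s + RtoC (INR n))), <- GI_conj by auto. rewrite Cplus_conj, Cconj_RtoC.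
  apply Gamma_Euler_GI. exact P.
- do 2 f_equal. apply functional_extensionality. intros k. now rewrite Cplus_conj, Cconj_RtoC.
Qed.

Lemma gamma_factor_conj r alpha beta s :
  Cconj (gamma_factor r alpha beta (Cconj s)) = gamma_factor r alpha (fun i => Cconj (beta i)) s.
Proof.
unfold gamma_factor. rewrite Cconj_Cprod. f_equal. apply functional_extensionality. intros i.
rewrite <- Gamma_conj. f_equal. now rewrite Cplus_conj, Cmult_conj, Cconj_RtoC, Cconj_conj.
Qed.

Lemma is_Cseries_conj (u : nat -> C) (l : C) : is_Cseries u l -> is_Cseries (fun n => Cconj (u n)) (Cconj l).
Proof.
intros H. apply is_series_C_eps. intros eps He.
destruct (is_Cseries_eps_inv u l H eps He) as [N HN]. exists N. intros n Hn. specialize (HN n Hn).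
replace (Csum_n (fun n => Cconj (u n)) n) with (Cconj (Csum_n u n)). now rewrite <- Cminus_conj, Cmod_conj.
clear. induction n as [|n IH]. now rewrite !sum_O. rewrite !sum_Sn, <- IH. apply Cplus_conj.
Qed.

Lemma abscissa_conj b mu : abscissa_abs (fun n => Cconj (b n)) mu = abscissa_abs b mu.
Proof.
unfold abscissa_abs. f_equal. apply functional_extensionality. intros s. f_equal.
apply functional_extensionality. intros n. rewrite !Cmod_dirichlet_term. unfold abs_term. now rewrite Cmod_conj.
Qed.

Lemma dirichlet_conj b mu sigma_b s : is_lim_seq mu p_infty -> abscissa_abs b mu = Finite sigma_b -> sigma_b < Re s ->
  Cconj (dirichlet b mu (Cconj s)) = dirichlet (fun n => Cconj (b n)) mu s.
Proof.
intros Hm Hb Hs. symmetry. apply CSeries_unique.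
apply (is_Cseries_ext (fun n => Cconj (dirichlet_term b mu (Cconj s) n))).
- intros n. unfold dirichlet_term. rewrite Cmult_conj, Cconj_Rcpow. do 2 f_equal. now rewrite <- Copp_conj, Cconj_conj.
- apply is_Cseries_conj. now apply (dirichlet_correct b mu sigma_b).
Qed.

(** A square is preferred to a disc because its complement is a union of four half-planes and its
    compactness is that of a product of intervals. *)
Definition square (T : R) (z : C) : Prop := Rabs (Re z) <= T /\ Rabs (Im z) <= T.

Lemma Ccompact_bounded K : Ccompact K -> exists R, forall z, K z -> Cmod z < R.
Proof.
intros H. destruct (H (fun U => exists n : nat, U = fun z => Cmod z < INR n)) as [l [Hl1 Hl2]].
- intros U [n ->]. intros z Hz.
  exists (mkposreal _ (Rdiv_lt_0_compat _ _ (proj2 (Rlt_0_minus _ _) Hz) Rlt_sqrt2_0)).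
  intros w Hw. apply C_NormedModule_mixin_compat2 in Hw. simpl in Hw.
  replace (sqrt 2 * ((INR n - Cmod z) / sqrt 2)) with (INR n - Cmod z) in Hw by (field; apply Rgt_not_eq, Rlt_sqrt2_0).
  change (Cmod (w - z) < INR n - Cmod z) in Hw.
  replace w with ((w - z) + z)%C by ring. eapply Rle_lt_trans. apply Cmod_triangle. lra.
- intros z Hz. destruct (nat_above (Cmod z)) as [n Hn]. exists (fun z => Cmod z < INR n). split; auto. now exists n.
- assert (Hb : exists R, forall U, List.In U l -> forall z, U z -> Cmod z < R).
  { clear Hl2. induction l as [|U l IH].
    - exists 0. intros U [].
    - destruct IH as [R HR]. intros V HV; apply Hl1; now right.
      destruct (Hl1 U (or_introl eq_refl)) as [n ->]. exists (Rmax R (INR n)).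
      intros V [<-|HV] z Hz. eapply Rlt_le_trans. exact Hz. apply Rmax_r.
      eapply Rlt_le_trans. apply (HR V HV z Hz). apply Rmax_l. }
  destruct Hb as [R HR]. exists R. intros z Hz. destruct (Hl2 z Hz) as [U [HU Uz]]. now apply (HR U).
Qed.

Lemma square_compact T : Ccompact (square T).
Proof.
intros fam Hopen Hcov.
(* Elements of [Compactness.Tn 2 R] are pairs closed off by [tt]. The radius comes from a member of
   [fam] that is open around the point; off the square any radius will do. *)
assert (Hd : forall p : Compactness.Tn 2 R, exists d : posreal, square T (fst p, fst (snd p)) ->
   exists U, fam U /\ forall x y, Rabs (x - fst p) < d -> Rabs (y - fst (snd p)) < d -> U (x, y)).
{ intros [x [y []]]. simpl. destruct (classic (square T (x, y))) as [Hs|Hn].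
  - destruct (Hcov _ Hs) as [U [HU Uz]]. destruct (Hopen U HU _ Uz) as [d Hd]. exists d. intros _. exists U. split; auto.
    intros x' y' X Y. apply Hd. split; simpl; auto.
  - exists (mkposreal 1 Rlt_0_1). intros; easy. }
destruct (functional_choice _ _ _ Hd) as [delta Hdel].
pose proof (compactness_list 2 (- T, (- T, tt)) (T, (T, tt)) delta) as HC.
apply NNPP in HC. destruct HC as [l Hl].
assert (Hsel : exists l' : list (C -> Prop), (forall U, List.In U l' -> fam U) /\
  forall p, List.In p l -> square T (fst p, fst (snd p)) -> exists U, List.In U l' /\
   forall x y, Rabs (x - fst p) < delta p -> Rabs (y - fst (snd p)) < delta p -> U (x, y)).
{ clear Hl. induction l as [|p l IH].
  - exists nil. split; intros ? [].
  - destruct IH as [l' [H1 H2]]. destruct (classic (square T (fst p, fst (snd p)))) as [Hs|Hn].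
    + destruct (Hdel p Hs) as [U [HU HUp]]. exists (U :: l')%list. split.
      intros V [<-|HV]; auto. intros q [<-|Hq] Hsq. exists U. split; auto. now left.
      destruct (H2 q Hq Hsq) as [V [V1 V2]]. exists V. split; auto. now right.
    + exists l'. split; auto. intros q [<-|Hq] Hsq. easy. now apply H2. }
destruct Hsel as [l' [H1 H2]]. exists l'. split; auto.
intros [x y] [X Y]. simpl in X, Y.
assert (B : Compactness.bounded_n 2 (- T, (- T, tt)) (T, (T, tt)) (x, (y, tt))).
{ simpl. apply Rabs_le_between in X. apply Rabs_le_between in Y. tauto. }
destruct (Hl _ B) as [[u [v []]] [T1 [T2 T3]]]. simpl in T2, T3.
destruct (H2 _ T1) as [U [HU HUp]].
{ split; simpl; apply Rabs_le_between; tauto. }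
exists U. split; auto. simpl in HUp. apply HUp; tauto.
Qed.

Lemma square_complement_open T : open (fun z : C => ~ square T z).
Proof.
intros z Hz.
assert (E : exists d, 0 < d /\ (T + d < Rabs (Re z) \/ T + d < Rabs (Im z))).
{ destruct (Rlt_or_le T (Rabs (Re z))) as [L|L].
  - exists ((Rabs (Re z) - T) / 2). split. lra. left. lra.
  - destruct (Rlt_or_le T (Rabs (Im z))) as [L'|L']. exists ((Rabs (Im z) - T) / 2). split. lra. right. lra.
    exfalso. apply Hz. split; auto. }
destruct E as [d [Hd E]]. exists (mkposreal d Hd). intros w [W1 W2] [S1 S2].
change (Rabs (fst w - fst z) < d) in W1. change (Rabs (snd w - snd z) < d) in W2.
unfold Re, Im in *.
pose proof (Rabs_triang_inv (fst z) (fst w)). pose proof (Rabs_triang_inv (snd z) (snd w)).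
rewrite Rabs_minus_sym in W1, W2. destruct E; lra.
Qed.

Definition Cconvex (P : C -> Prop) : Prop := forall z w t, P z -> P w -> 0 <= t <= 1 -> P (z + RtoC t * (w - z))%C.

(** Take the supremum of the times at which the segment from [z] to [w] is in [U]. Whether its point
    lies in [U] or in [V], openness of that set contradicts the choice of the supremum unless the
    two sets meet. *)
Lemma convex_meets P (U V : C -> Prop) : Cconvex P -> open U -> open V -> (forall z, P z -> U z \/ V z) ->
  (exists z, P z /\ U z) -> (exists z, P z /\ V z) -> exists z, P z /\ U z /\ V z.
Proof.
intros HP HU HV Hc [z [Pz Uz]] [w [Pw Vw]].
apply NNPP. intros Hn.
set (g := fun t => (z + RtoC t * (w - z))%C).
assert (Hseg : forall t, 0 <= t <= 1 -> P (g t)) by (intros; now apply HP).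
assert (Hgc : forall t, continuous (U := C_UniformSpace) g t).
{ intros t. apply continuous_Cplus. apply continuous_Cconst.
  apply (continuous_ext (T := R_UniformSpace) (U := C_UniformSpace) (fun t => (w - z) * RtoC t)%C (fun t => RtoC t * (w - z))%C).
  intros; apply Cmult_comm. apply continuous_Cmult_const.
  apply continuous_C_pair. apply continuous_id. apply continuous_const. }
destruct (completeness (fun t => 0 <= t <= 1 /\ U (g t))) as [m [M1 M2]].
- exists 1. intros t [Ht _]. lra.
- exists 0. split. lra. unfold g. replace (z + 0 * (w - z))%C with z by ring. auto.
- assert (Hm : 0 <= m <= 1).
  { split. apply M1. split. lra. unfold g. replace (z + 0 * (w - z))%C with z by ring. auto.
    apply M2. intros t [Ht _]. lra. }
  destruct (Hc _ (Hseg m Hm)) as [Um|Vm].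
  + destruct (Hgc m _ (HU _ Um)) as [d Hd].
    assert (m < 1).
    { destruct (proj2 Hm) as [|E]; auto. exfalso. apply Hn. exists (g m). repeat split; auto.
      rewrite E. unfold g. replace (z + 1 * (w - z))%C with w by ring. auto. }
    set (t := Rmin 1 (m + d / 2)). pose proof (cond_pos d).
    assert (Ht : m < t) by (apply Rmin_glb_lt; lra). assert (t <= 1) by apply Rmin_l. assert (t <= m + d / 2) by apply Rmin_r.
    assert (t <= m). { apply M1. split. lra. apply Hd. change (Rabs (t - m) < d). rewrite Rabs_pos_eq; lra. }
    lra.
  + destruct (Hgc m _ (HV _ Vm)) as [d Hd]. pose proof (cond_pos d).
    assert (m <= m - d / 2).
    { apply M2. intros t [Ht Ut]. destruct (Rle_or_lt t (m - d / 2)) as [|L]; auto. exfalso.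
      apply Hn. exists (g t). repeat split; auto. apply Hd. change (Rabs (t - m) < d).
      assert (t <= m) by (apply M1; auto). apply Rabs_def1; lra. }
    lra.
Qed.

Lemma convex_Re_gt T : Cconvex (fun z => T < Re z).
Proof.
intros z w t Hz Hw Ht. replace (Re (z + RtoC t * (w - z))) with (Re z + t * (Re w - Re z)) by (simpl; unfold Re; ring).
destruct (Req_dec t 1) as [->|]; nra.
Qed.
Lemma convex_Re_lt T : Cconvex (fun z => Re z < T).
Proof.
intros z w t Hz Hw Ht. replace (Re (z + RtoC t * (w - z))) with (Re z + t * (Re w - Re z)) by (simpl; unfold Re; ring).
destruct (Req_dec t 1) as [->|]; nra.
Qed.
Lemma convex_Im_gt T : Cconvex (fun z => T < Im z).
Proof.
intros z w t Hz Hw Ht. replace (Im (z + RtoC t * (w - z))) with (Im z + t * (Im w - Im z)) by (simpl; unfold Im; ring).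
destruct (Req_dec t 1) as [->|]; nra.
Qed.
Lemma convex_Im_lt T : Cconvex (fun z => Im z < T).
Proof.
intros z w t Hz Hw Ht. replace (Im (z + RtoC t * (w - z))) with (Im z + t * (Im w - Im z)) by (simpl; unfold Im; ring).
destruct (Req_dec t 1) as [->|]; nra.
Qed.

(* The complement of the square is a cycle of four overlapping half planes. *)
Lemma square_complement_connected T : 0 < T -> Cconnected (fun z => ~ square T z).
Proof.
intros HT U V HU HV Hc [z [Dz Uz]] [w [Dw Vw]]. apply NNPP. intros Hn.
assert (Hpiece : forall P : C -> Prop, Cconvex P -> (forall z, P z -> ~ square T z) ->
   (exists z, P z /\ U z) -> (exists z, P z /\ V z) -> False).
{ intros P HP HPD E1 E2. destruct (convex_meets P U V HP HU HV) as [p [Pp [Up Vp]]]; auto.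
  apply Hn. exists p. auto. }
assert (D1 : forall z, T < Re z -> ~ square T z).
{ intros p Hp [S1 _]. pose proof (Rle_abs (Re p)). lra. }
assert (D2 : forall z, T < Im z -> ~ square T z).
{ intros p Hp [_ S1]. pose proof (Rle_abs (Im p)). lra. }
assert (D3 : forall z, Re z < - T -> ~ square T z).
{ intros p Hp [S1 _]. pose proof (Rle_abs (- Re p)). rewrite Rabs_Ropp in *. lra. }
assert (D4 : forall z, Im z < - T -> ~ square T z).
{ intros p Hp [_ S1]. pose proof (Rle_abs (- Im p)). rewrite Rabs_Ropp in *. lra. }
pose proof (Hpiece _ (convex_Re_gt T) D1) as P1. pose proof (Hpiece _ (convex_Im_gt T) D2) as P2.
pose proof (Hpiece _ (convex_Re_lt (- T)) D3) as P3. pose proof (Hpiece _ (convex_Im_lt (- T)) D4) as P4.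
assert (Q : forall p, ~ square T p -> T < Re p \/ T < Im p \/ Re p < - T \/ Im p < - T).
{ intros p Hp. destruct (Rlt_or_le T (Re p)); auto. destruct (Rlt_or_le T (Im p)); auto.
  destruct (Rlt_or_le (Re p) (- T)); auto. destruct (Rlt_or_le (Im p) (- T)); auto.
  exfalso. apply Hp. split; apply Rabs_le; lra. }
set (p1 := (2 * T, 2 * T) : C). set (p2 := (- (2 * T), 2 * T) : C). set (p3 := (- (2 * T), - (2 * T)) : C).
assert (X1 : T < Re p1) by (simpl; lra). assert (X2 : T < Im p1) by (simpl; lra).
assert (Y1 : Re p2 < - T) by (simpl; lra). assert (Y2 : T < Im p2) by (simpl; lra).
assert (Z1 : Re p3 < - T) by (simpl; lra). assert (Z2 : Im p3 < - T) by (simpl; lra).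
(* Membership in [A] spreads from the corner point [p1] to [p2] and [p3], and every point outside
   the square shares a half-plane with one of the three. The form with [A] and [B] allows [U] and
   [V] to be interchanged. *)
assert (Key : forall A B : C -> Prop, (forall z, ~ square T z -> A z \/ B z) ->
  (forall P : C -> Prop, P = (fun z => T < Re z) \/ P = (fun z => T < Im z) \/ P = (fun z => Re z < - T) \/ P = (fun z => Im z < - T) ->
     forall z w, P z -> A z -> P w -> B w -> False) ->
  A p1 -> forall w, ~ square T w -> B w -> False).
{ intros A B HAB HP A1 q Dq Bq.
  assert (A2 : A p2).
  { destruct (HAB p2 (D3 _ Y1)) as [|B2]; auto. exfalso. apply (HP (fun z => T < Im z) ltac:(auto) p1 p2); auto. }
  assert (A3 : A p3).
  { destruct (HAB p3 (D3 _ Z1)) as [|B3]; auto. exfalso. apply (HP (fun z => Re z < - T) ltac:(auto) p2 p3); auto. }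
  destruct (Q q Dq) as [Hq|[Hq|[Hq|Hq]]].
  - apply (HP (fun z => T < Re z) ltac:(auto) p1 q); auto.
  - apply (HP (fun z => T < Im z) ltac:(auto) p1 q); auto.
  - apply (HP (fun z => Re z < - T) ltac:(auto) p2 q); auto.
  - apply (HP (fun z => Im z < - T) ltac:(auto) p3 q); auto. }
assert (PU : forall P : C -> Prop, P = (fun z => T < Re z) \/ P = (fun z => T < Im z) \/ P = (fun z => Re z < - T) \/ P = (fun z => Im z < - T) ->
     forall z w, P z -> U z -> P w -> V w -> False).
{ intros P HP a b Pa Ua Pb Vb. destruct HP as [->|[->|[->| ->]]].
  - apply P1; [exists a | exists b]; auto.
  - apply P2; [exists a | exists b]; auto.
  - apply P3; [exists a | exists b]; auto.
  - apply P4; [exists a | exists b]; auto. }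
destruct (Hc p1 (D1 _ X1)) as [C1|C1].
- apply (Key U V Hc PU C1 w Dw Vw).
- apply (Key V U) with (w := z); auto.
  intros q Hq; destruct (Hc q Hq); auto.
  intros P HP a b Pa Va Pb Ub. apply (PU P HP b a); auto.
Qed.

(** * Residues and analytic continuation along horizontal lines *)

Lemma Csum_n_mult (c : C) (f : nat -> C) N : Csum_n (fun n => c * f n)%C N = (c * Csum_n f N)%C.
Proof.
induction N as [|N IH]. now rewrite !sum_O. rewrite !sum_Sn, IH.
change ((c * Csum_n f N + c * f (S N))%C = (c * (Csum_n f N + f (S N)))%C). ring.
Qed.

Lemma dirichlet_term_Cd a lam n s : Cd (fun s => dirichlet_term a lam s n) s.
Proof. apply Cd_mult. apply Cd_const. apply Cd_Rcpow_opp. Qed.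

(** The path [xi] is only required to have constant real part, which covers both [w] and
    [delta - w]. The error of the partial sums is uniform in [t] because the terms are bounded by
    [abs_term] at [sigma]. *)
Lemma line_series a lam sigma_a (u xi : R -> C) sigma :
  is_lim_seq lam p_infty -> abscissa_abs a lam = Finite sigma_a -> sigma_a < sigma ->
  decays4 u -> (forall t, continuous (U := C_UniformSpace) xi t) -> (forall t, Re (xi t) = sigma) ->
  is_Cseries (fun n => LInt (fun t => u t * dirichlet_term a lam (xi t) n)%C)
    (LInt (fun t => u t * dirichlet a lam (xi t))%C).
Proof.
intros Hl Ha Hs Hu Hxi Hre.
destruct (abs_convergence a lam sigma_a sigma Hl Ha Hs) as [B HB].
pose proof Hu as [Hc [M [M0 HM]]].
assert (Hb : forall t n, Cmod (dirichlet_term a lam (xi t) n) <= abs_term a lam sigma n).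
{ intros t n. rewrite Cmod_dirichlet_term, Hre. lra. }
assert (Hd : forall t, is_Cseries (dirichlet_term a lam (xi t)) (dirichlet a lam (xi t))).
{ intros t. apply (dirichlet_correct a lam sigma_a); auto. now rewrite Hre. }
apply (LInt_series _ _ (fun N => M * (B - sum_n (abs_term a lam sigma) N))).
- intros n. apply decays4_decays. apply (decays4_mult_bounded u (fun t => dirichlet_term a lam (xi t) n) (abs_term a lam sigma n)); auto.
  intros t. apply (Ccont_path (fun s => dirichlet_term a lam s n) xi); auto. apply Cd_Ccont, dirichlet_term_Cd.
- apply decays4_decays. apply (decays4_mult_bounded u (fun t => dirichlet a lam (xi t)) B); auto.
  + intros t. apply (Ccont_path (dirichlet a lam) xi); auto. apply Cd_Ccont, (dirichlet_Cd a lam sigma_a); auto. now rewrite Hre.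
  + intros t. apply (Cseries_bound (dirichlet_term a lam (xi t)) (abs_term a lam sigma)); auto.
- replace (Finite 0) with (Rbar_mult M 0) by (simpl; f_equal; ring).
  apply is_lim_seq_scal_l. now apply tail_to_0.
- intros N t. rewrite Csum_n_mult.
  replace (u t * Csum_n (dirichlet_term a lam (xi t)) N - u t * dirichlet a lam (xi t))%C with
   (u t * (Csum_n (dirichlet_term a lam (xi t)) N - dirichlet a lam (xi t)))%C by ring.
  rewrite Cmod_mult. pose proof (one_plus_sq t).
  replace (M * (B - sum_n (abs_term a lam sigma) N) / (1 + t ^ 2)) with (M / (1 + t ^ 2) * (B - sum_n (abs_term a lam sigma) N)) by (unfold Rdiv; ring).
  apply Rmult_le_compat; try apply Cmod_ge_0.
  + eapply Rle_trans. apply HM. apply Rdiv_le_den; auto. pose proof (pow2_ge_0 t). nra.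
  + apply Cseries_tail; auto.
Qed.

(** Normalises the starting line. For [d > 0] it can be moved left to some [theta] in (0,1); for
    [d <= 0] take as [theta] the distance from [d] to the next pole on its left, and the strip
    degenerates to one line. From then on each shift by 1 crosses one pole. *)
Lemma pole_free_gap d : (forall k : nat, d <> - INR k) -> exists theta m0, 0 < theta < 1 /\
  - INR m0 + theta <= d /\ forall x t, - INR m0 + theta <= x <= d -> not_pole (x, t).
Proof.
intros H. destruct (Rlt_or_le 0 d) as [L|L].
- exists (Rmin d (1 / 2)), O. pose proof (Rmin_l d (1 / 2)). pose proof (Rmin_r d (1 / 2)).
  assert (0 < Rmin d (1 / 2)) by (apply Rmin_pos; lra). simpl INR. repeat split; try lra.
  intros x t X. apply not_pole_pos. simpl; lra.
- destruct (nfloor_ex (- d)) as [n [N1 N2]]; [lra|].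
  assert (INR n <> - d) by (intros E; apply (H n); lra).
  exists (d + INR n + 1), (S n). rewrite S_INR. repeat split; try lra.
  intros x t X k. apply line_neq_nat. simpl. replace x with d by lra. apply H.
Qed.

Lemma csum_0 (f : nat -> C) N : (forall k, (k < N)%nat -> f k = 0%C) -> csum f N = 0%C.
Proof. induction N as [|N IH]; intros H; simpl; auto. rewrite IH, H; auto. ring. Qed.

(** Passing from the line [- N + theta] to [- (N + 1) + theta] crosses the single pole [- N] of
    [Gamma], and its residue contributes a multiple of [x ^ N]. In the base case no pole is met. *)
Lemma poly_shift d theta m0 (v : C -> C) N : 0 < theta < 1 -> - INR m0 + theta <= d ->
  (forall x t, - INR m0 + theta <= x <= d -> not_pole (x, t)) -> (m0 <= N)%nat ->
  (forall w, Re w <= d -> Cd v w) ->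
  (forall x1, exists K, forall w, x1 <= Re w <= d -> Cmod (v w) <= K) ->
  exists p : nat -> C, forall x, 0 < x ->
    inv_mellin d (fun w => Gamma w * v w)%C x =
    (inv_mellin (- INR N + theta) (fun w => Gamma w * v w) x + csum (fun k => p k * RtoC (x ^ k)) N)%C.
Proof.
intros Ht Hd Hp HN Hv Hb. induction HN as [|N HN IH].
- exists (fun _ => 0%C). intros x Hx. rewrite csum_0 by (intros; ring).
  rewrite Cplus_0_r. symmetry. apply inv_mellin_shift; auto.
  destruct (Hb (- INR m0 + theta)) as [K HK].
  apply (strip_ok_mult Gamma v _ _ K).
  + now apply Gamma_strip_ok.
  + intros; apply Hv; simpl; lra.
  + intros; apply HK; simpl; lra.
- destruct IH as [p IH].
  assert (HNd : - INR N + theta <= d) by (apply le_INR in HN; lra).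
  pose (V := fun w => (Gamma_reg N w * v w)%C).
  exists (fun k => if Nat.eq_dec k N then V (RtoC (- INR N)) else p k). intros x Hx.
  rewrite IH by auto. simpl csum. destruct (Nat.eq_dec N N) as [_|]; [|easy].
  rewrite (csum_ext (fun k => (if Nat.eq_dec k N then V (RtoC (- INR N)) else p k) * RtoC (x ^ k))%C (fun k => p k * RtoC (x ^ k))%C N).
  2:{ intros k Hk. destruct (Nat.eq_dec k N); auto. lia. }
  rewrite S_INR.
  rewrite (inv_mellin_residue (fun w => Gamma w * v w)%C V (RtoC (- INR N)) (- (INR N + 1) + theta) (- INR N + theta) x).
  + replace (Rcpow x (- RtoC (- INR N))) with (RtoC (x ^ N)). ring.
    rewrite <- Rpower_pow, <- Rcpow_real by auto. f_equal. rewrite RtoC_opp. ring.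
  + simpl. lra.
  + destruct (Hb (- (INR N + 1) + theta)) as [K HK].
    apply (strip_ok_mult (Gamma_reg N) v _ _ K).
    * apply Gamma_reg_strip_ok. rewrite S_INR. lra. lra.
    * intros; apply Hv; simpl; lra.
    * intros; apply HK; simpl; lra.
  + intros w Hw. unfold V. rewrite (Gamma_reg_eq N).
    * replace (w - RtoC (- INR N))%C with (w + RtoC (INR N))%C by (rewrite RtoC_opp; ring). unfold Cdiv. ring.
    * rewrite S_INR. lra.
    * intros j Hj. apply line_neq_nat. destruct (Nat.eq_dec j N) as [->|].
      destruct Hw; lra. assert (j < N)%nat by lia. apply lt_INR in H as HjN.
      assert (INR j + 1 <= INR N) by (rewrite <- S_INR; apply le_INR; lia). destruct Hw; lra.
Qed.

Lemma region_identity (h : C -> C) x1 x2 u1 u2 T0 : x1 <= u1 -> u1 < u2 -> u2 <= x2 ->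
  (forall s, x1 < Re s < x2 -> T0 < Rabs (Im s) -> Cd h s) ->
  (forall s, u1 < Re s < u2 -> T0 < Rabs (Im s) -> h s = 0%C) ->
  forall s, x1 < Re s < x2 -> T0 < Rabs (Im s) -> h s = 0%C.
Proof.
intros H1 H12 H2 Hd H0 [x y] Hx Hy. simpl in Hx, Hy.
set (m := (u1 + u2) / 2). set (lo := Rmin x m). set (hi := Rmax x m).
(* Half of the smallest margin around the horizontal segment from [m] to [x] at height [y]: closed
   squares of half side [L] centred on it stay in the region. *)
set (L := Rmin (Rmin (lo - x1) (x2 - hi)) (Rabs y - T0) / 2).
assert (Hlo : x1 < lo) by (apply Rmin_glb_lt; unfold m; lra).
assert (Hhi : hi < x2) by (apply Rmax_lub_lt; unfold m; lra).
pose proof (Rmin_l x m). pose proof (Rmin_r x m). pose proof (Rmax_l x m). pose proof (Rmax_r x m).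
fold lo in H, H3. fold hi in H4, H5.
assert (HL : 0 < L). { unfold L. assert (0 < Rmin (Rmin (lo - x1) (x2 - hi)) (Rabs y - T0)) by (repeat apply Rmin_pos; lra). lra. }
assert (L1 : L < lo - x1 /\ L < x2 - hi /\ L < Rabs y - T0).
{ pose proof (Rmin_l (Rmin (lo - x1) (x2 - hi)) (Rabs y - T0)). pose proof (Rmin_r (Rmin (lo - x1) (x2 - hi)) (Rabs y - T0)).
  pose proof (Rmin_l (lo - x1) (x2 - hi)). pose proof (Rmin_r (lo - x1) (x2 - hi)). unfold L in *. lra. }
(* The number of steps: the centres advance from [m] to [x] by equal steps [d] of modulus below
   [L]. *)
destruct (nat_above (Rabs (x - m) / L)) as [n Hn].
assert (Hn0 : 0 < INR n). { eapply Rle_lt_trans; [|exact Hn]. apply Rmult_le_pos. apply Rabs_pos. left; now apply Rinv_0_lt_compat. }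
set (d := RtoC ((x - m) / INR n)).
assert (Hdn : Cmod d < L).
{ unfold d. rewrite Cmod_R. unfold Rdiv. rewrite Rabs_mult, (Rabs_pos_eq (/ INR n)) by (left; now apply Rinv_0_lt_compat).
  apply Rmult_lt_reg_r with (INR n); auto. rewrite Rmult_assoc, Rinv_l, Rmult_1_r by lra.
  apply Rmult_lt_compat_r with (r := L) in Hn; auto. unfold Rdiv in Hn. rewrite Rmult_assoc, Rinv_l, Rmult_1_r in Hn; lra. }
assert (Him : forall y', Rabs (y' - y) <= L -> T0 < Rabs y').
{ intros y' Hy'. pose proof (Rabs_triang_inv y y') as Q. rewrite Rabs_minus_sym in Hy'. lra. }
apply (identity_chain h (m, y) d L (Rmin L ((u2 - u1) / 2)) n); auto.
- apply Rmin_pos; lra.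
- intros k x' y' Hk X Y.
  assert (E1 : fst ((m, y) + INR k * d)%C = m + INR k / INR n * (x - m)) by (unfold d; simpl; field; lra).
  assert (E2 : snd ((m, y) + INR k * d)%C = y) by (unfold d; simpl; ring).
  rewrite E1 in X. rewrite E2 in Y.
  assert (Hkn : 0 <= INR k / INR n <= 1).
  { split. apply Rmult_le_pos. apply pos_INR. left; now apply Rinv_0_lt_compat.
    apply le_INR in Hk. apply Rmult_le_reg_r with (INR n); auto. unfold Rdiv. rewrite Rmult_assoc, Rinv_l; lra. }
  apply Hd; simpl; auto.
  set (q := INR k / INR n) in *. apply Rabs_le_between in X.
  assert (lo <= m + q * (x - m) <= hi).
  { split. replace (m + q * (x - m)) with ((1 - q) * m + q * x) by ring. nra.
    replace (m + q * (x - m)) with ((1 - q) * m + q * x) by ring. nra. }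
  lra.
- intros w Hw. apply Rmin_Rgt in Hw. destruct Hw as [W1 W2].
  pose proof (re_le_Cmod (w - (m, y))) as R1. pose proof (Rabs_Im_le_Cmod (w - (m, y))) as R2.
  apply H0.
  + assert (Rabs (Re w - m) < (u2 - u1) / 2).
    { eapply Rle_lt_trans; [|exact W2]. exact R1. }
    apply Rabs_def2 in H6. unfold m in H6. lra.
  + apply Him. eapply Rle_trans; [exact R2|]. lra.
- replace ((x, y) - ((m, y) + INR n * d))%C with (RtoC 0). rewrite Cmod_0; auto.
  unfold d. apply injective_projections; simpl; field; lra.
Qed.

(** * The modular relation *)

Lemma csum_series (p : nat -> nat -> C) (P : nat -> C) x N : (0 < N)%nat ->
  (forall k, (k < N)%nat -> is_Cseries (fun n => p n k) (P k)) ->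
  is_Cseries (fun n => csum (fun k => p n k * RtoC (x ^ k)) N)%C (csum (fun k => P k * RtoC (x ^ k)) N)%C.
Proof.
intros HN H. destruct N as [|N]. lia. clear HN. induction N as [|N IH].
- cbn [csum]. apply (is_Cseries_ext (fun n => RtoC (x ^ 0) * p n O)%C). intros; ring.
  replace (0 + P O * RtoC (x ^ 0))%C with (RtoC (x ^ 0) * P O)%C by ring. apply is_Cseries_mult. apply H; lia.
- replace (csum (fun k => P k * RtoC (x ^ k)) (S (S N)))%C with
   (csum (fun k => P k * RtoC (x ^ k)) (S N) + RtoC (x ^ S N) * P (S N))%C by (cbn [csum]; ring).
  apply (is_Cseries_ext (fun n => csum (fun k => p n k * RtoC (x ^ k)) (S N) + RtoC (x ^ S N) * p n (S N))%C).
  intros; cbn [csum]; ring. apply is_Cseries_plus. apply IH. intros; apply H; lia. apply is_Cseries_mult. apply H; lia.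
Qed.

Lemma strip_ok_line u a : strip_ok u a a -> decays4 (fun t => u (a, t)).
Proof. intros H. apply (strip_line u a a a H). lra. Qed.

Section Main.
Variables (lam mu : nat -> R) (a b : nat -> C) (sigma_a sigma_b : R)
  (r : nat) (alpha : nat -> R) (beta : nat -> C)
  (Q delta : R) (omega : C) (P1 : R -> C) (c : R).
Hypothesis lam_pos : forall n, 0 < lam n.
Hypothesis mu_pos : forall n, 0 < mu n.
Hypothesis lam_infty : is_lim_seq lam p_infty.
Hypothesis mu_infty : is_lim_seq mu p_infty.
Hypothesis abscissa_a : abscissa_abs a lam = Finite sigma_a.
Hypothesis abscissa_b : abscissa_abs b mu = Finite sigma_b.
Hypothesis alpha_pos : forall i, (i < r)%nat -> 0 < alpha i.
Hypothesis beta_nonneg : forall i, (i < r)%nat -> 0 <= Re (beta i).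
Hypothesis Q_pos : 0 < Q.
Hypothesis omega_unit : Cmod omega = 1.
Hypothesis c_pos : 0 < c.
Hypothesis c_regular : forall k : nat, c <> delta + INR k.

Let bb n := Cconj (b n).
Let bbeta i := Cconj (beta i).
Let gf := gamma_factor r alpha beta.
Let gfb := gamma_factor r alpha bbeta.
(** [right_side] and [left_side] are named after the half-planes in which their Dirichlet series
    converge. The exponent [delta - w - w] below is what Q^(delta - w) becomes after division by
    Q^w. *)
Definition right_side (w : C) : C := (gf w * dirichlet a lam w)%C.
Definition left_kernel (w : C) : C := (omega * Rcpow Q (RtoC delta - w - w) * gfb (RtoC delta - w))%C.
Definition left_side (w : C) : C := (left_kernel w * dirichlet bb mu (RtoC delta - w))%C.

Lemma bbeta_nonneg i : (i < r)%nat -> 0 <= Re (bbeta i).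
Proof. intros H. unfold bbeta. rewrite re_conj. auto. Qed.

Lemma gf_Cd w : 0 < Re w -> Cd gf w.
Proof. intros H. apply gamma_factor_Cd. intros i Hi. apply not_pole_pos, Re_affine_pos; auto. Qed.

Lemma gfb_Cd w : 0 < Re w -> Cd gfb w.
Proof. intros H. apply gamma_factor_Cd. intros i Hi. apply not_pole_pos, Re_affine_pos; auto. now apply bbeta_nonneg. Qed.

Lemma Re_delta_minus w : Re (RtoC delta - w) = delta - Re w.
Proof. simpl. unfold Re. ring. Qed.

Lemma Cd_delta_minus w : Cd (fun w => RtoC delta - w)%C w.
Proof. apply Cd_minus. apply Cd_const. apply Cd_id. Qed.

Lemma left_kernel_Cd w : Cd gfb (RtoC delta - w)%C -> Cd left_kernel w.
Proof.
intros H. apply Cd_mult. apply Cd_mult. apply Cd_const. apply Cd_Rcpow. apply Cd_minus. apply Cd_delta_minus. apply Cd_id.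
apply (Cd_comp gfb); auto. apply Cd_delta_minus.
Qed.

Lemma left_kernel_bounded x1 x2 : x2 < delta -> exists K, forall w, x1 <= Re w <= x2 -> Cmod (left_kernel w) <= K.
Proof.
intros H. destruct (gamma_factor_bounded r alpha bbeta (delta - x2) (delta - x1) alpha_pos bbeta_nonneg) as [K HK]. lra.
exists ((Rpower Q (delta - x2 - x2) + Rpower Q (delta - x1 - x1)) * K). intros w Hw.
unfold left_kernel. rewrite !Cmod_mult, omega_unit, Rmult_1_l, Cmod_Rcpow.
apply Rmult_le_compat; try apply Cmod_ge_0. left; apply exp_pos.
apply Rpower_between. simpl. unfold Re in *. lra. apply HK. rewrite Re_delta_minus. lra.
Qed.

Lemma gamma_gf_strip x1 x2 : 0 < x1 -> strip_ok (fun w => Gamma w * gf w)%C x1 x2.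
Proof.
intros H. destruct (gamma_factor_bounded r alpha beta x1 x2 alpha_pos beta_nonneg H) as [K HK].
apply (strip_ok_mult Gamma gf _ _ K).
- apply Gamma_strip_ok. intros x t X. apply not_pole_pos. simpl; lra.
- intros x t X. apply gf_Cd. simpl; lra.
- intros x t X _. apply HK. simpl; lra.
Qed.

Lemma right_strip x1 x2 : 0 < x1 -> sigma_a < x1 -> strip_ok (fun w => Gamma w * right_side w)%C x1 x2.
Proof.
intros H1 H2. destruct (dirichlet_bounded a lam sigma_a lam_infty abscissa_a x1 x2 H2) as [K HK].
apply (strip_ok_ext (fun w => Gamma w * gf w * dirichlet a lam w)%C). intros; unfold right_side; ring.
apply (strip_ok_mult _ (dirichlet a lam) _ _ K).
- now apply gamma_gf_strip.
- intros x t X. apply (dirichlet_Cd a lam sigma_a); auto. simpl; lra.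
- intros x t X _. apply HK. simpl; lra.
Qed.

Lemma left_kernel_strip x1 x2 : x2 < delta -> (forall x t, x1 <= x <= x2 -> not_pole (x, t)) ->
  strip_ok (fun w => Gamma w * left_kernel w)%C x1 x2.
Proof.
intros H Hp. destruct (left_kernel_bounded x1 x2 H) as [K HK].
apply (strip_ok_mult Gamma left_kernel _ _ K).
- now apply Gamma_strip_ok.
- intros x t X. apply left_kernel_Cd, gfb_Cd. rewrite Re_delta_minus. simpl; lra.
- intros x t X _. apply HK. simpl; lra.
Qed.

Lemma abscissa_bb : abscissa_abs bb mu = Finite sigma_b.
Proof. unfold bb. now rewrite abscissa_conj. Qed.

Lemma left_strip x1 x2 : x2 < delta -> x2 < delta - sigma_b -> (forall x t, x1 <= x <= x2 -> not_pole (x, t)) ->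
  strip_ok (fun w => Gamma w * left_side w)%C x1 x2.
Proof.
intros H1 H2 Hp. destruct (dirichlet_bounded bb mu sigma_b mu_infty abscissa_bb (delta - x2) (delta - x1)) as [K HK]. lra.
apply (strip_ok_ext (fun w => Gamma w * left_kernel w * dirichlet bb mu (RtoC delta - w))%C). intros; unfold left_side; ring.
apply (strip_ok_mult _ (fun w => dirichlet bb mu (RtoC delta - w))%C _ _ K).
- now apply left_kernel_strip.
- intros x t X. apply (Cd_comp (dirichlet bb mu)). apply Cd_delta_minus.
  apply (dirichlet_Cd bb mu sigma_b mu_infty abscissa_bb). rewrite Re_delta_minus. simpl; lra.
- intros x t X _. apply HK. rewrite Re_delta_minus. simpl; lra.
Qed.

(** Since [c > 0], no pole lies to the right of the line [c], and the line can be moved to where the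
    Dirichlet series converges absolutely. *)
Lemma Yfun_inv_mellin a1 x : c <= a1 -> Yfun r alpha beta c x = inv_mellin a1 (fun w => Gamma w * gf w)%C x.
Proof.
intros Ha. pose proof (gamma_gf_strip c a1 c_pos) as H.
rewrite <- (inv_mellin_shift _ c a1 x Ha H). unfold Yfun.
rewrite vertical_integral_LInt. reflexivity.
apply decays4_decays.
exact (strip_line (fun s => Gamma s * gf s * Rcpow x (- s))%C c a1 c (strip_ok_Rcpow _ c a1 x H) (conj (Rle_refl c) Ha)).
Qed.

Lemma right_series a1 x : c <= a1 -> sigma_a < a1 -> 0 < x ->
  is_Cseries (fun n => a n * Yfun r alpha beta c (lam n * x))%C (inv_mellin a1 (fun w => Gamma w * right_side w)%C x).
Proof.
intros Ha Hs Hx.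
assert (H : strip_ok (fun w => Gamma w * gf w)%C a1 a1) by (apply gamma_gf_strip; lra).
pose proof (strip_ok_line _ _ (strip_ok_Rcpow _ _ _ x H)) as Hu. cbv beta in Hu.
pose proof (line_series a lam sigma_a _ (fun t => (a1, t)) a1 lam_infty abscissa_a Hs Hu (continuous_vert a1) (fun t => eq_refl)) as L.
apply (is_Cseries_mult (/ RtoC (2 * PI))%C) in L.
replace (inv_mellin a1 (fun w => Gamma w * right_side w)%C x) with
 (/ RtoC (2 * PI) * LInt (fun t => Gamma (a1, t) * gf (a1, t) * Rcpow x (- (a1, t)) * dirichlet a lam (a1, t)))%C.
2:{ unfold inv_mellin. f_equal. apply LInt_ext. intros t. unfold right_side. ring. }
revert L. apply is_Cseries_ext. intros n.
rewrite (Yfun_inv_mellin a1) by auto. unfold inv_mellin.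
pose proof (decays4_decays _ (strip_ok_line _ _ (strip_ok_Rcpow _ _ _ (lam n * x) H))) as Hn. cbv beta in Hn.
transitivity (/ RtoC (2 * PI) * (a n * LInt (fun t => Gamma (a1, t) * gf (a1, t) * Rcpow (lam n * x) (- (a1, t)))))%C.
2: ring.
rewrite <- (LInt_Cmult _ _ Hn). f_equal. apply LInt_ext. intros t.
rewrite Rcpow_mult by auto. unfold dirichlet_term. ring.
Qed.

Definition left_term (n : nat) (w : C) : C := (left_kernel w * dirichlet_term bb mu (RtoC delta - w) n)%C.

(** Comparison of exponents: [- delta + (delta - w) = - w] for [x] and
    [- delta + 2 (delta - w) = delta - 2 w] for [Q]. *)
Lemma power_identity x m w : 0 < x -> 0 < m ->
  (/ RtoC (Rpower (x * Q) delta) * Rcpow (m / (Q ^ 2 * x)) (- (RtoC delta - w)))%C =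
  (Rcpow Q (RtoC delta - w - w) * Rcpow m (- (RtoC delta - w)) * Rcpow x (- w))%C.
Proof.
intros Hx Hm. rewrite <- Rcpow_real, <- Rcpow_opp.
unfold Rcpow. rewrite <- !Cexp_plus. f_equal.
assert (0 < Q ^ 2) by (apply pow_lt; auto).
unfold Rdiv. rewrite (ln_mult m), ln_Rinv, !ln_mult, ln_pow; auto.
2: now apply Rmult_lt_0_compat. 2: apply Rinv_0_lt_compat; now apply Rmult_lt_0_compat.
rewrite !RtoC_plus, RtoC_opp, !RtoC_plus, RtoC_mult.
replace (RtoC (INR 2)) with (1 + 1)%C by (rewrite <- RtoC_plus; f_equal; simpl; ring). ring.
Qed.

Lemma left_line_decays d x : d < delta -> (forall t, not_pole (d, t)) ->
  decays4 (fun t => Gamma (d, t) * left_kernel (d, t) * Rcpow x (- (d, t)))%C.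
Proof.
intros Hd Hp. apply (strip_ok_line (fun w => Gamma w * left_kernel w * Rcpow x (- w))%C).
apply strip_ok_Rcpow, left_kernel_strip; auto. intros y t Y. replace y with d by lra. auto.
Qed.

Lemma d_not_pole t : not_pole (delta - c, t).
Proof. intros k. apply line_neq_nat. simpl. intros E. apply (c_regular k). lra. Qed.

(** The substitution [w = delta - s] turns [Gamma (delta - s)] into [Gamma w] and the line [c] into
    [delta - c], traversed downwards; [LInt_reflect] restores the direction. By [c_regular] the new
    line avoids the poles. *)
Lemma Xfun_inv_mellin n x : 0 < x ->
  (omega / RtoC (Rpower (x * Q) delta) * (bb n * Xfun delta r alpha bbeta c (mu n / (Q ^ 2 * x))))%C =
  inv_mellin (delta - c) (fun w => Gamma w * left_term n w)%C x.
Proof.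
intros Hx. set (d := delta - c). set (y := mu n / (Q ^ 2 * x)).
set (F := fun t : R => (Gamma (d, t) * gfb (RtoC delta - (d, t)) * Rcpow y (- (RtoC delta - (d, t))))%C).
assert (DF : decays F).
{ apply decays4_decays. unfold F.
  apply (strip_ok_line (fun w => Gamma w * gfb (RtoC delta - w) * Rcpow y (- (RtoC delta - w)))%C).
  destruct (gamma_factor_bounded r alpha bbeta c c alpha_pos bbeta_nonneg c_pos) as [K HK].
  apply (strip_ok_mult (fun w => Gamma w * gfb (RtoC delta - w))%C (fun w => Rcpow y (- (RtoC delta - w)))%C d d (Rpower y (- c))).
  apply (strip_ok_mult Gamma (fun w => gfb (RtoC delta - w))%C d d K).
  - apply Gamma_strip_ok. intros z t Z. replace z with d by lra. apply d_not_pole.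
  - intros z t Z. apply (Cd_comp gfb). apply Cd_delta_minus. apply gfb_Cd. rewrite Re_delta_minus. simpl. unfold d in Z. lra.
  - intros z t Z _. apply HK. rewrite Re_delta_minus. simpl. unfold d in Z. lra.
  - intros. apply Cd_Rcpow, Cd_opp, Cd_delta_minus.
  - intros z t Z _. rewrite Cmod_Rcpow. right. f_equal. simpl. unfold d in Z. lra. }
assert (EX : Xfun delta r alpha bbeta c y = (/ RtoC (2 * PI) * LInt F)%C).
{ assert (EF : forall t, (Gamma (RtoC delta - (c, t)) * gfb (c, t) * Rcpow y (- (c, t)))%C = F (- t)).
  { intros t. unfold F.
    replace (RtoC delta - (d, (- t)%R))%C with ((c, t) : C) by (unfold d; apply injective_projections; simpl; ring).
    do 3 f_equal. unfold d; apply injective_projections; simpl; ring. }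
  unfold Xfun. rewrite vertical_integral_LInt.
  - f_equal. rewrite <- (LInt_reflect F DF). apply LInt_ext. intros t. apply EF.
  - apply (decays_ext (fun t => F (- t))). intros t. symmetry. apply EF. now apply decays_reflect. }
rewrite EX. unfold inv_mellin.
transitivity (/ RtoC (2 * PI) * ((omega / RtoC (Rpower (x * Q) delta) * bb n) * LInt F))%C. unfold Cdiv; ring.
rewrite <- (LInt_Cmult _ _ DF). f_equal. apply LInt_ext. intros t. unfold F, left_term, left_kernel, dirichlet_term.
transitivity (omega * bb n * Gamma (d, t) * gfb (RtoC delta - (d, t)) * (/ RtoC (Rpower (x * Q) delta) * Rcpow y (- (RtoC delta - (d, t)))))%C.
unfold Cdiv; ring. unfold y. rewrite power_identity by auto. ring.
Qed.

(** On this line [delta - w] has real part above [sigma_b], so the conjugated Dirichlet series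
    converges absolutely and may be summed under the integral sign. *)
Lemma left_series L x : L < delta -> L < delta - sigma_b -> (forall t, not_pole (L, t)) -> 0 < x ->
  is_Cseries (fun n => inv_mellin L (fun w => Gamma w * left_term n w)%C x) (inv_mellin L (fun w => Gamma w * left_side w)%C x).
Proof.
intros H1 H2 Hp Hx.
pose proof (left_line_decays L x H1 Hp) as Hu.
assert (Hxi : forall t, continuous (U := C_UniformSpace) (fun t : R => (RtoC delta - (L, t))%C) t).
{ intros t. apply continuous_Cminus. apply continuous_Cconst. apply continuous_vert. }
pose proof (line_series bb mu sigma_b _ (fun t => (RtoC delta - (L, t))%C) (delta - L) mu_infty abscissa_bb ltac:(lra) Hu Hxi
  (fun t => Re_delta_minus (L, t))) as E.
apply (is_Cseries_mult (/ RtoC (2 * PI))%C) in E.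
replace (inv_mellin L (fun w => Gamma w * left_side w)%C x) with
 (/ RtoC (2 * PI) * LInt (fun t => Gamma (L, t) * left_kernel (L, t) * Rcpow x (- (L, t)) * dirichlet bb mu (RtoC delta - (L, t))))%C.
2:{ unfold inv_mellin. f_equal. apply LInt_ext. intros t. unfold left_side. ring. }
revert E. apply is_Cseries_ext. intros n. unfold inv_mellin. f_equal. apply LInt_ext. intros t. unfold left_term. ring.
Qed.

Lemma left_poly theta m0 N : 0 < theta < 1 -> - INR m0 + theta <= delta - c ->
  (forall x t, - INR m0 + theta <= x <= delta - c -> not_pole (x, t)) -> (m0 <= N)%nat ->
  exists p : nat -> nat -> C, forall n x, 0 < x ->
    inv_mellin (delta - c) (fun w => Gamma w * left_term n w)%C x =
    (inv_mellin (- INR N + theta) (fun w => Gamma w * left_term n w) x + csum (fun k => p n k * RtoC (x ^ k)) N)%C.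
Proof.
intros Ht Hd Hp HN.
apply (functional_choice _ _ (fun n (p : nat -> C) => forall x, 0 < x ->
    inv_mellin (delta - c) (fun w => Gamma w * left_term n w)%C x =
    (inv_mellin (- INR N + theta) (fun w => Gamma w * left_term n w) x + csum (fun k => p k * RtoC (x ^ k)) N)%C)).
intros n. apply (poly_shift (delta - c) theta m0 (left_term n) N); auto.
- intros w Hw. apply Cd_mult. apply left_kernel_Cd, gfb_Cd. rewrite Re_delta_minus; lra.
  apply (Cd_comp (fun s => dirichlet_term bb mu s n)). apply Cd_delta_minus. apply dirichlet_term_Cd.
- intros x1. destruct (left_kernel_bounded x1 (delta - c)) as [K HK]. lra.
  exists (K * (Cmod (bb n) * (Rpower (mu n) (x1 - delta) + Rpower (mu n) (- c)))). intros w Hw.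
  unfold left_term. rewrite Cmod_mult. apply Rmult_le_compat; try apply Cmod_ge_0. now apply HK.
  rewrite Cmod_dirichlet_term. unfold abs_term. apply Rmult_le_compat_l. apply Cmod_ge_0.
  apply Rpower_between. rewrite Re_delta_minus. lra.
Qed.

Hypothesis modular_relation : forall x : R, 0 < x ->
     exists S T : C,
       is_Cseries (fun n => a n * Yfun r alpha beta c (lam n * x))%C S /\
       is_Cseries
         (fun n => bb n * Xfun delta r alpha bbeta c (mu n / (Q ^ 2 * x)))%C T /\
       S = (P1 x + omega / RtoC (Rpower (x * Q) delta) * T)%C.

Lemma mellin_identity : exists theta N0, 0 < theta < 1 /\ forall N, (N0 <= N)%nat ->
  - INR N + theta < delta - sigma_b -> - INR N + theta < delta ->
  exists P : nat -> C, forall x a1, 0 < x -> c <= a1 -> sigma_a < a1 ->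
    inv_mellin a1 (fun w => Gamma w * right_side w)%C x =
    (P1 x + csum (fun k => P k * RtoC (x ^ k)) N + inv_mellin (- INR N + theta) (fun w => Gamma w * left_side w) x)%C.
Proof.
destruct (pole_free_gap (delta - c)) as [theta [m0 [Ht [Hm Hp]]]].
{ intros k E. apply (c_regular k). lra. }
(* [S m0] instead of [m0] makes [N] positive, as [csum_series] requires. *)
exists theta, (S m0). split; auto. intros N HN HL1 HL2.
destruct (left_poly theta m0 N Ht Hm Hp ltac:(lia)) as [p Hpol].
set (L := - INR N + theta) in *.
assert (HLp : forall t, not_pole (L, t)).
{ intros t k. apply line_neq_nat. simpl. unfold L. intros E.
  assert (E' : INR N - 1 < INR k < INR N) by lra. destruct E' as [E1 E2]. apply INR_lt in E2.
  assert (INR k + 1 <= INR N) by (rewrite <- S_INR; apply le_INR; lia). lra. }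
(* Subtracting the shifted integrals, whose series converges by [left_series], from the given
   X-series leaves a convergent series of polynomials. *)
assert (Hser : forall x, 0 < x -> forall S T, is_Cseries (fun n => a n * Yfun r alpha beta c (lam n * x))%C S ->
   is_Cseries (fun n => bb n * Xfun delta r alpha bbeta c (mu n / (Q ^ 2 * x)))%C T ->
   is_Cseries (fun n => csum (fun k => p n k * RtoC (x ^ k)) N)%C
     (omega / RtoC (Rpower (x * Q) delta) * T - inv_mellin L (fun w => Gamma w * left_side w) x)%C).
{ intros x Hx S T _ HT. apply (is_Cseries_mult (omega / RtoC (Rpower (x * Q) delta))%C) in HT.
  pose proof (is_Cseries_minus _ _ _ _ HT (left_series L x HL2 HL1 HLp Hx)) as E. revert E. apply is_Cseries_ext.
  intros n. rewrite Xfun_inv_mellin, Hpol by auto. ring. }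
assert (Hco : forall k, (k < N)%nat -> ex_Cseries (fun n => p n k)).
{ apply csum_series_coeffs. intros x Hx. destruct (modular_relation x Hx) as [S [T [H1 [H2 _]]]]. eexists. now apply (Hser x Hx S T). }
(* Only the coefficients below [N] are constrained; 0 is the default for the others. *)
destruct (functional_choice _ _ (fun (k : nat) (l : C) => (k < N)%nat -> is_Cseries (fun n => p n k) l)) as [P HP].
{ intros k. destruct (classic (k < N)%nat) as [Hk|Hk]. destruct (Hco k Hk) as [l Hl]. now exists l. exists (RtoC 0). easy. }
exists P. intros x a1 Hx Ha1 Ha2. destruct (modular_relation x Hx) as [S [T [H1 [H2 H3]]]].
pose proof (is_Cseries_unique _ _ _ H1 (right_series a1 x Ha1 Ha2 Hx)) as E1.
pose proof (is_Cseries_unique _ _ _ (Hser x Hx S T H1 H2) (csum_series p P x N ltac:(lia) HP)) as E2.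
rewrite <- E1, H3, <- E2. ring.
Qed.

(** * Comparison of the two half-planes and the continuation *)

Lemma completed_eq s : completed r alpha beta a lam s = right_side s.
Proof. unfold completed, right_side. fold gf. ring. Qed.

(** The restriction comes from [dirichlet_conj]: conjugation is passed through the series where it
    converges, and [CSeries] is unspecified elsewhere. *)
Lemma functional_side_eq s : Re s < delta - sigma_b ->
  (omega * Rcpow Q (RtoC delta - s) * Cconj (completed r alpha beta b mu (RtoC delta - Cconj s)))%C =
  (Rcpow Q s * left_side s)%C.
Proof.
intros Hs. replace (RtoC delta - Cconj s)%C with (Cconj (RtoC delta - s)) by (rewrite Cminus_conj, Cconj_RtoC; ring).
unfold completed. rewrite Cmult_conj, gamma_factor_conj, (dirichlet_conj b mu sigma_b); auto.
2: rewrite Re_delta_minus; lra.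
unfold left_side, left_kernel.
replace (Rcpow Q (RtoC delta - s)) with (Rcpow Q s * Rcpow Q (RtoC delta - s - s))%C by (rewrite <- Rcpow_plus; f_equal; ring).
unfold gfb, bbeta, bb. ring.
Qed.

(** The transform of [P1] over (0,1) is read off from the modular relation as a difference of three
    transforms that are known explicitly. *)
Lemma residual_mellin_zero (f g h : R -> C) l m n s :
  (forall x, 0 < x -> f x = (P1 x + g x + h x)%C) ->
  is_RInt_gen (V := C_R_NormedModule) (fun x => f x * Rcpow x (s - 1))%C (at_right 0) (at_point 1) l ->
  is_RInt_gen (V := C_R_NormedModule) (fun x => g x * Rcpow x (s - 1))%C (at_right 0) (at_point 1) m ->
  is_RInt_gen (V := C_R_NormedModule) (fun x => h x * Rcpow x (s - 1))%C (at_right 0) (at_point 1) n ->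
  CInt (fun x => P1 x * Rcpow x (s - 1))%C (at_right 0) (at_point 1) = (l - m - n)%C.
Proof.
intros E Hf Hg Hh. apply CInt_unique; try typeclasses eauto.
pose proof (is_RInt_gen_minus (V := C_R_NormedModule) _ _ _ _ (is_RInt_gen_minus (V := C_R_NormedModule) _ _ _ _ Hf Hg) Hh) as I.
revert I. apply is_RInt_gen_ext.
apply Filter_prod with (fun x => 0 < x) (fun x => x = 1).
- exists (mkposreal 1 Rlt_0_1). intros y _ Hy. exact Hy.
- reflexivity.
- intros x y Hx -> z Hz. simpl in Hz. assert (Z : 0 < z). { eapply Rlt_trans; [|apply Hz]. apply Rmin_glb_lt; lra. }
  change ((f z * Rcpow z (s - 1) - g z * Rcpow z (s - 1) - h z * Rcpow z (s - 1))%C = (P1 z * Rcpow z (s - 1))%C).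
  rewrite E by auto. ring.
Qed.

Lemma residual_mellin_infty (f g h : R -> C) l m n s :
  (forall x, 0 < x -> f x = (P1 x + g x + h x)%C) ->
  is_RInt_gen (V := C_R_NormedModule) (fun x => f x * Rcpow x (s - 1))%C (at_point 1) (Rbar_locally p_infty) l ->
  is_RInt_gen (V := C_R_NormedModule) (fun x => g x * Rcpow x (s - 1))%C (at_point 1) (Rbar_locally p_infty) m ->
  is_RInt_gen (V := C_R_NormedModule) (fun x => h x * Rcpow x (s - 1))%C (at_point 1) (Rbar_locally p_infty) n ->
  CInt (fun x => P1 x * Rcpow x (s - 1))%C (at_point 1) (Rbar_locally p_infty) = (l - m - n)%C.
Proof.
intros E Hf Hg Hh. apply CInt_unique; try typeclasses eauto.
pose proof (is_RInt_gen_minus (V := C_R_NormedModule) _ _ _ _ (is_RInt_gen_minus (V := C_R_NormedModule) _ _ _ _ Hf Hg) Hh) as I.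
revert I. apply is_RInt_gen_ext.
apply Filter_prod with (fun x => x = 1) (fun x => 0 < x).
- reflexivity.
- exists 0. auto.
- intros x y -> Hy z Hz. simpl in Hz. assert (Z : 0 < z). { eapply Rlt_trans; [|apply Hz]. apply Rmin_glb_lt; lra. }
  change ((f z * Rcpow z (s - 1) - g z * Rcpow z (s - 1) - h z * Rcpow z (s - 1))%C = (P1 z * Rcpow z (s - 1))%C).
  rewrite E by auto. ring.
Qed.

Let U (w : C) : C := (Gamma w * right_side w)%C.
Let W (w : C) : C := (Gamma w * left_side w)%C.

(** Write [U s] as the difference of its Cauchy integrals over [a2] and [a1]. The one over [a1] is
    minus the transform over (0,1) of the line integral on [a1], which the modular relation replaces
    by the terms of [P1], the polynomial and [W]. *)
Lemma right_equation P N L a1 a2 s :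
  (forall x, 0 < x -> inv_mellin a1 U x = (P1 x + csum (fun k => P k * RtoC (x ^ k)) N + inv_mellin L W x)%C) ->
  0 < a1 -> sigma_a < a1 -> a1 < Re s < a2 -> L < Re s -> decays4 (fun t => W (L, t)) ->
  U s = (cauchy_line a2 U s - cauchy_line L W s + CInt (fun x => P1 x * Rcpow x (s - 1)) (at_right 0) (at_point 1)
     + csum (fun k => P k / (s + RtoC (INR k))) N)%C.
Proof.
intros Hid H1 H2 Hs HL HW.
assert (HU : strip_ok U a1 a2) by (apply right_strip; auto).
assert (Ha : decays4 (fun t => U (a1, t))) by (apply (strip_line U a1 a2); auto; lra).
rewrite <- (cauchy_line_strip U a1 a2 s) at 1; auto.
rewrite (residual_mellin_zero _ _ _ _ _ _ s Hid (mellin_zero a1 U s Ha (proj1 Hs)) (mellin_csum_zero P N s ltac:(lra)) (mellin_zero L W s HW HL)).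
ring.
Qed.

(** The mirror image on (1,oo): the Cauchy integral over [L2] is the transform of the line integral
    of [W], moved from [L] to [L2]. The signs of the half transforms turn, and the Cauchy integrals
    over [a2] and [L] appear exactly as in [right_equation]. *)
Lemma left_equation P N L L2 a2 s :
  (forall x, 0 < x -> inv_mellin a2 U x = (P1 x + csum (fun k => P k * RtoC (x ^ k)) N + inv_mellin L W x)%C) ->
  decays4 (fun t => U (a2, t)) -> strip_ok W L L2 -> L < Re s < L2 -> Re s < a2 -> Re s < 0 -> Re s < 1 - INR N ->
  W s = (cauchy_line a2 U s - cauchy_line L W s + - CInt (fun x => P1 x * Rcpow x (s - 1)) (at_point 1) (Rbar_locally p_infty)
     + csum (fun k => P k / (s + RtoC (INR k))) N)%C.
Proof.
intros Hid HU HW Hs Ha H0 HN.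
assert (HL2 : decays4 (fun t => W (L2, t))) by (apply (strip_line W L L2); auto; lra).
rewrite <- (cauchy_line_strip W L L2 s) at 1; auto.
assert (Hid' : forall x, 0 < x -> inv_mellin a2 U x = (P1 x + csum (fun k => P k * RtoC (x ^ k)) N + inv_mellin L2 W x)%C).
{ intros x Hx. rewrite Hid by auto. now rewrite (inv_mellin_shift W L L2 x ltac:(lra) HW). }
rewrite (residual_mellin_infty _ _ _ _ _ _ s Hid' (mellin_infty a2 U s HU Ha) (mellin_csum_infty P N s H0 HN) (mellin_infty L2 W s HL2 (proj2 Hs))).
ring.
Qed.

(** The equation [alpha s + beta + k = 0] forces the height [- Im beta / alpha], whatever [k] is.
    Replacing [s] by [delta - s] and [beta] by its conjugate gives the same heights. *)
Lemma gamma_factor_poles_bounded : exists T, 0 < T /\ forall s, T < Rabs (Im s) ->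
  (forall i, (i < r)%nat -> not_pole (RtoC (alpha i) * s + beta i)%C) /\
  (forall i, (i < r)%nat -> not_pole (RtoC (alpha i) * (RtoC delta - s) + bbeta i)%C).
Proof.
assert (HT : exists T, 0 < T /\ forall i, (i < r)%nat -> Rabs (Im (beta i)) <= alpha i * T).
{ clear -alpha_pos. induction r as [|q IH].
  - exists 1. split. lra. intros; lia.
  - destruct IH as [T [T0 HT]]. intros; apply alpha_pos; lia.
    exists (Rmax T (Rabs (Im (beta q)) / alpha q)). split. eapply Rlt_le_trans; [exact T0 | apply Rmax_l].
    intros i Hi. pose proof (alpha_pos i Hi). destruct (Nat.eq_dec i q) as [->|].
    + apply Rle_trans with (alpha q * (Rabs (Im (beta q)) / alpha q)). right; field; lra.
      apply Rmult_le_compat_l. lra. apply Rmax_r.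
    + eapply Rle_trans. apply HT; lia. apply Rmult_le_compat_l. lra. apply Rmax_l. }
destruct HT as [T [T0 HT]]. exists T. split; auto. intros s Hs.
assert (Hne : forall i, (i < r)%nat -> alpha i * Im s + Im (beta i) <> 0).
{ intros i Hi E. specialize (HT i Hi). pose proof (alpha_pos i Hi) as Ha.
  replace (Im (beta i)) with (- (alpha i * Im s)) in HT by lra.
  rewrite Rabs_Ropp, Rabs_mult, (Rabs_pos_eq (alpha i)) in HT by lra. nra. }
split; intros i Hi; apply not_pole_im; specialize (Hne i Hi); simpl; unfold Im in *; lra.
Qed.

Lemma right_side_Cd s : sigma_a < Re s -> (forall i, (i < r)%nat -> not_pole (RtoC (alpha i) * s + beta i)%C) -> Cd right_side s.
Proof.
intros Hs Hp. apply Cd_mult. now apply gamma_factor_Cd. apply (dirichlet_Cd a lam sigma_a); auto.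
Qed.

Lemma left_side_Cd s : Re s < delta - sigma_b -> (forall i, (i < r)%nat -> not_pole (RtoC (alpha i) * (RtoC delta - s) + bbeta i)%C) -> Cd left_side s.
Proof.
intros Hs Hp. apply Cd_mult. apply left_kernel_Cd. now apply gamma_factor_Cd.
apply (Cd_comp (dirichlet bb mu)). apply Cd_delta_minus. apply (dirichlet_Cd bb mu sigma_b mu_infty abscissa_bb). rewrite Re_delta_minus. lra.
Qed.

Lemma csum_Cd (f : nat -> C -> C) N s : (forall k, (k < N)%nat -> Cd (f k) s) -> Cd (fun s => csum (fun k => f k s) N) s.
Proof.
induction N as [|N IH]; intros H; simpl. apply Cd_const. apply Cd_plus. apply IH; intros; apply H; lia. apply H; lia.
Qed.

Hypothesis delta_pos : 0 < delta.
Hypothesis P1_residual : residual_function P1.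

(* The singularities of the polynomial part and of the continuation given by
   [P1] have bounded imaginary part. *)
Lemma common_continuation : exists (B T : R) (tot : C -> C), 0 < B /\ B < T /\
  - B < sigma_a < B /\ - B < delta - sigma_b < B /\
  (forall s, T < Rabs (Im s) ->
    (forall i, (i < r)%nat -> not_pole (RtoC (alpha i) * s + beta i)%C) /\
    (forall i, (i < r)%nat -> not_pole (RtoC (alpha i) * (RtoC delta - s) + bbeta i)%C)) /\
  (forall s, - B <= Re s <= B -> T < Rabs (Im s) -> Cd tot s) /\
  (forall s, sigma_a < Re s <= B -> T < Rabs (Im s) -> tot s = U s) /\
  (forall s, - B <= Re s < delta - sigma_b -> T < Rabs (Im s) -> tot s = W s).
Proof.
destruct P1_residual as [_ [c0 [Hc0 [_ [_ [K1 [chi1 [[HK1 [_ [_ [Hhol [Hr Hl]]]]] _]]]]]]]].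
destruct (Ccompact_bounded K1 HK1) as [R1 HR1].
destruct gamma_factor_poles_bounded as [T1 [HT1 Hpoles]].
destruct mellin_identity as [theta [N0 [Ht Hid]]].
(* [B] exceeds every abscissa in play: [c] and [sigma_a] so that [a1] and [a2] are admissible lines,
   and [c0] so that [chi1] is given by the Mellin integrals of [P1] beyond [B] and [- B]. *)
set (B := 1 + Rabs sigma_a + Rabs sigma_b + delta + c + c0).
pose proof (Rabs_pos sigma_a). pose proof (Rabs_pos sigma_b).
pose proof (Rle_abs sigma_a). pose proof (Rle_abs (- sigma_a)). pose proof (Rle_abs sigma_b). pose proof (Rle_abs (- sigma_b)).
rewrite Rabs_Ropp in *.
destruct (nat_above (B + 2)) as [N1 HN1]. set (N := max N0 N1).
assert (HN : B + 2 < INR N) by (eapply Rlt_le_trans; [exact HN1 | apply le_INR; unfold N; lia]).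
(* Both lines lie strictly between the poles [- N] and [1 - N]. The strip between them is where
   [left_equation] will give [W]. *)
set (L := - INR N + theta). set (L2 := - INR N + (theta + 1) / 2).
destruct (Hid N ltac:(unfold N; lia)) as [P HP]; [unfold B in HN; lra | unfold B in HN; lra |]. fold L in HP.
set (a1 := B + 1). set (a2 := B + 2).
(* Above this height there are no points of [K1] (by [R1]) and no poles of the Gamma factors (by
   [T1]); and [T] exceeds [B]. *)
set (T := B + 1 + Rabs R1 + T1).
pose proof (Rabs_pos R1). pose proof (Rle_abs R1).
set (tot := fun s => (cauchy_line a2 U s - cauchy_line L W s + chi1 s + csum (fun k => P k / (s + RtoC (INR k))) N)%C).
assert (HK : forall s, T < Rabs (Im s) -> ~ K1 s).
{ intros s Hs Ks. apply HR1 in Ks. pose proof (Rabs_Im_le_Cmod s). unfold T in Hs. unfold B in Hs. lra. }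
assert (HWs : strip_ok W L L2).
{ apply left_strip. unfold L2, B in *; lra. unfold L2, B in *; lra.
  intros x t X k. apply line_neq_nat. simpl. intros E.
  assert (E1 : INR N - 1 < INR k < INR N) by (unfold L, L2 in X; lra). destruct E1 as [E1 E2]. apply INR_lt in E2.
  assert (INR k + 1 <= INR N) by (rewrite <- S_INR; apply le_INR; lia). lra. }
assert (HWL : decays4 (fun t => W (L, t))) by (apply (strip_line W L L2); auto; unfold L, L2; lra).
assert (HUs : strip_ok U a1 a2) by (apply right_strip; unfold a1, B; lra).
assert (HUa : decays4 (fun t => U (a2, t))) by (apply (strip_line U a1 a2); auto; unfold a1, a2; lra).
assert (Htot : forall s, L < Re s < a2 -> T < Rabs (Im s) -> Cd tot s).
{ intros s Hs Hi. unfold tot. apply Cd_plus. apply Cd_plus. apply Cd_minus.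
  - apply cauchy_line_Cd; auto. lra.
  - apply cauchy_line_Cd; auto. lra.
  - apply Cd_ex_derive. apply Hhol. now apply HK.
  - apply (csum_Cd (fun k s => P k / (s + RtoC (INR k)))%C). intros k _. apply Cd_div. apply Cd_const.
    apply Cd_plus. apply Cd_id. apply Cd_const. apply not_pole_im. intros E. rewrite E, Rabs_R0 in Hi. unfold T, B in Hi. lra. }
assert (HiT1 : forall s, T < Rabs (Im s) -> T1 < Rabs (Im s)) by (intros s Hs; unfold T, B in Hs; lra).
assert (HG : forall s, T < Rabs (Im s) -> Cd Gamma s).
{ intros s Hs. apply Gamma_Cd, not_pole_im. intros E. rewrite E, Rabs_R0 in Hs. unfold T, B in Hs. lra. }
exists B, T, tot. split; [unfold B; lra|]. split; [unfold T; lra|]. split; [unfold B; lra|]. split; [unfold B; lra|].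
split; [intros s Hs; now apply Hpoles, HiT1|]. split; [|split].
- intros s Hs Hi. apply Htot; auto. unfold L, a2. lra.
- intros s Hs Hi.
  (* [right_equation] gives the equality between [a1] and [a2]; [region_identity] carries it left as
     far as [sigma_a], at each height above [T]. *)
  assert (E : (tot s - U s)%C = 0%C).
  { apply (region_identity (fun s => tot s - U s)%C sigma_a a2 a1 a2 T); auto; try (unfold a1, a2, B; lra).
    - intros w Hw Hwi. apply Cd_minus. apply Htot; auto. unfold L, B in *; lra.
      apply Cd_mult. now apply HG. apply right_side_Cd. lra. now apply Hpoles, HiT1.
    - intros w Hw Hwi.
      rewrite (right_equation P N L a1 a2 w); auto; try (unfold a1, L, B in *; lra).
      + unfold tot. rewrite Hr. ring. now apply HK. unfold a1, B in Hw; lra.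
      + intros x Hx. apply HP; auto; unfold a1, B; lra.
    - unfold a2. lra. }
  replace (tot s) with (tot s - U s + U s)%C by ring. rewrite E; ring.
- intros s Hs Hi.
  assert (E : (tot s - W s)%C = 0%C).
  { apply (region_identity (fun s => tot s - W s)%C L (delta - sigma_b) L L2 T); auto; try (unfold L, L2, B in *; lra).
    - intros w Hw Hwi. apply Cd_minus. apply Htot; auto. unfold a2, B in *; lra.
      apply Cd_mult. now apply HG. apply left_side_Cd. lra. now apply Hpoles, HiT1.
    - intros w Hw Hwi.
      rewrite (left_equation P N L L2 a2 w); auto; try (unfold a2, L2, L, B in *; lra).
      + unfold tot. rewrite Hl. ring. now apply HK. unfold L2, B in *; lra.
      + intros x Hx. apply HP; auto; unfold a2, B; lra. }
  replace (tot s) with (tot s - W s + W s)%C by ring. rewrite E; ring.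
Qed.

Lemma main_continuation :
  exists (K : C -> Prop) (chi : C -> C),
    continues_outside K chi
      (fun s => sigma_a < Re s)
      (fun s => Rcpow Q s * completed r alpha beta a lam s)%C
      (fun s => Re s < delta - sigma_b)
      (fun s => omega * Rcpow Q (RtoC delta - s)
                * Cconj (completed r alpha beta b mu (RtoC delta - Cconj s)))%C.
Proof.
destruct common_continuation as [B [T [tot [HB [HBT [Ha [Hb [Hpoles [Htot [HR HL]]]]]]]]]].
(* [tot / Gamma] is under control only in the band [Rabs (Re s) <= B] above height [T]. Beyond the
   band the Dirichlet series themselves define [chi], also near the real axis. *)
pose (chi := fun s : C => if Rlt_dec B (Re s) then (Rcpow Q s * right_side s)%C
   else if Rlt_dec (Re s) (- B) then (Rcpow Q s * left_side s)%C else (Rcpow Q s * (tot s / Gamma s))%C).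
exists (square T), chi.
(* Because [B < T], a point of the band can leave the square in the vertical direction only. *)
assert (Hout : forall s, ~ square T s -> - B <= Re s <= B -> T < Rabs (Im s)).
{ intros s Hs Hr. destruct (Rlt_or_le T (Rabs (Im s))); auto. exfalso. apply Hs. split; auto. apply Rabs_le; lra. }
assert (HGn : forall s, T < Rabs (Im s) -> Gamma s <> 0%C).
{ intros s Hs. apply Gamma_neq_0, not_pole_im. intros E. rewrite E, Rabs_R0 in Hs. lra. }
assert (Hright : forall s, ~ square T s -> sigma_a < Re s -> chi s = (Rcpow Q s * right_side s)%C).
{ intros s Hs Hr. unfold chi. destruct (Rlt_dec B (Re s)); auto. destruct (Rlt_dec (Re s) (- B)). lra.
  assert (Hi := Hout s Hs ltac:(lra)). rewrite HR by (auto; lra). f_equal. unfold U. field. auto. }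
assert (Hleft : forall s, ~ square T s -> Re s < delta - sigma_b -> chi s = (Rcpow Q s * left_side s)%C).
{ intros s Hs Hr. unfold chi. destruct (Rlt_dec B (Re s)). lra. destruct (Rlt_dec (Re s) (- B)); auto.
  assert (Hi := Hout s Hs ltac:(lra)). rewrite HL by (auto; lra). f_equal. unfold W. field. auto. }
assert (Hnb : forall s, ~ square T s -> exists d, 0 < d /\ forall w, Cmod (w - s) < d -> ~ square T w).
{ intros s Hs. destruct (square_complement_open T s Hs) as [d Hd]. exists d. split. apply cond_pos.
  intros w Hw. apply Hd. now apply C_NormedModule_mixin_compat1. }
assert (Hre : forall s w d, Cmod (w - s) < d -> Rabs (Re w - Re s) < d).
{ intros s w d Hw. eapply Rle_lt_trans; [|exact Hw]. apply (re_le_Cmod (w - s)). }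
assert (HQ : forall s, Cd (fun s => Rcpow Q s) s) by (intros s; apply Cd_Rcpow, Cd_id).
split; [apply square_compact|]. split; [apply square_complement_open|].
split; [apply square_complement_connected; lra|]. split; [|split].
- intros s Hs. apply Cd_ex_derive. destruct (Hnb s Hs) as [d [Hd Hw]].
  (* On the two open half-planes [chi] coincides with an explicit product. The remaining points have
     [delta - sigma_b <= Re s <= sigma_a], hence lie strictly inside the band, away from the seams
     of the definition. *)
  destruct (Rlt_or_le (sigma_a) (Re s)) as [H1|H1]; [|destruct (Rlt_or_le (Re s) (delta - sigma_b)) as [H2|H2]].
  + apply (Cd_ext (fun s => Rcpow Q s * right_side s)%C chi s (Rmin d (Re s - sigma_a))). apply Rmin_pos; lra.
    * intros w W1. apply Rmin_Rgt in W1. destruct W1 as [W1 W2]. symmetry. apply Hright. now apply Hw.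
      apply Hre in W2. apply Rabs_def2 in W2. lra.
    * apply Cd_mult; auto. apply right_side_Cd; auto.
      destruct (Rlt_or_le T (Rabs (Im s))) as [Hi|Hi]. now apply Hpoles.
      (* Outside the square with small imaginary part means [Rabs (Re s) > T > B], and
         [Re s > sigma_a > - B] decides the sign. The Gamma factors are then free of poles by
         positivity. *)
      assert (0 < Re s). { destruct (Rlt_or_le 0 (Re s)); auto. exfalso. apply Hs. split; auto. apply Rabs_le; lra. }
      intros i Hi'. apply not_pole_pos, Re_affine_pos; auto.
  + apply (Cd_ext (fun s => Rcpow Q s * left_side s)%C chi s (Rmin d (delta - sigma_b - Re s))). apply Rmin_pos; lra.
    * intros w W1. apply Rmin_Rgt in W1. destruct W1 as [W1 W2]. symmetry. apply Hleft. now apply Hw.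
      apply Hre in W2. apply Rabs_def2 in W2. lra.
    * apply Cd_mult; auto. apply left_side_Cd; auto.
      destruct (Rlt_or_le T (Rabs (Im s))) as [Hi|Hi]. now apply Hpoles.
      (* Likewise, [Re s < delta - sigma_b < B] leaves only negative real parts outside the
         square. *)
      assert (Re s < delta).
      { destruct (Rlt_or_le (Re s) 0); [lra|]. exfalso. apply Hs. split; auto. apply Rabs_le; lra. }
      intros i Hi'. apply not_pole_pos, Re_affine_pos; auto. now apply bbeta_nonneg. rewrite Re_delta_minus. lra.
  + assert (Hi := Hout s Hs ltac:(lra)).
    apply (Cd_ext (fun s => Rcpow Q s * (tot s / Gamma s))%C chi s (Rmin (Re s + B) (B - Re s))). apply Rmin_pos; lra.
    * intros w W1. apply Rmin_Rgt in W1. destruct W1 as [W1 W2]. apply Hre in W1. apply Hre in W2.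
      apply Rabs_def2 in W1. apply Rabs_def2 in W2. unfold chi. destruct (Rlt_dec B (Re w)). lra. destruct (Rlt_dec (Re w) (- B)). lra. auto.
    * apply Cd_mult; auto. apply Cd_div. apply Htot; auto; lra. apply Gamma_Cd, not_pole_im. intros E. rewrite E, Rabs_R0 in Hi. lra.
      now apply HGn.
- intros s Hs Hr. rewrite completed_eq. now apply Hright.
- intros s Hs Hr. rewrite functional_side_eq by auto. now apply Hleft.
Qed.

End Main.

Theorem theorem1p5
  (lam mu : nat -> R) (a b : nat -> C) (sigma_a sigma_b : R)
  (r : nat) (alpha : nat -> R) (beta : nat -> C)
  (Q delta : R) (omega : C) (P1 : R -> C) (c : R)
  (lam_pos : forall n, 0 < lam n) (mu_pos : forall n, 0 < mu n)
  (lam_incr : forall n, lam n < lam (S n))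
  (mu_incr : forall n, mu n < mu (S n))
  (lam_infty : is_lim_seq lam p_infty) (mu_infty : is_lim_seq mu p_infty)
  (a_nonzero : exists n, a n <> RtoC 0) (b_nonzero : exists n, b n <> RtoC 0)
  (abscissa_a : abscissa_abs a lam = Finite sigma_a)
  (abscissa_b : abscissa_abs b mu = Finite sigma_b)
  (alpha_pos : forall i, (i < r)%nat -> 0 < alpha i)
  (beta_nonneg : forall i, (i < r)%nat -> 0 <= Re (beta i))
  (Q_pos : 0 < Q) (omega_unit : Cmod omega = 1) (delta_pos : 0 < delta)
  (P1_residual : residual_function P1)
  (* the line Re s = c must avoid the poles of Gamma (delta - s) *)
  (c_pos : 0 < c) (c_regular : forall k : nat, c <> delta + INR k)
  (modular_relation : forall x : R, 0 < x ->
     exists S T : C,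
       is_series (V := C_NormedModule)
         (fun n => a n * Yfun r alpha beta c (lam n * x))%C S /\
       is_series (V := C_NormedModule)
         (fun n => Cconj (b n)
                   * Xfun delta r alpha (fun i => Cconj (beta i)) c
                          (mu n / (Q ^ 2 * x)))%C T /\
       S = (P1 x + omega / RtoC (Rpower (x * Q) delta) * T)%C) :
  exists (K : C -> Prop) (chi : C -> C),
    continues_outside K chi
      (fun s => sigma_a < Re s)
      (fun s => Rcpow Q s * completed r alpha beta a lam s)%C
      (fun s => Re s < delta - sigma_b)
      (fun s => omega * Rcpow Q (RtoC delta - s)
                * Cconj (completed r alpha beta b mu (RtoC delta - Cconj s)))%C.
Proof.
now apply (main_continuation lam mu a b sigma_a sigma_b r alpha beta Q delta omega P1 c).
Qed.
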